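(* Let $\{f_1,\dots,f_N\}$ be an iterated function system of similarities on $\mathbb R^d$ with contraction ratios $\lambda_1,\dots,\lambda_N\in(0,1)$ satisfying the open set condition, with attractor $\Lambda$ and $s_0=\dim_H\Lambda$. Let $\alpha>0$ and let $\ell:\mathbb N\to\mathbb N$ be monotone increasing with $$\liminf_{n\to\infty}\frac{\ell(n)}{\log n}=\frac1\alpha .$$ Let $\mathbb P_p$ be the Bernoulli measure on $\Sigma=\{1,\dots,N\}^{\mathbb N}$ corresponding to a probability vector $p=(p_1,\dots,p_N)$ with $p_i>0$ for all $i$, and let $p_{\min}=\min_i p_i$. For $q\in\mathbb R$ let $P_\alpha(q)$ be the unique real number with $\sum_{i=1}^N\lambda_i^{P_\alpha(q)}(p_ie^\alpha)^q=1$. Then for $\mathbb P_p$-almost every $\mathbf o\in\Sigma$, the dynamical covering set $R(\mathbf o,\ell)$ satisfies $$\dim_H R(\mathbf o,\ell)=s(\alpha):=\inf_{q\in[0,1]}P_\alpha(q).$$ Furthermore, for $\mathbb P_p$-almost every $\mathbf o$: if $-\log p_{\min}>\alpha>-\sum_{i=1}^N\lambda_i^{s_0}\log p_i$, then $\mathcal H^{s_0}(R(\mathbf o,\ell))=\mathcal H^{s_0}(\Lambda)$ but $R(\mathbf o,\ell)\neq\Lambda$; and if $\alpha>-\log p_{\min}$, then $R(\mathbf o,\ell)=\Lambda$.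
   Context: A similarity $f_i$ with contraction ratio $\lambda_i$ satisfies $\|f_i(x)-f_i(y)\|=\lambda_i\|x-y\|$. The attractor $\Lambda$ is the unique non-empty compact set with $\Lambda=\bigcup_{i=1}^Nf_i(\Lambda)$. The open set condition: there is a non-empty bounded open set $U\subset\mathbb R^d$ with $f_i(U)\subset U$ for all $i$ and $f_i(U)\cap f_j(U)=\emptyset$ for $i\ne j$; then $s_0=\dim_H\Lambda$ is the unique solution of $\sum_i\lambda_i^{s_0}=1$. $\sigma$ is the left shift on $\Sigma=\{1,\dots,N\}^{\mathbb N}$; $\mathbf i|_n$ is the word of the first $n$ letters of $\mathbf i$; for a finite word $\mathbf i=(i_1,\dots,i_n)$, $f_{\mathbf i}=f_{i_1}\circ\cdots\circ f_{i_n}$ and $[\mathbf i]\subset\Sigma$ is the cylinder of sequences beginning with $\mathbf i$. The coding map is $\pi:\Sigma\to\Lambda$, $\pi(\mathbf i)=\lim_{n\to\infty}f_{\mathbf i|_n}(0)$. The dynamical covering set is $$R(\mathbf o,\ell)=\pi\Big(\bigcap_{k=1}^\infty\bigcup_{n=k}^\infty\big[(\sigma^n\mathbf o)|_{\ell(n)}\big]\Big)\subseteq\Lambda .$$ $\mathcal H^{s}$ denotes $s$-dimensional Hausdorff measure and $\dim_H$ Hausdorff dimension. *)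

(* Defs.v *)
From HB Require Import structures.
From mathcomp Require Import all_boot all_order all_algebra.
From mathcomp Require Import all_classical all_reals all_analysis.

Set Implicit Arguments.
Unset Strict Implicit.
Unset Printing Implicit Defensive.

Import Order.TTheory GRing.Theory Num.Theory.
Import numFieldNormedType.Exports.

Local Open Scope classical_set_scope.
Local Open Scope ring_scope.

(* The norm that the library puts on 'rV[R]_d is the sup norm; similarities and
   diameters are Euclidean notions.  The topology on 'rV[R]_d is the same for
   both norms. *)
Definition enorm (R : realType) (d : nat) (x : 'rV[R]_d) : R :=
  Num.sqrt (\sum_(j < d) x ord0 j ^+ 2).

Definition ebounded (R : realType) (d : nat) (U : set 'rV[R]_d) : Prop :=
  exists M : R, forall x, U x -> enorm x <= M.

(* [-oo] on the empty set. *)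
Definition diam (R : realType) (d : nat) (U : set 'rV[R]_d) : \bar R :=
  ereal_sup [set (enorm (z.1 - z.2))%:E | z in U `*` U].

(* The empty set contributes 0 for every s; a singleton contributes 0 ^ s,
   which is 1 for s = 0 since poweR x 0 = 1. *)
Definition hausdorff_term (R : realType) (d : nat) (s : R)
    (U : set 'rV[R]_d) : \bar R :=
  if U == set0 then 0%E else poweR (diam U) s.

Definition delta_cover (R : realType) (d : nat) (delta : R)
    (E : set 'rV[R]_d) (U : nat -> set 'rV[R]_d) : Prop :=
  E `<=` \bigcup_n U n /\ forall n, (diam (U n) <= delta%:E)%E.

Definition hausdorff_premeasure (R : realType) (d : nat) (s delta : R)
    (E : set 'rV[R]_d) : \bar R :=
  ereal_inf [set (\sum_(0 <= n <oo) hausdorff_term s (U n))%E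
            | U in delta_cover delta E].

Definition hausdorff_measure (R : realType) (d : nat) (s : R)
    (E : set 'rV[R]_d) : \bar R :=
  ereal_sup [set hausdorff_premeasure s delta E
            | delta in [set delta : R | 0 < delta]].

Definition hausdorff_dim (R : realType) (d : nat)
    (E : set 'rV[R]_d) : \bar R :=
  ereal_inf [set s%:E
            | s in [set s : R | 0 <= s /\ hausdorff_measure s E = 0%E]].

Definition similarity (R : realType) (d : nat) (f : 'rV[R]_d -> 'rV[R]_d)
    (r : R) : Prop :=
  forall x y, enorm (f x - f y) = r * enorm (x - y).

(* A system of N >= 1 maps is indexed by 'I_m.+1 with N = m.+1: the library's
   measurable types, among them the space of sequences of letters, are
   inhabited. *)
Definition open_set_condition (R : realType) (d m : nat)
    (f : 'I_m.+1 -> 'rV[R]_d -> 'rV[R]_d) : Prop :=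
  exists U : set 'rV[R]_d,
    [/\ U !=set0, ebounded U, open U,
        forall i, f i @` U `<=` U &
        forall i j, i != j -> (f i @` U) `&` (f j @` U) = set0].

Definition attractor (R : realType) (d m : nat)
    (f : 'I_m.+1 -> 'rV[R]_d -> 'rV[R]_d) (L : set 'rV[R]_d) : Prop :=
  [/\ L !=set0, compact L & L = \bigcup_(i in [set: 'I_m.+1]) (f i @` L)].

(* Makes [symbol_space] below a pointedType, as [g_sigma_algebraType] requires. *)
HB.instance Definition _ (m : nat) := isPointed.Build 'I_m.+1 ord0.

(* Letters are numbered from 0: the first letter of o is o 0. *)
Definition symbol_space (m : nat) : Type := nat -> 'I_m.+1.

Definition left_shift (m n : nat) (o : symbol_space m) : symbol_space m :=
  fun k => o (n + k)%N.

Definition initial_word (m : nat) (o : symbol_space m) (n : nat) :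
    seq 'I_m.+1 :=
  mkseq o n.

Definition cylinder (m : nat) (w : seq 'I_m.+1) : set (symbol_space m) :=
  [set o | initial_word o (size w) = w].

Definition cylinders (m : nat) : set (set (symbol_space m)) :=
  [set cylinder w | w in [set: seq 'I_m.+1]].

Definition word_map (T : Type) (m : nat) (f : 'I_m.+1 -> T -> T)
    (w : seq 'I_m.+1) : T -> T :=
  fun x => foldr f x w.

Definition coding (R : realType) (d m : nat)
    (f : 'I_m.+1 -> 'rV[R]_d -> 'rV[R]_d) (o : symbol_space m) : 'rV[R]_d :=
  lim ((fun n : nat => word_map f (initial_word o n) 0) @ \oo).

Definition covering_set (R : realType) (d m : nat)
    (f : 'I_m.+1 -> 'rV[R]_d -> 'rV[R]_d) (o : symbol_space m)
    (l : nat -> nat) : set 'rV[R]_d :=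
  coding f @`
    \bigcap_(k in [set k | (1 <= k)%N]) \bigcup_(n in [set n | (k <= n)%N])
      cylinder (initial_word (left_shift n o) (l n)).

(* By the pi-lambda theorem the values on cylinders determine a unique
   probability measure on the sigma-algebra that they generate. *)
Definition bernoulli_measure (R : realType) (m : nat) (p : 'I_m.+1 -> R)
    (P : probability (g_sigma_algebraType (@cylinders m)) R) : Prop :=
  forall w : seq 'I_m.+1, P (cylinder w) = (\prod_(i <- w) p i)%:E.

Definition pmin (R : realType) (m : nat) (p : 'I_m.+1 -> R) : R :=
  \big[Order.min/p ord0]_(i < m.+1) p i.

(* The value of [get] is the unique solution t. *)
Definition pressure (R : realType) (m : nat) (lam p : 'I_m.+1 -> R)
    (alpha q : R) : R :=
  get [set t : R |
    \sum_(i < m.+1) lam i `^ t * (p i * expR alpha) `^ q = 1].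

Definition dim_formula (R : realType) (m : nat) (lam p : 'I_m.+1 -> R)
    (alpha : R) : R :=
  inf [set pressure lam p alpha q | q in [set q : R | 0 <= q <= 1]].

(* Main.v *)
Require Import Defs.
From HB Require Import structures.
From mathcomp Require Import all_boot all_order all_algebra.
From mathcomp Require Import all_classical all_reals all_analysis.
From mathcomp Require Import lra ring zify.

(** Let [c] be a code.  The point [coding f c] belongs to the covering set of
    [o] when, for infinitely many [n], the first [l n] letters of [c] stand in
    [o] from place [n] on.  The growth condition on [l] says how many chances a
    word of length [K] has: every place asking for [K] letters lies before
    [C * expR (a * K)] for each [a > alpha] ([lengths_ge]), while for each
    [a < alpha] there are arbitrarily large [K] such that none of the first
    [expR (a * K)] blocks of length [K] asks for more than [K] letters
    ([many_trials]).  So a word [w] of length [K] and probability [p_w] is met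
    with probability about [min 1 (p_w * expR (alpha * K))].

    Upper bound ([covering_set_measure_eq0]).  The pieces of the attractor whose
    words are met cover the covering set.  Since [min 1 x <= x `^ q] for
    [0 <= q <= 1], the expectation of the sum of [ratio w `^ s] over the words
    of length [K] that are met is at most a constant times
    [(\sum_i lam i `^ s * (p i * expR a) `^ q) ^+ K].  If [s] exceeds the
    pressure at some [q], this decays geometrically for [a] close to [alpha];
    the Markov inequality and the Borel-Cantelli lemma finish.

    Lower bound ([covering_set_measure_neq0]).  If [t] is smaller than all
    pressures, then [\sum_i lam i `^ t * (p i * expR alpha) `^ q > 1] for all
    [q] in [0, 1].  At the minimising [q] the normalised summands are weights
    under which typical words satisfy
    [min 1 (p_w * expR (alpha * n)) >= (p_w * expR (alpha * n)) `^ q], up to a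
    factor [expR (- eta * n)].  As there are only polynomially many letter
    counts, the rearrangements of one word [w0], of length [B], already satisfy
    [N * (ratio w0 `^ t * min 1 (p_w0 * expR (alpha * B))) > 1], where [N] is
    their number ([balanced_type]).  They form a homogeneous subsystem: all
    its maps have the same ratio and the same probability.  Among many random
    blocks, the ones that are words over this subsystem are spread evenly over
    all prefixes, by Chernoff bounds ([random_hits_spread]).  Restarting the
    count of hits at a sequence of rapidly increasing lengths gives a mass on
    the tree of words ([cantor_mass]) which lives on points of the covering set
    and satisfies a Frostman bound.  Under the open set condition such a mass
    forces positive Hausdorff measure ([mass_distribution]).

    Covering by all words of a given length, and the mass distribution argument
    with uniform mass on a homogeneous subsystem, give
    [\sum_i lam i `^ s0 = 1] ([moran]).

    Full measure ([covering_set_full_measure]).  Give a word the natural weight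
    [ratio w `^ s0].  By the law of large numbers most words for this weight
    have probability about [expR (- c * K)], where
    [c = - \sum_i lam i `^ s0 * ln (p i)]; if [c < alpha], they are almost
    certainly met, so the weight of the missing words tends to 0 along a
    sequence of lengths, and the missing words cover the part of the attractor
    outside of the covering set.

    The whole attractor.  Every word of length [K] has probability at least
    [pmin p ^+ K].  If [- ln (pmin p) < alpha], then all words are met
    ([covering_set_full]).  If [alpha < - ln (pmin p)], then the runs of a
    letter [i] with [p i = pmin p] are too rare, so the fixed point of [f i] is
    missed, because it has only one code ([covering_set_not_full]). *)

Set Implicit Arguments.
Unset Strict Implicit.
Unset Printing Implicit Defensive.

Import Order.TTheory GRing.Theory Num.Theory.
Import numFieldNormedType.Exports.

Local Open Scope classical_set_scope.
Local Open Scope ring_scope.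

(** * Words over a finite list of letters *)

(** The alphabet is a list, so that a set of words can serve as the alphabet of
    another set of words. *)
Fixpoint words (T : Type) (A : seq T) (n : nat) : seq (seq T) :=
  if n is n'.+1 then [seq a :: w | a <- A, w <- words A n'] else [:: [::]].

Lemma mem_words (T : eqType) (A : seq T) n (w : seq T) :
  (w \in words A n) = (size w == n) && all [in A] w.
Proof.
elim: n w => [|n IH] [|a w] //=.
- by apply/negP => /allpairsP[[x y] /= []].
- rewrite eqSS; apply/allpairsP/idP.
    by case=> -[x y] /= [xA]; rewrite IH => /andP[/eqP <- yA] [-> ->]; rewrite eqxx xA.
  case/andP=> sw /andP[aA wA]; exists (a, w); split=> //=.
  by rewrite IH sw.
Qed.

Lemma size_mem_words (T : eqType) (A : seq T) n w : w \in words A n -> size w = n.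
Proof. by rewrite mem_words => /andP[/eqP]. Qed.

Lemma mem_words_enum (T : finType) n (w : seq T) :
  (w \in words (enum T) n) = (size w == n).
Proof.
rewrite mem_words; case: eqP => //= _; apply/allP => a _; exact: mem_enum.
Qed.

Lemma uniq_words (T : eqType) (A : seq T) n : uniq A -> uniq (words A n).
Proof.
move=> uA; elim: n => //= n IH.
by apply: allpairs_uniq => // -[a v] [b w] _ _ /= [-> ->].
Qed.

Lemma size_words (T : Type) (A : seq T) n : size (words A n) = (size A ^ n)%N.
Proof. by elim: n => //= n IH; rewrite size_allpairs IH expnS. Qed.

Section SumWords.
Variables (V : nmodType) (T : Type) (A : seq T).
Implicit Types F : seq T -> V.

Lemma sum_wordsS n F : \sum_(w <- words A n.+1) F w =
  \sum_(a <- A) \sum_(w <- words A n) F (a :: w).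
Proof. by rewrite /= big_allpairs_dep. Qed.

Lemma sum_words_cat m n F : \sum_(w <- words A (m + n)) F w =
  \sum_(u <- words A m) \sum_(v <- words A n) F (u ++ v).
Proof.
elim: m F => [|m IH] F; first by rewrite big_seq1.
by rewrite addSn !sum_wordsS; apply: eq_bigr => a _; rewrite IH.
Qed.

End SumWords.

Lemma sum_words_flatten (V : nmodType) (T : Type) (A : seq T) n B (F : seq T -> V) : \sum_(w <- words A (n * B)) F w =
  \sum_(v <- words (words A B) n) F (flatten v).
Proof.
elim: n F => [|n IH] F; first by rewrite !big_seq1.
rewrite mulSn sum_words_cat sum_wordsS; apply: eq_bigr => u _.
by rewrite IH; apply: eq_bigr => v _.
Qed.

(** This is the expansion of a power of a sum: summing a multiplicative weight
    over all words of a given length gives a power. *)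
Lemma sum_words_prod (R : comNzRingType) (T : Type) (A : seq T) n (F : T -> R) :
  \sum_(w <- words A n) \prod_(a <- w) F a = (\sum_(a <- A) F a) ^+ n.
Proof.
elim: n => [|n IH]; first by rewrite big_seq1 big_nil.
rewrite sum_wordsS exprS -IH mulr_suml; apply: eq_bigr => a _.
by rewrite mulr_sumr; apply: eq_bigr => w _; rewrite big_cons.
Qed.

Lemma prod_flatten (R : comNzRingType) (T : Type) (v : seq (seq T)) (F : T -> R) :
  \prod_(w <- v) \prod_(a <- w) F a = \prod_(a <- flatten v) F a.
Proof. by elim: v => [|w v IH]; rewrite ?big_nil// big_cons big_cat IH. Qed.

Lemma ler_sum_mem (R : numDomainType) (T : eqType) (s : seq T) (P : pred T)
    (F G : T -> R) : (forall a, a \in s -> P a -> F a <= G a) ->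
  \sum_(a <- s | P a) F a <= \sum_(a <- s | P a) G a.
Proof.
by move=> h; rewrite big_seq_cond [leRHS]big_seq_cond; apply: ler_sum => a /andP[]; apply: h.
Qed.

Lemma ler_sum_pred (R : numDomainType) (T : eqType) (s : seq T) (P Q : pred T)
    (F : T -> R) : (forall a, a \in s -> P a -> Q a) ->
  (forall a, a \in s -> Q a -> 0 <= F a) ->
  \sum_(a <- s | P a) F a <= \sum_(a <- s | Q a) F a.
Proof.
move=> PQ F0; rewrite big_mkcond [leRHS]big_mkcond /=; apply: ler_sum_mem => a As _.
by case: ifPn => [/(PQ _ As) ->//|_]; case: ifPn => // /(F0 _ As).
Qed.

(** * Independent sequences of letters *)

Definition blocks (Om T : Type) (X : Om -> nat -> T) (B : nat) (o : Om) (j : nat) : seq T :=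
  mkseq (fun r => X o (j * B + r)%N) B.

Lemma flatten_blocks (Om T : Type) (X : Om -> nat -> T) B o n :
  flatten (mkseq (blocks X B o) n) = mkseq (X o) (n * B).
Proof.
elim: n => [|n IH] //.
rewrite /mkseq -addn1 iotaD map_cat flatten_cat [in LHS]/= cats0.
rewrite [flatten _]IH mulnDl mul1n /mkseq iotaD map_cat; congr (_ ++ _).
by rewrite /blocks /mkseq !add0n -[in RHS](addn0 (n * B)%N) iotaDl -map_comp.
Qed.

Section Iid.
Context d (Om : measurableType d) (R : realType) (P : probability Om R).

(** Independence of identically distributed letters, in the form in which it is
    used: an event about the first [n] terms has the probability that product
    weights give to it.  The form is stable under grouping terms into blocks. *)
Definition iid (T : eqType) (X : Om -> nat -> T) (A : seq T) (p : T -> R) :=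
  forall n (Q : pred (seq T)), measurable [set o | Q (mkseq (X o) n)] /\
    P [set o | Q (mkseq (X o) n)] =
      (\sum_(w <- words A n | Q w) \prod_(a <- w) p a)%:E.

Lemma iidP (T : eqType) (X : Om -> nat -> T) (A : seq T) (p : T -> R) n (Q : pred (seq T)) :
  iid X A p -> P [set o | Q (mkseq (X o) n)] =
      (\sum_(w <- words A n | Q w) \prod_(a <- w) p a)%:E.
Proof. by move=> /(_ n Q)[]. Qed.

Lemma iid_measurable (T : eqType) (X : Om -> nat -> T) (A : seq T) (p : T -> R) n
  (Q : pred (seq T)) : iid X A p -> measurable [set o | Q (mkseq (X o) n)].
Proof. by move=> /(_ n Q)[]. Qed.

(** An event about the first [n] terms is a finite disjoint union of cylinders. *)
Lemma iid_of_cylinders (T : finType) (X : Om -> nat -> T) (p : T -> R) :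
  (forall w, measurable [set o | mkseq (X o) (size w) = w] /\
    P [set o | mkseq (X o) (size w) = w] = (\prod_(a <- w) p a)%:E) ->
  iid X (enum T) p.
Proof.
move=> h n Q.
have key (s : seq (seq T)) : uniq s -> (forall w, w \in s -> size w = n) ->
    measurable [set o | mkseq (X o) n \in s] /\
    P [set o | mkseq (X o) n \in s] = (\sum_(w <- s) \prod_(a <- w) p a)%:E.
  elim: s => [|w s IH] /=.
    move=> _ _; rewrite big_nil (_ : [set _ | _] = set0) ?measure0; last first.
      by apply/seteqP; split => // o /=; rewrite in_nil.
    by split=> //; exact: measurable0.
  case/andP=> ws us sz; have /IH[//|ms Ps] : forall v, v \in s -> size v = n.
    by move=> v vs; apply: sz; rewrite inE vs orbT.
  have szw : size w = n by apply: sz; rewrite inE eqxx.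
  have [mw Pw] := h w; rewrite szw in mw Pw.
  have -> : [set o | mkseq (X o) n \in w :: s] =
      [set o | mkseq (X o) n = w] `|` [set o | mkseq (X o) n \in s].
    apply/seteqP; split => o /=; rewrite inE.
      by case/orP => [/eqP ->|]; [left|right].
    by case=> [->|->]; rewrite ?eqxx ?orbT.
  split; first exact: measurableU.
  rewrite big_cons EFinD -Ps -Pw; apply: measureU => //.
  by apply/seteqP; split => // o /= [ow os]; move: ws; rewrite -ow os.
have -> : [set o | Q (mkseq (X o) n)] =
    [set o | mkseq (X o) n \in [seq w <- words (enum T) n | Q w]].
  apply/seteqP; split => o /=; rewrite mem_filter mem_words_enum size_mkseq eqxx andbT //.
have [||m1 ->] := key [seq w <- words (enum T) n | Q w].
- by rewrite filter_uniq// uniq_words// enum_uniq.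
- by move=> w; rewrite mem_filter => /andP[_ /size_mem_words].
by split => //; rewrite big_filter.
Qed.

(** A word over blocks is the same thing as its concatenation, and the product
    weights agree. *)
Lemma iid_blocks (T : eqType) (X : Om -> nat -> T) (A : seq T) (p : T -> R) B :
  iid X A p -> iid (blocks X B) (words A B) (fun w => \prod_(a <- w) p a).
Proof.
move=> iX n Q.
pose Q' (w : seq T) := Q (reshape (nseq n B) w).
have rs (v : seq (seq T)) : size v = n -> all (fun w => size w == B) v ->
    reshape (nseq n B) (flatten v) = v.
  move=> <- sv; rewrite -[RHS]flattenK; congr (reshape _ _).
  by elim: v sv {Q'} => //= w v IH /andP[/eqP -> /IH ->].
have -> : [set o | Q (mkseq (blocks X B o) n)] = [set o | Q' (mkseq (X o) (n * B))].
  apply/seteqP; split => o /=; rewrite /Q' -flatten_blocks rs ?size_mkseq//.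
  - by apply/allP => w /mapP[j _ ->]; rewrite /blocks size_mkseq.
  - by apply/allP => w /mapP[j _ ->]; rewrite /blocks size_mkseq.
have [m1 ->] := iX (n * B)%N Q'.
split => //; congr EFin.
rewrite big_mkcond sum_words_flatten [RHS]big_mkcond.
rewrite big_seq [RHS]big_seq; apply: eq_bigr => v.
rewrite mem_words => /andP[/eqP sv /allP av].
rewrite /Q' rs//; last by apply/allP => w /av /= /size_mem_words ->.
by rewrite -prod_flatten.
Qed.

(** The exponential Markov inequality.  The indicator of [E] is at most
    [x ^+ count / z], whose expectation factorises over the terms.  The term of
    index 0 is not counted, since the trials of interest stand at positive
    multiples of the block length. *)
Lemma iid_tail (T : eqType) (X : Om -> nat -> T) (A : seq T) (p : T -> R)
    (S : pred T) (x z : R) M (E : pred (seq T)) :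
  iid X A p -> (forall a, 0 <= p a) -> \sum_(a <- A) p a = 1 ->
  0 <= x -> 0 < z -> (forall w, E w -> z <= x ^+ count S (behead w)) ->
  (P [set o | E (mkseq (X o) M.+1)] <=
    ((1 + (x - 1) * \sum_(a <- A | S a) p a) ^+ M / z)%:E)%E.
Proof.
move=> iX p0 p1 x0 z0 hE; rewrite (iidP _ _ iX) lee_fin.
have pw0 (w : seq T) : 0 <= \prod_(a <- w) p a by apply: prodr_ge0.
apply: (@le_trans _ _ (\sum_(w <- words A M.+1)
    \prod_(a <- w) p a * (x ^+ count S (behead w) / z))).
  rewrite big_mkcond /=; apply: ler_sum => w _; case: ifPn => [/hE hw|_].
    by rewrite ler_peMr// ler_pdivlMr// mul1r.
  by rewrite mulr_ge0// divr_ge0 ?exprn_ge0// ltW.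
rewrite sum_wordsS /=.
have -> : \sum_(a <- A) \sum_(w <- words A M)
    \prod_(b <- a :: w) p b * (x ^+ count S w / z) =
    \sum_(w <- words A M) \prod_(b <- w) (p b * x ^+ (S b)) / z.
  rewrite -[RHS]mul1r -[X in X * _]p1 mulr_suml; apply: eq_bigr => a _.
  rewrite mulr_sumr; apply: eq_bigr => w _.
  rewrite big_cons -!mulrA; congr (_ * _); rewrite mulrA; congr (_ / _).
  elim: w => [|b w IH]; first by rewrite !big_nil expr0 mulr1.
  by rewrite !big_cons /= exprD mulrACA IH.
rewrite -mulr_suml sum_words_prod ler_pM2r ?invr_gt0//.
suff -> : \sum_(b <- A) p b * x ^+ (S b) = 1 + (x - 1) * \sum_(a <- A | S a) p a by [].
rewrite -[X in X + _]p1 mulr_sumr [X in _ + X]big_mkcond -big_split /=.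
by apply: eq_bigr => b _; case: (S b); rewrite ?expr1 ?expr0 /=; ring.
Qed.

(** The exponential bound at [x = 0], where [x ^+ count] is the indicator of
    never seeing [S]. *)
Lemma iid_prob_miss (T : eqType) (X : Om -> nat -> T) (A : seq T) (p : T -> R)
    (S : pred T) M :
  iid X A p -> (forall a, 0 <= p a) -> \sum_(a <- A) p a = 1 ->
  (P [set o | ~~ has S (behead (mkseq (X o) M.+1))] <=
    (expR (- (M%:R * \sum_(a <- A | S a) p a)))%:E)%E.
Proof.
move=> iX p0 p1.
have a1 : \sum_(a <- A | S a) p a <= 1.
  by rewrite -p1; apply: ler_sum_pred.
have E w : ~~ has S (behead w) -> 1 <= (0 : R) ^+ count S (behead w).
  by rewrite has_count -eqn0Ngt => /eqP ->; rewrite expr0.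
apply: le_trans (iid_tail M (S := S) (E := fun w => ~~ has S (behead w)) iX p0 p1 (lexx _) ltr01 E) _.
rewrite lee_fin divr1 sub0r mulN1r -mulrN expRM_natl.
by rewrite lerXn2r ?nnegrE ?expR_ge0// ?expR_ge1Dx// subr_ge0.
Qed.

(** The exponential bound at [x = expR 1].  As [expR 1 - 1 <= 3], an expected
    count of at most [y / 6] contributes [expR (y / 2)] against [expR (- y)]. *)
Lemma iid_upper_tail (T : eqType) (X : Om -> nat -> T) (A : seq T) (p : T -> R)
    (S : pred T) M (y : R) :
  iid X A p -> (forall a, 0 <= p a) -> \sum_(a <- A) p a = 1 ->
  M%:R * \sum_(a <- A | S a) p a <= y / 6 ->
  (P [set o | (y <= (count S (behead (mkseq (X o) M.+1)))%:R)%R] <=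
    (expR (- (y / 2)))%:E)%E.
Proof.
move=> iX p0 p1 hy.
have a0 : 0 <= \sum_(a <- A | S a) p a by apply: sumr_ge0.
have E w : y <= (count S (behead w))%:R -> expR y <= expR 1 ^+ count S (behead w).
  by move=> h; rewrite -expRM_natl ler_expR mulr1.
apply: le_trans (iid_tail M (S := S) (E := fun w => (y <= (count S (behead w))%:R)%R) iX p0 p1 (expR_ge0 _) (expR_gt0 _) E) _.
(* Inverse of the square of the bound 1 - 1 / 2 <= expR (- 1 / 2). *)
have e4 : expR (1 : R) <= 4.
  have h : expR (- (1 / 2 : R)) >= 1 / 2.
    by apply: le_trans (expR_ge1Dx _); lra.
  have h2 : expR (1 : R) * (expR (- (1 / 2)) ^+ 2) = 1.
    by rewrite -expRM_natl -expRD -[RHS](expR0 R); congr expR; lra.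
  have h3 : expR (- (1 / 2 : R)) ^+ 2 >= 1 / 4.
    by rewrite expr2; nra.
  have e0 := expR_gt0 (1 : R); nra.
rewrite lee_fin -expRN; set a := (X in 1 + _ * X).
apply: (@le_trans _ _ (expR (M%:R * (3 * a)) * expR (- y))).
  rewrite ler_wpM2r ?expR_ge0// expRM_natl lerXn2r ?nnegrE ?expR_ge0//.
    rewrite addr_ge0// mulr_ge0// subr_ge0; apply: le_trans (expR_ge1Dx _); lra.
  apply: le_trans (expR_ge1Dx _); rewrite lerD2l ler_wpM2r//; lra.
rewrite -expRD ler_expR; move: hy; rewrite -/a; lra.
Qed.

(** The exponential bound at [x = expR (- 1)].  As [1 - expR (- 1) >= 5 / 9],
    the exponent is at most [y / 2 - 5 / 9 * y = - y / 18]. *)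
Lemma iid_lower_tail (T : eqType) (X : Om -> nat -> T) (A : seq T) (p : T -> R)
    (S : pred T) M (y : R) :
  iid X A p -> (forall a, 0 <= p a) -> \sum_(a <- A) p a = 1 ->
  y = M%:R * \sum_(a <- A | S a) p a ->
  (P [set o | ((count S (behead (mkseq (X o) M.+1)))%:R <= y / 2)%R] <=
    (expR (- (y / 18)))%:E)%E.
Proof.
move=> iX p0 p1 hy.
have a0 : 0 <= \sum_(a <- A | S a) p a by apply: sumr_ge0.
have a1 : \sum_(a <- A | S a) p a <= 1.
  by rewrite -p1; apply: ler_sum_pred.
have E w : (count S (behead w))%:R <= y / 2 ->
    expR (- (y / 2)) <= expR (-1) ^+ count S (behead w).
  by move=> h; rewrite -expRM_natl ler_expR; lra.
apply: le_trans (iid_tail M (S := S) (E := fun w => ((count S (behead w))%:R <= y / 2)%R) iX p0 p1 (expR_ge0 _) (expR_gt0 _) E) _.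
(* Inverse of the square of the bound 1 + 1 / 2 <= expR (1 / 2). *)
have e4 : expR (-1 : R) <= 4 / 9.
  have h : expR ((1 / 2 : R)) >= 3 / 2.
    by apply: le_trans (expR_ge1Dx _); lra.
  have h2 : expR (-1 : R) * (expR ((1 / 2)) ^+ 2) = 1.
    by rewrite -expRM_natl -expRD -[RHS](expR0 R); congr expR; lra.
  have h3 : expR ((1 / 2 : R)) ^+ 2 >= 9 / 4.
    by rewrite expr2; nra.
  have e0 := expR_gt0 (-1 : R); nra.
have e0 := expR_gt0 (-1 : R).
rewrite lee_fin -expRN opprK; set a := (X in 1 + _ * X).
apply: (@le_trans _ _ (expR (M%:R * (- (5 / 9) * a)) * expR (y / 2))).
  rewrite ler_wpM2r ?expR_ge0// expRM_natl lerXn2r ?nnegrE ?expR_ge0//.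
    by rewrite /a; nra.
  by apply: le_trans (expR_ge1Dx _); rewrite /a; nra.
rewrite -expRD ler_expR; move: hy; rewrite -/a; lra.
Qed.

(** * Almost sure events *)

(** Choose bad events of probability less than every [1 / n.+1]: their
    intersection is null, and outside of it one of them fails. *)
Lemma ae_frequently (I : Type) (g : I -> nat) (Bad : I -> set Om) :
  (forall i, measurable (Bad i)) ->
  (forall (K : nat) (e : R), 0 < e ->
     exists i, (K <= g i)%N /\ (P (Bad i) <= e%:E)%E) ->
  {ae P, forall o, forall K : nat, exists i, (K <= g i)%N /\ ~ Bad i o}.
Proof.
move=> mB h; apply: ae_foralln => K.
have /choice[i hi] n : exists i, (K <= g i)%N /\ (P (Bad i) <= (n.+1%:R^-1)%:E)%E.
  by apply: h; rewrite invr_gt0.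
exists (\bigcap_n Bad (i n)); split.
- by apply: bigcap_measurable => //; exists 0%N.
- apply/eqP; rewrite eq_le measure_ge0 andbT; apply/lee_addgt0Pr => e e0.
  rewrite add0e; have [n ne] : exists n : nat, n.+1%:R^-1 < e.
    have [n _ hn] := near_infty_natSinv_lt (PosNum e0).
    by exists n; apply: hn => /=.
  apply: (@le_trans _ _ (P (Bad (i n)))).
    apply: le_measure; rewrite ?inE//; first by apply: bigcap_measurable => //; exists 0%N.
    by apply: bigcap_inf.
  by apply: le_trans (hi n).2 _; rewrite lee_fin ltW.
- move=> o /= no n _; apply: contrapT => nB; apply: no.
  by exists (i n); split=> //; exact: (hi n).1.
Qed.

(** The Borel-Cantelli lemma, for a geometric bound. *)
Lemma ae_eventually (Bad : nat -> set Om) (C q : R) :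
  (forall n, measurable (Bad n)) -> 0 <= q < 1 ->
  (forall n, (P (Bad n) <= (C * q ^+ n)%:E)%E) ->
  {ae P, forall o, exists N, forall n, (N <= n)%N -> ~ Bad n o}.
Proof.
move=> mB /andP[q0 q1] h.
have mL : measurable (lim_sup_set Bad).
  by apply: bigcap_measurable => [|n _]; [exists 0%N|apply: bigcup_measurable].
exists (lim_sup_set Bad); split => //.
- apply: lim_sup_set_cvg0 => //.
  apply: (@le_lt_trans _ _ (\big[+%E/0%R]_(0 <= n <oo) (C * q ^+ n)%:E)).
    by apply: lee_nneseries => *; [exact: measure_ge0|exact: h].
  have -> : (\big[+%E/0%R]_(0 <= n <oo) (C * q ^+ n)%:E)%E = (C / (1 - q))%:E.
    apply: cvg_lim => //.
    have -> : (fun n => \sum_(0 <= i < n) (C * q ^+ i)%:E)%E =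
        EFin \o series (geometric C q).
      by apply/funext => n /=; rewrite sumEFin.
    apply: cvg_comp; first by apply: cvg_geometric_series; rewrite ger0_norm.
    by [].
  by rewrite ltry.
- move=> o /= no n _; apply: contrapT => nB; apply: no; exists n => k nk Bk.
  by apply: nB; exists k.
Qed.

End Iid.

(** * Growth of exponentials *)

Lemma powRexp (R : realType) (a x : R) : 0 < a -> a `^ x = expR (x * ln a).
Proof. by move=> a0; rewrite /powR gt_eqF. Qed.

(** One term of the exponential series, of degree one more than the polynomial,
    is enough. *)
Lemma expR_dominates (R : realType) (k : nat) (c C : R) : 0 < c ->
  exists N, forall n, (N <= n)%N -> C * n.+1%:R ^+ k <= expR (c * n%:R).
Proof.
move=> c0.
pose D := `|C| * 2 ^+ k * (k.+1)`!%:R / c ^+ k.+1.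
have D0 : 0 <= D by rewrite /D divr_ge0 ?exprn_ge0 ?(ltW c0)// !mulr_ge0// exprn_ge0.
exists (Num.truncn D).+1 => n hn.
have n0 : (0 < n)%N by apply: leq_trans hn.
have Dn : D <= n%:R.
  apply: ltW; apply: lt_le_trans (truncnS_gt D) _; by rewrite ler_nat.
have cn0 : 0 <= c * n%:R by rewrite mulr_ge0 // ltW.
apply: le_trans (expR_ge1Dxn k cn0).
apply: (@le_trans _ _ (`|C| * (2 * n%:R) ^+ k)).
  apply: (@le_trans _ _ (`|C| * n.+1%:R ^+ k)).
    by rewrite ler_wpM2r ?exprn_ge0// ler_norm.
  rewrite ler_wpM2l// lerXn2r ?nnegrE// -natr1; have : 1 <= (n%:R : R) by rewrite ler1n.
  by move=> *; lra.
apply: ler_wpDl => //.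
rewrite ler_pdivlMr ?ltr0n ?fact_gt0//.
have -> : (c * n%:R) ^+ k.+1 = c ^+ k.+1 * n%:R * n%:R ^+ k by rewrite exprMn [in LHS](exprS n%:R k) mulrA.
have -> : `|C| * (2 * n%:R) ^+ k * (k.+1)`!%:R = D * c ^+ k.+1 * n%:R ^+ k.
  rewrite /D divfK ?expf_neq0 ?gt_eqF// exprMn; ring.
rewrite ler_wpM2r ?exprn_ge0// mulrC ler_wpM2l// exprn_ge0// ltW//.
Qed.

(** * Consequences of the growth condition on the lengths *)

Section Lengths.
Variables (R : realType) (alpha : R) (l : nat -> nat).
Hypothesis alpha0 : 0 < alpha.
Hypothesis hl : {homo l : n n' / (n <= n')%N}.
Hypothesis hliminf : limn_einf (fun n : nat => ((l n)%:R / ln (n%:R : R))%:E)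
               = (1 / alpha)%:E.

Let u n := ((l n)%:R / ln (n%:R : R))%:E.

Let sup_einfs : ereal_sup (range (einfs u)) = (1 / alpha)%:E.
Proof. by rewrite -hliminf limn_einf_lim; apply/esym/cvg_lim => //; exact: cvg_einfs_sup. Qed.

(** The liminf exceeds [1 / a], so eventually [ln n < a * l n]; the constant
    [C] absorbs the finitely many other places. *)
Lemma lengths_ge a : alpha < a ->
  exists C : R, 0 <= C /\ forall n, n%:R <= C * expR (a * (l n)%:R).
Proof.
move=> aa; have a0 : 0 < a by apply: lt_trans aa.
have : ((1 / a)%:E < ereal_sup (range (einfs u)))%E.
  by rewrite sup_einfs lte_fin !div1r ltf_pV2.
move=> /ereal_sup_gt[_ [N _ <-] hN].
exists (N + 2)%:R; split=> // n.
have [nN|nN] := ltnP n (N + 2).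
  apply: (@le_trans _ _ (N + 2)%:R); first by rewrite ler_nat ltnW.
  by rewrite ler_peMr// -expR0 ler_expR mulr_ge0// ltW.
have n1 : (1 : R) < n%:R by rewrite ltr1n; lia.
have ln0 : 0 < ln (n%:R : R) by rewrite ln_gt0.
have : ((1 / a)%:E < u n)%E.
  apply: lt_le_trans hN _; apply: ereal_inf_lbound; exists n => //=; lia.
rewrite /u lte_fin div1r ltr_pdivlMr// mulrC ltr_pdivrMr// => h.
apply: (@le_trans _ _ (expR (a * (l n)%:R))).
  by rewrite -[leLHS]lnK ?posrE ?(lt_trans ltr01)// ler_expR ltW// mulrC.
by rewrite ler_peMl ?expR_ge0// ler1n; lia.
Qed.

Lemma lengths_le_often a n0 : 0 < a < alpha ->
  exists n, (n0 <= n)%N /\ expR (a * (l n)%:R) <= n%:R.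
Proof.
move=> /andP[a0 aa].
have : (einfs u (n0 + 2)%N < (1 / a)%:E)%E.
  apply: (@le_lt_trans _ _ (1 / alpha)%:E).
    by rewrite -sup_einfs; apply: ereal_sup_ubound; exists (n0 + 2)%N.
  by rewrite lte_fin !div1r ltf_pV2.
move=> /ereal_inf_lt[_ [n /= hn <-]].
have n1 : (1 : R) < n%:R by rewrite ltr1n; lia.
have ln0 : 0 < ln (n%:R : R) by rewrite ln_gt0.
rewrite /u lte_fin div1r ltr_pdivrMr// mulrC ltr_pdivlMr// => h.
exists n; split; first lia.
by rewrite -[leRHS]lnK ?posrE ?(lt_trans ltr01)// ler_expR ltW// mulrC.
Qed.

Lemma lengths_unbounded L : exists N, forall n, (N <= n)%N -> (L <= l n)%N.
Proof.
have [|C [C0 hC]] := @lengths_ge (2 * alpha); first by rewrite ltr_pMl// ltr1n.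
exists (Num.truncn (C * expR (2 * alpha * L%:R))).+1 => n hn.
rewrite leqNgt; apply/negP => lL.
have : n%:R <= C * expR (2 * alpha * L%:R).
  apply: le_trans (hC n) _; rewrite ler_wpM2l// ler_expR ler_wpM2l ?ler_nat ?(ltnW lL)//.
  by rewrite mulr_ge0// ltW.
apply/negP; rewrite -ltNge; apply: lt_le_trans (truncnS_gt _) _; by rewrite ler_nat.
Qed.

(** Choose [a'] between [a] and [alpha] and a place [n] with
    [expR (a' * l n) <= n], and let [K * B] be [l n] rounded up to a multiple of
    [B].  By monotonicity no earlier place asks for more letters, and there are
    [n %/ (K * B)] blocks before [n]; the factor [expR ((a' - a) * l n)] pays
    for the division and for the rounding. *)
Lemma many_trials a B K0 : 0 < a < alpha -> (0 < B)%N ->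
  exists K M, [/\ (K0 <= K)%N, (0 < K)%N, expR (a * (K * B)%:R) <= M%:R &
    forall n, (n <= M * (K * B))%N -> (l n <= K * B)%N].
Proof.
move=> /andP[a0 aa] B0; pose a' := (a + alpha) / 2.
have aa' : a < a' by rewrite /a'; lra.
have a'0 : 0 < a' < alpha by rewrite /a'; apply/andP; split; lra.
have [|L1 hL1] := @expR_dominates R 1 (a' - a) (2 * expR (a * B%:R) * B.+1%:R).
  by rewrite subr_gt0.
have [N hN] := lengths_unbounded (L1 + B * K0 + 1).
have [n [nN hn]] := lengths_le_often N a'0.
set L := l n in hn; have hL : (L1 + B * K0 + 1 <= L)%N by apply: hN.
pose K := (L %/ B).+1; pose D := (K * B)%N.
have DL : (D <= L + B)%N.
  by rewrite /D /K mulSn; have := leq_trunc_div L B; lia.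
have LD : (L <= D)%N by rewrite /D /K; have := ltn_ceil L B0; lia.
have D0 : (0 < D)%N by rewrite /D /K muln_gt0.
exists K, (n %/ D)%N; split=> //.
- rewrite /K; apply: leqW; rewrite leq_divRL//; lia.
- rewrite -/D.
  have hnD : (n < (n %/ D).+1 * D)%N by apply: ltn_ceil.
  suff : (expR (a * D%:R) + 1) * D%:R <= n%:R.
    move=> h; have : (expR (a * D%:R) + 1) * D%:R < (n %/ D).+1%:R * D%:R.
      by apply: le_lt_trans h _; rewrite -natrM ltr_nat.
    rewrite ltr_pM2r ?ltr0n// -natr1; lra.
  apply: le_trans hn.
  have DLr : D%:R <= L%:R + B%:R :> R by rewrite -natrD ler_nat.
  apply: (@le_trans _ _ (2 * expR (a * (L%:R + B%:R)) * (L%:R + B%:R))).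
    apply: ler_pM => //.
    have h1 : expR (a * D%:R) <= expR (a * (L%:R + B%:R)) by rewrite ler_expR ler_wpM2l// ltW.
    have h2 : 1 <= expR (a * (L%:R + B%:R)).
      by rewrite -expR0 ler_expR; apply: mulr_ge0; rewrite ?(ltW a0)// addr_ge0.
    lra.
  have -> : expR (a' * L%:R) = expR (a * L%:R) * expR ((a' - a) * L%:R).
    by rewrite -expRD; congr expR; ring.
  have -> : 2 * expR (a * (L%:R + B%:R)) * (L%:R + B%:R) =
     expR (a * L%:R) * (2 * expR (a * B%:R) * (L%:R + B%:R)) :> R.
    have -> : expR (a * (L%:R + B%:R)) = expR (a * L%:R) * expR (a * B%:R) by rewrite mulrDr expRD.
    by ring.
  rewrite ler_wpM2l ?expR_ge0//.
  apply: le_trans (hL1 L _); last lia.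
  rewrite expr1 -[leRHS]mulrA ler_wpM2l ?mulr_ge0 ?expR_ge0//.
  by rewrite -natrD -natrM ler_nat; nia.
- move=> k hk; apply: leq_trans LD; apply: hl.
  by apply: leq_trans hk _; exact: leq_trunc_div.
Qed.

End Lengths.

(** * The law of large numbers on words *)

(** For centred independent summands the cross terms vanish. *)
Lemma words_second_moment (R : realType) (T : Type) (A : seq T) (th X : T -> R) n :
  \sum_(a <- A) th a = 1 -> \sum_(a <- A) th a * X a = 0 ->
  \sum_(w <- words A n) \prod_(a <- w) th a * (\sum_(a <- w) X a) ^+ 2 =
  n%:R * \sum_(a <- A) th a * X a ^+ 2.
Proof.
move=> th1 X0; elim: n => [|n IH].
  by rewrite big_seq1 !big_nil mul0r expr0n mulr0.
have E : \sum_(w <- words A n) \prod_(a <- w) th a = 1.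
  by rewrite sum_words_prod th1 expr1n.
rewrite sum_wordsS.
under eq_bigr => a _ do under eq_bigr => w _ do
  rewrite !big_cons sqrrD !mulrDr.
under eq_bigr => a _ do rewrite !big_split.
rewrite !big_split /=.
have -> : \sum_(a <- A) \sum_(w <- words A n) th a * \prod_(b <- w) th b * X a ^+ 2 =
    \sum_(a <- A) th a * X a ^+ 2.
  apply: eq_bigr => a _.
  rewrite -[RHS]mul1r -[X in X * _]E mulr_suml.
  by apply: eq_bigr => w _; rewrite -mulrA mulrCA.
have -> : \sum_(a <- A) \sum_(w <- words A n)
      th a * \prod_(b <- w) th b * (X a * \sum_(b <- w) X b) = 0.
  transitivity (\sum_(a <- A) (th a * X a) *
     (\sum_(w <- words A n) \prod_(b <- w) th b * (\sum_(b <- w) X b))).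
    by apply: eq_bigr => a _; rewrite mulr_sumr; apply: eq_bigr => w _; ring.
  by rewrite -mulr_suml X0 mul0r.
have -> : \sum_(a <- A) \sum_(w <- words A n)
      th a * \prod_(b <- w) th b * (\sum_(b <- w) X b) ^+ 2 =
    n%:R * \sum_(a <- A) th a * X a ^+ 2.
  rewrite -IH -[RHS]mul1r -[X in X * _]th1 mulr_suml; apply: eq_bigr => a _.
  by rewrite mulr_sumr; apply: eq_bigr => w _; ring.
by rewrite -natr1 !addr0; ring.
Qed.

(** The weak law of large numbers: under product weights the sum of [X] over the
    letters of a word of length [n] is close to [n] times its mean. *)
Lemma words_chebyshev (R : realType) (T : eqType) (A : seq T) (th X : T -> R) (mu eta : R) :
  (forall a, 0 <= th a) -> \sum_(a <- A) th a = 1 ->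
  mu = \sum_(a <- A) th a * X a -> 0 < eta ->
  exists V, forall n, (0 < n)%N ->
  \sum_(w <- words A n | eta * n%:R <= `|\sum_(a <- w) X a - n%:R * mu|)
    \prod_(a <- w) th a <= V / n%:R.
Proof.
move=> th0 th1 hmu eta0.
pose Y a := X a - mu.
have Y0 : \sum_(a <- A) th a * Y a = 0.
  under eq_bigr => a _ do rewrite /Y mulrBr.
  by rewrite sumrB -mulr_suml th1 mul1r -hmu subrr.
pose V := (\sum_(a <- A) th a * Y a ^+ 2) / eta ^+ 2.
exists V => n n0.
have nr0 : (0 : R) < n%:R by rewrite ltr0n.
have -> : V / n%:R = (\sum_(w <- words A n) \prod_(a <- w) th a * (\sum_(a <- w) Y a) ^+ 2)
     / (eta * n%:R) ^+ 2.
  rewrite words_second_moment// /V exprMn; field.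
  by rewrite !gt_eqF.
rewrite mulr_suml big_mkcond big_seq [leRHS]big_seq /=; apply: ler_sum => w /size_mem_words sw.
have p0 : 0 <= \prod_(a <- w) th a by apply: prodr_ge0.
have -> : \sum_(a <- w) Y a = \sum_(a <- w) X a - n%:R * mu.
  by rewrite sumrB -sw; congr (_ - _); rewrite big_const_seq count_predT iter_addr_0 mulr_natl.
case: ifPn => h.
  rewrite -mulrA ler_peMr// ler_pdivlMr ?exprn_gt0 ?mulr_gt0// mul1r.
  by rewrite -[leRHS]real_normK ?num_real// lerXn2r// ?nnegrE ?mulr_ge0// ltW.
by rewrite divr_ge0 ?sqr_ge0// mulr_ge0 ?sqr_ge0.
Qed.

(** * Euclidean geometry *)

Section Euclid.
Variables (R : realType) (d : nat).
Implicit Types x y z : 'rV[R]_d.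

Definition dotp x y : R := \sum_(j < d) x ord0 j * y ord0 j.

Lemma dotpC x y : dotp x y = dotp y x.
Proof. by apply: eq_bigr => j _; rewrite mulrC. Qed.

Lemma dotpDl x y z : dotp (x + y) z = dotp x z + dotp y z.
Proof. by rewrite -big_split; apply: eq_bigr => j _; rewrite mxE mulrDl. Qed.

Lemma dotpZl a x z : dotp (a *: x) z = a * dotp x z.
Proof. by rewrite mulr_sumr; apply: eq_bigr => j _; rewrite mxE mulrA. Qed.

Lemma dotpNl x z : dotp (- x) z = - dotp x z.
Proof. by rewrite -scaleN1r dotpZl mulN1r. Qed.

Lemma dotp_ge0 x : 0 <= dotp x x.
Proof. by apply: sumr_ge0 => j _; rewrite -expr2 sqr_ge0. Qed.

Lemma enormE x : enorm x = Num.sqrt (dotp x x).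
Proof. by rewrite /enorm; congr Num.sqrt; apply: eq_bigr => j _; rewrite expr2. Qed.

Lemma sqr_enorm x : enorm x ^+ 2 = dotp x x.
Proof. by rewrite enormE sqr_sqrtr ?dotp_ge0. Qed.

Lemma enorm_ge0 x : 0 <= enorm x.
Proof. exact: sqrtr_ge0. Qed.

Lemma enormN x : enorm (- x) = enorm x.
Proof. by rewrite !enormE dotpNl dotpC dotpNl opprK. Qed.

Lemma enorm0 : enorm (0 : 'rV[R]_d) = 0.
Proof. by rewrite /enorm big1 ?sqrtr0// => j _; rewrite mxE expr0n. Qed.

Lemma enormB x y : enorm (x - y) = enorm (y - x).
Proof. by rewrite -enormN opprB. Qed.

Lemma coord_le_enorm x j : `|x ord0 j| <= enorm x.
Proof.
rewrite -sqrtr_sqr; apply: ler_wsqrtr.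
by rewrite (bigD1 j)//= lerDl sumr_ge0// => i _; exact: sqr_ge0.
Qed.

Lemma enorm_eq0 x : enorm x = 0 -> x = 0.
Proof.
move=> x0; apply/rowP => j; rewrite mxE; apply/eqP; rewrite -normr_eq0.
by rewrite eq_le normr_ge0 andbT -x0 coord_le_enorm.
Qed.

(** The Cauchy-Schwarz inequality, from the positivity of the square of
    [|y|^2 x - (x . y) y]. *)
Lemma dotp_le x y : dotp x y <= enorm x * enorm y.
Proof.
have [y0|yn0] := eqVneq (enorm y) 0.
  rewrite y0 mulr0 (enorm_eq0 y0) dotpC.
  by rewrite /dotp big1// => j _; rewrite mxE mul0r.
have y0 : 0 < enorm y by rewrite lt_neqAle eq_sym yn0 enorm_ge0.
have := dotp_ge0 (enorm y ^+ 2 *: x - dotp x y *: y).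
rewrite dotpDl dotpNl !dotpZl ![dotp _ (_ - _)]dotpC !dotpDl !dotpNl !dotpZl.
rewrite (dotpC y x) -!sqr_enorm => h.
have h2 : dotp x y ^+ 2 <= (enorm x * enorm y) ^+ 2.
  rewrite -(ler_pM2l (exprn_gt0 2 y0)) exprMn; move: h; set a := dotp x y; nra.
apply: le_trans (ler_norm _) _.
by rewrite -(ler_sqr (x := `|_|)) ?nnegrE ?mulr_ge0 ?enorm_ge0// real_normK ?num_real.
Qed.

Lemma enormD x y : enorm (x + y) <= enorm x + enorm y.
Proof.
rewrite -ler_sqr ?nnegrE ?addr_ge0 ?enorm_ge0//.
rewrite sqr_enorm dotpDl dotpC (dotpC y) !dotpDl (dotpC y x) -!sqr_enorm.
have := dotp_le x y; rewrite sqrrD; lra.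
Qed.

Lemma enorm_triangle y x z : enorm (x - z) <= enorm (x - y) + enorm (y - z).
Proof. by apply: le_trans (enormD _ _); rewrite addrA subrK. Qed.

(** The bound [c / d.+1] instead of [c / d] gives a strict inequality and
    includes the case [d = 0]. *)
Lemma enorm_lt_coord x (c : R) : 0 < c ->
  (forall j, `|x ord0 j| <= c / d.+1%:R) -> enorm x < c.
Proof.
move=> c0 h; rewrite -ltr_sqr ?nnegrE ?enorm_ge0 ?(ltW c0)// sqr_enorm.
apply: (@le_lt_trans _ _ (\sum_(j < d) (c / d.+1%:R) ^+ 2)).
  apply: ler_sum => j _; rewrite -expr2 -real_normK ?num_real//.
  by rewrite lerXn2r ?nnegrE// divr_ge0// ltW.
rewrite sumr_const card_ord.
have -> : (c / d.+1%:R) ^+ 2 *+ d = c ^+ 2 * (d%:R / d.+1%:R ^+ 2).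
  by rewrite -[LHS]mulr_natl exprMn exprVn; ring.
rewrite gtr_pMr ?exprn_gt0//.
rewrite ltr_pdivrMr ?exprn_gt0 ?ltr0n// mul1r -natrX ltr_nat.
by rewrite expnS expn1; nia.
Qed.

Lemma norm_le_enorm x : `|x| <= enorm x.
Proof.
change (mx_norm x <= enorm x); rewrite mx_normrE.
apply: bigmax_le => [|[i j] _]; first exact: enorm_ge0.
by rewrite (ord1 i) coord_le_enorm.
Qed.

Lemma coord_le_norm x j : `|x ord0 j| <= `|x|.
Proof.
change (`|x ord0 j| <= mx_norm x); rewrite mx_normrE.
exact: (le_bigmax _ (fun ij => `|x ij.1 ij.2|) (ord0, j)).
Qed.

Lemma open_contains_eball (U : set 'rV[R]_d) a : open U -> U a ->
  exists2 r : R, 0 < r & forall y, enorm (y - a) < r -> U y.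
Proof.
move=> oU Ua; have : nbhs a U by apply: open_nbhs_nbhs.
move=> /nbhs_ballP[r /= r0 hr]; exists r => // y hy; apply: hr.
by rewrite -ball_normE /= distrC; apply: le_lt_trans hy; exact: norm_le_enorm.
Qed.

Lemma cvg_of_enorm (u : nat -> 'rV[R]_d) y (v : nat -> R) :
  (forall n, enorm (u n - y) <= v n) -> v @ \oo --> 0 -> u @ \oo --> y.
Proof.
move=> uv v0; apply/cvgrPdist_lt => e e0.
move/cvgrPdist_lt : v0 => /(_ e e0); apply: filterS => n.
rewrite sub0r normrN => h; rewrite distrC; apply: le_lt_trans (norm_le_enorm _) _.
by apply: le_lt_trans (uv n) _; apply: le_lt_trans (ler_norm _) h.
Qed.

Lemma cvg_enorm (u : nat -> 'rV[R]_d) y (e : R) : 0 < e ->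
  u @ \oo --> y -> \forall n \near \oo, enorm (u n - y) < e.
Proof.
move=> e0 /cvgrPdist_lt /(_ (e / d.+1%:R)); rewrite divr_gt0// => /(_ isT).
apply: filterS => n h; apply: enorm_lt_coord => // j.
apply: le_trans (coord_le_norm _ _) _; rewrite distrC; exact: ltW.
Qed.

Lemma compact_ebounded (L : set 'rV[R]_d) : compact L ->
  exists2 D : R, 0 < D & forall x y, L x -> L y -> enorm (x - y) <= D.
Proof.
move=> /compact_bounded [M [_ hM]].
pose c := `|M| + 1; exists (2 * c * d.+1%:R) => [|x y Lx Ly].
  by rewrite !mulr_gt0// /c ltr_wpDl.
have hc z : L z -> `|z| <= c by apply: hM; rewrite /c; have := ler_norm M; lra.
have c0 : 0 < c by rewrite /c ltr_wpDl.
apply/ltW/enorm_lt_coord; first by rewrite !mulr_gt0.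
move=> j; rewrite mulfK ?pnatr_eq0// !mxE; apply: le_trans (ler_normB _ _) _.
have := le_trans (coord_le_norm x j) (hc _ Lx).
have := le_trans (coord_le_norm y j) (hc _ Ly); lra.
Qed.

End Euclid.

(** * Similarities *)

Section Similarity.
Variables (R : realType) (d : nat) (f : 'rV[R]_d -> 'rV[R]_d) (r : R).
Hypotheses (r0 : 0 < r) (hf : similarity f r).

Lemma similarity_inj : injective f.
Proof.
move=> x y fxy; apply/subr0_eq/enorm_eq0; apply: (mulfI (lt0r_neq0 r0)).
by rewrite -hf fxy subrr enorm0 mulr0.
Qed.

(** The normalised map [g x = r^-1 *: (f x - f 0)] preserves the norm of
    differences and fixes 0, hence preserves inner products.  It sends the
    standard basis to the rows of an orthogonal matrix [Q], and [g x = x *m Q]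
    because both sides have the same inner products with these rows. *)
Lemma similarity_surj y : exists x, f x = y.
Proof.
pose g x := r^-1 *: (f x - f 0).
have gB x z : enorm (g x - g z) = enorm (x - z).
  rewrite /g -scalerBr opprB addrA subrK.
  have -> (a : R) (v : 'rV[R]_d) : 0 < a -> enorm (a *: v) = a * enorm v.
    move=> a0; apply/eqP; rewrite -(eqrXn2 (n := 2))// ?mulr_ge0 ?enorm_ge0 ?(ltW a0)//.
    by rewrite exprMn !sqr_enorm dotpZl dotpC dotpZl expr2 mulrA.
  - by rewrite hf mulKf ?gt_eqF.
  - by rewrite invr_gt0.
have g0 : g 0 = 0 by rewrite /g subrr scaler0.
have gN x : dotp (g x) (g x) = dotp x x.
  by have := gB x 0; rewrite g0 !subr0 -!sqr_enorm => ->.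
have gdot x z : dotp (g x) (g z) = dotp x z.
  have h (a b : 'rV[R]_d) : dotp (a - b) (a - b) = dotp a a + dotp b b - 2 * dotp a b.
    by rewrite dotpDl dotpNl ![dotp _ (_ - _)]dotpC !dotpDl !dotpNl (dotpC b a); ring.
  have := h (g x) (g z); rewrite !gN -sqr_enorm gB sqr_enorm h; lra.
pose Q : 'M[R]_d := \matrix_i g (delta_mx ord0 i).
have Qe i : row i Q = g (delta_mx ord0 i) by rewrite rowK.
have dm (a b : 'rV[R]_d) : a *m b^T = (dotp a b)%:M.
  apply/matrixP => i j; rewrite !ord1 !mxE eqxx mulr1n.
  by apply: eq_bigr => k _; rewrite !mxE.
have gQ x : g x *m Q^T = x.
  apply/rowP => i; rewrite !mxE.
  transitivity (dotp (g x) (g (delta_mx ord0 i))).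
    by apply: eq_bigr => k _; rewrite !mxE.
  rewrite gdot /dotp (bigD1 i)//= big1 ?addr0.
    by rewrite mxE !eqxx mulr1.
  by move=> k ki; rewrite mxE eqxx /= (negbTE ki) mulr0.
have QQ : Q *m Q^T = 1%:M.
  by apply/row_matrixP => i; rewrite row_mul Qe gQ rowE mulmx1.
have QQ' := mulmx1C QQ.
pose z := r^-1 *: (y - f 0); exists (z *m Q^T).
have gz : g (z *m Q^T) = z.
  by rewrite -[LHS]mulmx1 -QQ' mulmxA gQ -mulmxA QQ' mulmx1.
have : r *: g (z *m Q^T) = r *: z by rewrite gz.
by rewrite /g /z !scalerA divff ?gt_eqF// !scale1r => /addIr.
Qed.

End Similarity.

(** * Packing *)

(** Points of a ball of radius [C * r] that are [c * r] apart lie in different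
    cells of a grid of mesh proportional to [r], and the number of cells of this
    grid that meet the ball depends only on the ratio of [C] to [c]. *)
Lemma packing (R : realType) (d : nat) (C c : R) : 0 < c -> 0 < C ->
  exists N : nat, forall (I : eqType) (s : seq I) (y : I -> 'rV[R]_d) x (r : R),
    0 < r -> uniq s ->
    (forall i, i \in s -> enorm (y i - x) <= C * r) ->
    (forall i j, i \in s -> j \in s -> i != j -> c * r <= enorm (y i - y j)) ->
    (size s <= N)%N.
Proof.
move=> c0 C0.
pose h := c / d.+1%:R; have h0 : 0 < h by rewrite divr_gt0.
pose Q := (Num.truncn (2 * C / h)).+1.
exists #|{ffun 'I_d -> 'I_Q}| => I s y x r r0 us yx yy.
pose co i j := (y i ord0 j - x ord0 j + C * r) / (h * r).
have hr0 : 0 < h * r by rewrite mulr_gt0.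
have co0 i j : i \in s -> 0 <= co i j.
  move=> /yx iC; rewrite divr_ge0 ?(ltW hr0)//.
  have := le_trans (coord_le_enorm (y i - x) j) iC; rewrite !mxE ler_norml => /andP[]; lra.
have coQ i j : i \in s -> (Num.truncn (co i j) < Q)%N.
  move=> /[dup] si /yx iC; rewrite -(ltr_nat R).
  apply: (@le_lt_trans _ _ (co i j)); first by rewrite truncn_le co0.
  apply: le_lt_trans (truncnS_gt _).
  rewrite /co ler_pdivrMr// mulrA divfK ?gt_eqF//.
  have := le_trans (coord_le_enorm (y i - x) j) iC; rewrite !mxE ler_norml => /andP[]; lra.
pose F i : {ffun 'I_d -> 'I_Q} := [ffun j => inord (Num.truncn (co i j))].
have Finj : {in s &, injective F}.
  move=> i i' si si' FF; apply/eqP/negP => /negP ii'.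
  have := yy _ _ si si' ii'; apply/negP; rewrite -ltNge.
  apply: enorm_lt_coord; first by rewrite mulr_gt0.
  move=> j; have /(congr1 val) : F i j = F i' j by rewrite FF.
  rewrite !ffunE /= !inordK ?coQ// => tt.
  have /andP[a1 a2] := truncn_itv (co0 i j si).
  have /andP[b1 b2] := truncn_itv (co0 i' j si').
  rewrite tt in a1 a2.
  have -> : (y i - y i') ord0 j = (co i j - co i' j) * (h * r).
    by rewrite /co -mulrBl divfK ?gt_eqF// !mxE; ring.
  rewrite normrM (gtr0_norm hr0) /h mulrAC ler_piMl//; first by rewrite ltW// divr_gt0// mulr_gt0.
  rewrite ler_norml; rewrite -natr1 in a2 b2; lra.
have -> : size s = size (map F s) by rewrite size_map.
have uF : uniq (map F s) by rewrite map_inj_in_uniq.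
by rewrite -(card_uniqP uF); exact: max_card.
Qed.

(** * Tilted weights and words of a fixed type *)

Lemma expR_le_quadratic (R : realType) (y : R) : y <= 1 / 2 ->
  expR y <= 1 + y + 2 * y ^+ 2.
Proof.
move=> hy; have h := expR_ge1Dx (- y).
have h1 : expR y * expR (- y) = 1 by rewrite -expRD subrr expR0.
have e0 := expR_gt0 y.
have h2 : expR y * (1 - y) <= 1 by rewrite -[leRHS]h1 ler_wpM2l// ltW.
have y1 : 0 < 1 - y by lra.
rewrite -(ler_pM2r y1); apply: le_trans h2 _.
have : 0 <= y ^+ 2 * (1 - 2 * y) by rewrite mulr_ge0 ?sqr_ge0//; lra.
rewrite expr2; lra.
Qed.

(** If the mean of [X] were negative, the expansion
    [expR (h * X) <= 1 + h * X + 2 * (h * X) ^+ 2] would make the sum smaller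
    than 1 for small [h].  This is the first-order condition at a minimum,
    also valid at an end point of the interval. *)
Lemma tilt_mean_ge0 (R : realType) (T : eqType) (A : seq T) (th X : T -> R) (h0 : R) :
  (forall a, 0 <= th a) -> \sum_(a <- A) th a = 1 -> 0 < h0 ->
  (forall h, 0 < h <= h0 -> 1 <= \sum_(a <- A) th a * expR (h * X a)) ->
  0 <= \sum_(a <- A) th a * X a.
Proof.
move=> th0 th1 h00 hh; set mu := (X in 0 <= X).
rewrite leNgt; apply/negP => mu0.
pose W := \sum_(a <- A) th a * X a ^+ 2.
have W0 : 0 <= W by apply: sumr_ge0 => a _; rewrite mulr_ge0 ?sqr_ge0.
pose b := \sum_(a <- A) `|X a|.
have b0 : 0 <= b by apply: sumr_ge0.
have Xb a : a \in A -> X a <= b.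
  move=> aA; apply: le_trans (ler_norm _) _; rewrite /b (big_rem a aA) /=.
  by rewrite lerDl sumr_ge0.
(* The first bound on h makes the quadratic estimate available, the second one
   makes the quadratic term smaller than the linear one. *)
pose h1 := 1 / (2 * (b + 1)); pose h2 := - mu / (4 * (W + 1)).
pose h := Num.min h0 (Num.min h1 h2).
have h1p : 0 < h1 by rewrite divr_gt0// mulr_gt0//; lra.
have h2p : 0 < h2 by rewrite divr_gt0 ?oppr_gt0// mulr_gt0//; lra.
have hp : 0 < h by rewrite !lt_min h00 h1p h2p.
have hle0 : h <= h0 by rewrite ge_min lexx.
have hle1 : h <= h1 by rewrite !ge_min lexx orbT.
have hle2 : h <= h2 by rewrite !ge_min lexx !orbT.
have hX a : a \in A -> h * X a <= 1 / 2.
  move=> /Xb aX; apply: (@le_trans _ _ (h * (b + 1))).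
    by rewrite ler_wpM2l ?(ltW hp)//; lra.
  apply: le_trans (ler_wpM2r _ hle1) _; first lra.
  by rewrite /h1 -ler_pdivlMr ?ltr_wpDl//; rewrite invfM mulrA lexx.
have : 1 <= 1 + h * mu + 2 * h ^+ 2 * W.
  apply: le_trans (hh h _) _; first by rewrite hp.
  apply: (@le_trans _ _ (\sum_(a <- A) (th a + h * (th a * X a) + 2 * h ^+ 2 * (th a * X a ^+ 2)))).
    apply: ler_sum_mem => a aA _.
    have := expR_le_quadratic (hX a aA) => /(ler_wpM2l (th0 a)).
    move=> H; apply: le_trans H _; rewrite le_eqVlt; apply/orP; left; apply/eqP; ring.
  by rewrite !big_split /= -!mulr_sumr th1.
have h4 : h * (4 * (W + 1)) <= - mu.
  by rewrite -ler_pdivlMr//; rewrite mulr_gt0//; lra.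
have h5 : h * (h * (4 * (W + 1))) <= h * - mu by rewrite ler_wpM2l// ltW.
have h6 : 0 < h * - mu by rewrite mulr_gt0// oppr_gt0.
have h7 : 0 <= h * h * W by rewrite !mulr_ge0// ltW.
have h8 : 0 < h * h by rewrite mulr_gt0.
rewrite expr2; lra.
Qed.

Lemma continuous_sum_expR (R : realType) (T : Type) (A : seq T) (c k : T -> R) :
  continuous (fun q : R => \sum_(a <- A) c a * expR (q * k a)).
Proof.
elim: A => [|a A IH] q.
  under eq_fun do rewrite big_nil; exact: cvg_cst.
under eq_fun do rewrite big_cons.
apply: cvgD; last exact: IH.
apply: cvgM; first exact: cvg_cst.
apply: (cvg_comp (fun q => q * k a) expR); last exact: continuous_expR.
apply: cvgM; [exact: cvg_id|exact: cvg_cst].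
Qed.

Lemma prod_const_perm (R : comNzRingType) (T : eqType) (F : T -> R) (u w : seq T) :
  perm_eq u w -> \prod_(a <- u) F a = \prod_(a <- w) F a.
Proof. by move=> h; apply: perm_big. Qed.

(** Up to rearrangement a word of length [n] is known by its letter counts, so
    there are at most [n.+1 ^ #|T|] classes, and some class carries at least the
    average share of the sum. *)
Lemma perm_class_pigeonhole (R : realType) (T : finType) n (F : seq T -> R) :
  (forall u w, perm_eq u w -> F u = F w) ->
  (n.+1 ^ #|T|)%:R < \sum_(w <- words (enum T) n) F w ->
  exists2 w0, size w0 = n &
    1 < (size [seq w <- words (enum T) n | perm_eq w0 w])%:R * F w0.
Proof.
move=> hF hs; apply: contrapT => hno; move: hs; apply/negP; rewrite -leNgt.
pose ty (w : seq T) : {ffun T -> 'I_n.+1} := [ffun a => inord (count_mem a w)].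
rewrite (partition_big ty predT)//=.
have -> : (n.+1 ^ #|T|)%:R = \sum_(j : {ffun T -> 'I_n.+1}) (1 : R).
  by rewrite sumr_const card_ffun card_ord.
apply: ler_sum => j _.
have [/hasP[w0 w0n /eqP w0j]|no] := boolP (has (fun w => ty w == j) (words (enum T) n)); last first.
  by rewrite big_hasC.
have s0 := size_mem_words w0n.
rewrite leNgt; apply/negP => h; apply: hno; exists w0 => //.
apply: lt_le_trans h _.
rewrite big_seq_cond (eq_bigl (fun w => (w \in words (enum T) n) && perm_eq w0 w)); last first.
  move=> w; apply: andb_id2l => /size_mem_words sw.
  rewrite -w0j; apply/eqP/idP => [tt|/permP pw].
    rewrite perm_sym; apply/allP => a _ /=; apply/eqP.
    have := congr1 (fun g : {ffun T -> 'I_n.+1} => val (g a)) tt; rewrite !ffunE /= !inordK//.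
      by rewrite ltnS -s0 count_size.
    by rewrite ltnS -sw count_size.
  by apply/ffunP => a; rewrite !ffunE pw.
rewrite -big_seq_cond (eq_bigr (fun=> F w0)); last by move=> w /hF ->.
by rewrite -big_filter big_const_seq count_predT iter_addr_0 mulr_natl.
Qed.

(** Let [q0] minimise [\sum_i b i * x i `^ q] on [0, 1], and let [th] be the
    weights proportional to the summands at [q0].  The mean [mu] of [ln (x i)]
    under [th] is nonnegative if [q0 < 1] and nonpositive if [0 < q0]: at a
    minimum the derivative vanishes or points inwards.  For a word with
    typical sum [S] of [ln (x i)], this gives [q0 * S <= min 0 S] up to an error of
    [eta] for each letter, so the [q0]-th power of its [x]-product is hardly
    larger than [min 1] of the product.  The summands [F] of the typical words
    therefore add up to half of [expR (eta * n)] at least, where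
    [expR (2 * eta) = phi q0], and one class of rearrangements has a sum greater
    than 1. *)
Lemma balanced_type (R : realType) (m : nat) (b x : 'I_m.+1 -> R) :
  (forall i, 0 < b i) -> (forall i, 0 < x i) ->
  (forall q : R, 0 <= q <= 1 -> 1 < \sum_i b i * x i `^ q) ->
  exists w0, [/\ (0 < size w0)%N &
    1 < (size [seq w <- words (enum 'I_m.+1) (size w0) | perm_eq w0 w])%:R *
      (\prod_(i <- w0) b i * Num.min 1 (\prod_(i <- w0) x i))].
Proof.
move=> b0 x0 hq; set A := enum 'I_m.+1.
pose X i := ln (x i).
pose phi (q : R) := \sum_(i <- A) b i * expR (q * X i).
have phiE q : phi q = \sum_i b i * x i `^ q.
  rewrite /phi big_enum /=; apply: eq_bigr => i _; by rewrite powRexp.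
have [q0 q0I hmin] : exists2 c, c \in `[0, 1] & forall t, t \in `[0, 1] -> phi c <= phi t.
  apply: EVT_min; first exact: ler01.
  by apply: continuous_subspaceT; exact: continuous_sum_expR.
have hphi : 1 < phi q0 by rewrite phiE; apply: hq; move: q0I; rewrite in_itv.
have p0 : 0 < phi q0 by apply: lt_trans hphi.
pose th i := b i * expR (q0 * X i) / phi q0.
have th0 i : 0 <= th i by rewrite divr_ge0 ?mulr_ge0 ?expR_ge0 ?ltW.
have th1 : \sum_(i <- A) th i = 1 by rewrite -mulr_suml divff// gt_eqF.
pose mu := \sum_(i <- A) th i * X i.
move: q0I; rewrite in_itv /= => /andP[q00 q01].
have tilt h : 0 <= q0 + h <= 1 -> 1 <= \sum_(i <- A) th i * expR (h * X i).
  move=> qh; have : phi q0 <= phi (q0 + h) by apply: hmin; rewrite in_itv.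
  rewrite -[X in _ -> X <= _](divff (lt0r_neq0 p0)).
  have -> : \sum_(i <- A) th i * expR (h * X i) = phi (q0 + h) / phi q0.
    rewrite /phi mulr_suml; apply: eq_bigr => i _.
    by rewrite mulrDl expRD /th; ring.
  by rewrite ler_pM2r// invr_gt0.
have mu_ge0 : q0 < 1 -> 0 <= mu.
  move=> q1; apply: (@tilt_mean_ge0 _ _ _ _ _ (1 - q0)) => //; first by rewrite subr_gt0.
  by move=> h /andP[h0 h1]; apply: tilt; lra.
have mu_le0 : 0 < q0 -> mu <= 0.
  move=> q1; have : 0 <= \sum_(a <- A) th a * (- X a).
    apply: (@tilt_mean_ge0 _ _ _ _ _ q0) => // h /andP[h0 h1].
    under eq_bigr do rewrite mulrN -mulNr; apply: tilt; lra.
  under eq_bigr do rewrite mulrN; rewrite sumrN -/mu; lra.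
pose eta := ln (phi q0) / 2.
have eta0 : 0 < eta by rewrite divr_gt0// ln_gt0.
have [V hV] := @words_chebyshev R _ A th X mu eta th0 th1 erefl eta0.
have [N1 hN1] := @expR_dominates R m.+1 eta 4 eta0.
(* At this length at least half of the weight is typical, and the exponential
   gain exceeds twice the number of letter counts. *)
pose n := (maxn N1 (Num.truncn (2 * V)).+1 + 1)%N.
have n0 : (0 < n)%N by rewrite /n addn1.
have nN1 : (N1 <= n)%N by rewrite /n; lia.
have Vn : V / n%:R <= 1 / 2.
  rewrite ler_pdivrMr ?ltr0n//.
  have : 2 * V < n%:R.
    apply: lt_le_trans (truncnS_gt _) _; rewrite ler_nat /n.
    by apply: leq_trans (leq_maxr N1 _) _; exact: leq_addr.
  by lra.
pose F w := \prod_(i <- w) b i * Num.min 1 (\prod_(i <- w) x i).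
have [||w0 sw0 hw0] := @perm_class_pigeonhole R 'I_m.+1 n F.
- by move=> u w uw; rewrite /F !(prod_const_perm _ uw).
- have wE w : w \in words A n -> \prod_(i <- w) th i =
      \prod_(i <- w) b i * expR (q0 * \sum_(i <- w) X i) / phi q0 ^+ n.
    move=> /size_mem_words <-; elim: w => [|i w IH].
      by rewrite !big_nil mulr0 expR0 expr0 divr1 mulr1.
    rewrite !big_cons IH mulrDr expRD /= exprS invfM /th; ring.
  have xE w : \prod_(i <- w) x i = expR (\sum_(i <- w) X i).
    elim: w => [|i w IH]; first by rewrite !big_nil expR0.
    by rewrite !big_cons IH expRD /X lnK ?posrE.
  have F0 w : 0 <= F w.
    rewrite /F mulr_ge0 ?prodr_ge0// => [i _|]; first exact: ltW.
    by rewrite le_min ler01 prodr_ge0// => i _; exact: ltW.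
  pose typ w := ~~ (eta * n%:R <= `|\sum_(a <- w) X a - n%:R * mu|).
  have typF w : w \in words A n -> typ w ->
      expR (eta * n%:R) * \prod_(i <- w) th i <= F w.
    move=> wA; rewrite /typ -ltNge ltr_norml => /andP[lo hi].
    rewrite wE// /F; set bw := \prod_(i <- w) b i.
    have bw0 : 0 <= bw by apply: prodr_ge0 => i _; exact: ltW.
    have -> : phi q0 ^+ n = expR (2 * eta * n%:R).
      have -> : 2 * eta = ln (phi q0) by rewrite /eta; lra.
      by rewrite expRM_natr lnK ?posrE.
    rewrite -expRN.
    have -> : expR (eta * n%:R) * (bw * expR (q0 * \sum_(i <- w) X i) * expR (- (2 * eta * n%:R))) =
        bw * expR (q0 * (\sum_(i <- w) X i) - eta * n%:R).
      have -> : q0 * (\sum_(i <- w) X i) - eta * n%:R =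
        eta * n%:R + q0 * (\sum_(i <- w) X i) + - (2 * eta * n%:R) by ring.
      by rewrite !expRD; ring.
    rewrite ler_wpM2l// le_min xE ler_expR -[X in _ <= X]expR0 ler_expR.
    set S := \sum_(i <- w) X i in lo hi *.
    have nr0 : (0 : R) <= n%:R by [].
    have nm1 : q0 < 1 -> 0 <= n%:R * mu by move=> /mu_ge0 h; rewrite mulr_ge0.
    have nm2 : 0 < q0 -> n%:R * mu <= 0 by move=> /mu_le0 h; rewrite mulr_ge0_le0.
    have en0 : 0 <= eta * n%:R by rewrite mulr_ge0 ?(ltW eta0).
    apply/andP; split.
      move: q00; rewrite le_eqVlt => /orP[/eqP <-|q0p]; first by rewrite mul0r; lra.
      have Su : S <= eta * n%:R by have := nm2 q0p; lra.
      have [S0|S0] := leP 0 S.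
        have : q0 * S <= 1 * S by rewrite ler_wpM2r.
        lra.
      have : q0 * S <= 0 by rewrite mulr_ge0_le0 ?ltW.
      lra.
    move: q01; rewrite le_eqVlt => /orP[/eqP ->|q0p]; first by rewrite mul1r; lra.
    have Su : - (eta * n%:R) <= S by have := nm1 q0p; lra.
    have [S0|S0] := leP 0 S.
      have : q0 * S <= 1 * S by rewrite ler_wpM2r// ltW.
      lra.
    have : 0 <= q0 * (eta * n%:R) by rewrite mulr_ge0.
    have : 0 <= (1 - q0) * (S + eta * n%:R) by apply: mulr_ge0; lra.
    lra.
  apply: (@lt_le_trans _ _ (expR (eta * n%:R) * (1 / 2))).
    rewrite card_ord natrX; have := hN1 n nN1; have : 0 < (n.+1%:R : R) ^+ m.+1 by rewrite exprn_gt0.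
    lra.
  have half : 1 / 2 <= \sum_(w <- words A n | typ w) \prod_(i <- w) th i.
    have : \sum_(w <- words A n) \prod_(i <- w) th i = 1 by rewrite sum_words_prod th1 expr1n.
    rewrite (bigID (fun w => eta * n%:R <= `|\sum_(a <- w) X a - n%:R * mu|)) /=.
    have := hV n n0; rewrite /typ; lra.
  apply: le_trans (ler_wpM2l (expR_ge0 _) half) _.
  rewrite mulr_sumr; apply: (@le_trans _ _ (\sum_(w <- words A n | typ w) F w)).
    by apply: ler_sum_mem => w wA tw; exact: typF.
  by apply: ler_sum_pred.
exists w0; rewrite sw0; split => //.
Qed.

(** * The pressure *)

Section Pressure.
Variables (R : realType) (m : nat) (lam : 'I_m.+1 -> R).
Hypothesis hlam : forall i, 0 < lam i < 1.

Lemma powR_decr (x t t' : R) : 0 < x < 1 -> t < t' -> x `^ t' < x `^ t.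
Proof.
move=> /andP[x0 x1] tt'; rewrite !powRexp// ltr_expR ltr_nM2r//.
by rewrite ln_lt0// x0.
Qed.

Lemma powsum_decr (c : 'I_m.+1 -> R) t t' : (forall i, 0 < c i) -> t < t' ->
  \sum_i lam i `^ t' * c i < \sum_i lam i `^ t * c i.
Proof.
move=> c0 tt'; apply: ltr_sum; first by apply/hasP; exists ord0; rewrite ?mem_index_enum.
by move=> i _; rewrite ltr_pM2r// powR_decr.
Qed.

(** Where the exponent makes one summand equal to 1 the sum is at least 1; where
    it makes all summands at most [1 / m.+1] the sum is at most 1. *)
Lemma powsum_root (c : 'I_m.+1 -> R) : (forall i, 0 < c i) ->
  exists t, \sum_i lam i `^ t * c i = 1.
Proof.
move=> c0; pose g t := \sum_i lam i `^ t * c i.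
have lam0 i : 0 < lam i by have /andP[] := hlam i.
have ll i : ln (lam i) < 0 by rewrite ln_lt0.
have gE t : g t = \sum_(i <- enum 'I_m.+1) c i * expR (t * ln (lam i)).
  by rewrite big_enum; apply: eq_bigr => i _; rewrite powRexp// mulrC.
pose t1 := - ln (c ord0) / ln (lam ord0).
have g1 : 1 <= g t1.
  rewrite /g (bigD1 ord0)//= powRexp// /t1 divfK ?lt_eqF// expRN lnK ?posrE//.
  rewrite mulVf ?gt_eqF// lerDl sumr_ge0// => i _; rewrite mulr_ge0 ?powR_ge0// ltW//.
pose s i := ln ((m.+1%:R * c i)^-1) / ln (lam i).
pose t2 := \sum_i `|s i|.
have g2 : g t2 <= 1.
  apply: (@le_trans _ _ (\sum_(i < m.+1) m.+1%:R^-1)).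
    apply: ler_sum => i _; rewrite -ler_pdivlMr// powRexp//.
    have n0 : 0 < (m.+1%:R * c i)^-1 by rewrite invr_gt0 mulr_gt0.
    rewrite -invfM -[leRHS]lnK ?posrE// ler_expR -ler_ndivrMr//.
    apply: le_trans (ler_norm _) _; rewrite -/(s i) /t2 (bigD1 i)//= lerDl sumr_ge0//.
  by rewrite sumr_const card_ord -[_ *+ _]mulr_natl divff.
have t12 : t1 <= t2.
  rewrite leNgt; apply/negP => /(powsum_decr c0) h.
  by have := le_lt_trans g1 h; rewrite ltNge g2.
have [||t _ ht] := @IVT R g t1 t2 1 t12.
- apply: continuous_subspaceT; rewrite (_ : g = fun t => \sum_(i <- enum 'I_m.+1) c i * expR (t * ln (lam i))).
    exact: continuous_sum_expR.
  by apply/funext.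
- by rewrite ge_min g2 orbT le_max g1.
by exists t.
Qed.

Variables (p : 'I_m.+1 -> R) (alpha : R).
Hypotheses (hp : forall i, 0 < p i) (hp1 : \sum_(i < m.+1) p i = 1).
Hypothesis halpha : 0 < alpha.

Let c0 q i : 0 < (p i * expR alpha) `^ q.
Proof. by rewrite powR_gt0// mulr_gt0 ?expR_gt0. Qed.

Lemma pressureP q :
  \sum_i lam i `^ (pressure lam p alpha q) * (p i * expR alpha) `^ q = 1.
Proof. by have := getPex (powsum_root (c0 q)). Qed.

(** At the exponent 0 the sum is [\sum_i (p i * expR alpha) `^ q], which is at
    least [\sum_i p i = 1]. *)
Lemma pressure_ge0 q : 0 <= q <= 1 -> 0 <= pressure lam p alpha q.
Proof.
move=> /andP[q0 q1]; rewrite leNgt; apply/negP => /(powsum_decr (c0 q)).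
rewrite pressureP; apply/negP; rewrite -leNgt -hp1; apply: ler_sum => i _.
rewrite powRr0 mul1r.
have p1 : p i <= 1 by rewrite -hp1 (bigD1 i)//= lerDl sumr_ge0// => j _; exact: ltW.
apply: (@le_trans _ _ (p i `^ q)); first by apply: ger1_powR; rewrite ?hp.
apply: ge0_ler_powR; rewrite ?nnegrE ?(ltW (hp i))// ?mulr_ge0 ?expR_ge0 ?(ltW (hp i))//.
by rewrite ler_peMr ?(ltW (hp i))// -expR0 ler_expR ltW.
Qed.

Let pressures := [set pressure lam p alpha q | q in [set q : R | 0 <= q <= 1]].

Let pressures_neq0 : pressures !=set0.
Proof. by exists (pressure lam p alpha 0), 0 => //=; rewrite lexx ler01. Qed.

Let pressures_lb : lbound pressures 0.
Proof. by move=> _ [q hq <-]; exact: pressure_ge0. Qed.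

Lemma dim_formula_ge0 : 0 <= dim_formula lam p alpha.
Proof. exact: lb_le_inf. Qed.

Lemma dim_formula_lt t : dim_formula lam p alpha < t ->
  exists2 q, 0 <= q <= 1 & \sum_i lam i `^ t * (p i * expR alpha) `^ q < 1.
Proof.
move=> /inf_lt[]// _ [q hq <-] qt; exists q => //.
by rewrite -(pressureP q); exact: powsum_decr.
Qed.

Lemma lt_dim_formula t q : t < dim_formula lam p alpha -> 0 <= q <= 1 ->
  1 < \sum_i lam i `^ t * (p i * expR alpha) `^ q.
Proof.
move=> tD hq; rewrite -(pressureP q); apply: powsum_decr => //.
by apply: lt_le_trans tD _; apply: ge_inf; [exists 0|exists q].
Qed.

End Pressure.

(** * Iterated function systems of similarities *)

Section IFS.
Variables (R : realType) (d m : nat).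
Variables (f : 'I_m.+1 -> 'rV[R]_d -> 'rV[R]_d) (lam : 'I_m.+1 -> R).
Hypothesis hlam : forall i, 0 < lam i < 1.
Hypothesis hf : forall i, similarity (f i) (lam i).

Implicit Types (w v : seq 'I_m.+1) (o : symbol_space m).

Definition ratio w := \prod_(i <- w) lam i.

Lemma word_map_cat u v x : word_map f (u ++ v) x = word_map f u (word_map f v x).
Proof. by rewrite /word_map foldr_cat. Qed.

Lemma ratio_gt0 w : 0 < ratio w.
Proof. by apply: prodr_gt0 => i _; have /andP[] := hlam i. Qed.

Lemma ratio_ge0 w : 0 <= ratio w.
Proof. exact/ltW/ratio_gt0. Qed.

Lemma ratio_cat u v : ratio (u ++ v) = ratio u * ratio v.
Proof. by rewrite /ratio big_cat. Qed.

Lemma ratio_nil : ratio [::] = 1.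
Proof. by rewrite /ratio big_nil. Qed.

Lemma ratio_cons i v : ratio (i :: v) = lam i * ratio v.
Proof. by rewrite /ratio big_cons. Qed.

Lemma similarity_word_map w : similarity (word_map f w) (ratio w).
Proof.
elim: w => [|i w IH] x y /=; first by rewrite ratio_nil mul1r.
by rewrite hf IH ratio_cons mulrA.
Qed.

Lemma word_map_inj w : injective (word_map f w).
Proof. exact: similarity_inj (ratio_gt0 w) (similarity_word_map w). Qed.

Lemma ratio_geometric : exists2 q : R, 0 < q < 1 & forall w, ratio w <= q ^+ size w.
Proof.
pose q := \big[Num.max/lam ord0]_i lam i.
have lq i : lam i <= q by apply: le_bigmax.
have q0 : 0 < q by apply: lt_le_trans (lq ord0); have /andP[] := hlam ord0.
exists q => [|w].
  rewrite q0 /=; apply: bigmax_lt => [|i _].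
    by have /andP[] := hlam ord0.
  by have /andP[] := hlam i.
elim: w => [|i w IH]; first by rewrite ratio_nil expr0.
rewrite ratio_cons /= exprS ler_pM ?ratio_ge0//.
by have /andP[/ltW] := hlam i.
Qed.

(** At the first letter where two words differ, their images of [U] become
    disjoint. *)
Lemma osc_incomparable (U : set 'rV[R]_d) :
  (forall i, f i @` U `<=` U) ->
  (forall i j, i != j -> (f i @` U) `&` (f j @` U) = set0) ->
  forall w v x y, U x -> U y -> word_map f w x = word_map f v y ->
  prefix w v || prefix v w.
Proof.
move=> fU dU; have wU w x : U x -> U (word_map f w x).
  by elim: w => //= i w IH /IH Uw; apply: (fU i); exists (word_map f w x).
elim=> [|i w IH] [|j v] x y Ux Uy //=.
have [<-|ij] := eqVneq i j; last first.
  move=> e; suff : set0 (f i (word_map f w x)) by [].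
  rewrite -(dU i j ij); split; first by exists (word_map f w x) => //; exact: wU.
  by rewrite /= e; exists (word_map f v y) => //; exact: wU.
rewrite /= => /(similarity_inj _ (hf i)) e.
by apply: IH Ux Uy _; apply: e; have /andP[] := hlam i.
Qed.

(** Choose [a] in the open set [U] and a ball of radius [r0] about it inside
    [U].  If [word_map f v a] were closer to [word_map f w a], it would be the
    image under [word_map f w] of a point of this ball, and the images of [U]
    would meet. *)
Lemma osc_separation : open_set_condition f ->
  exists a (r0 : R), 0 < r0 /\ forall w v, ~~ prefix w v -> ~~ prefix v w ->
    r0 * ratio w <= enorm (word_map f w a - word_map f v a).
Proof.
move=> [U [[a Ua] _ oU fU dU]].
have [r0 r00 hr] := open_contains_eball oU Ua.
exists a, r0; split=> // w v wv vw; rewrite leNgt; apply/negP => hlt.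
have [z hz] := similarity_surj (ratio_gt0 w) (similarity_word_map w) (word_map f v a).
have Uz : U z.
  apply: hr; rewrite -(ltr_pM2r (ratio_gt0 w)) mulrC -similarity_word_map hz.
  by rewrite enormB.
by have := osc_incomparable fU dU Uz Ua hz; rewrite (negbTE wv) (negbTE vw).
Qed.

(** * The coding map *)

Variable L : set 'rV[R]_d.
Hypothesis hL : attractor f L.

Lemma attractor_word w x : L x -> L (word_map f w x).
Proof.
have [_ _ LE] := hL; elim: w => //= i w IH /IH Lw.
by rewrite LE; exists i => //; exists (word_map f w x).
Qed.

Lemma attractor_diam : exists2 D : R, 0 < D &
  forall w x y, (word_map f w @` L) x -> (word_map f w @` L) y ->
    enorm (x - y) <= ratio w * D.
Proof.
have [_ cL _] := hL; have [D D0 hD] := compact_ebounded cL.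
exists D => // w _ _ [x Lx <-] [y Ly <-].
by rewrite similarity_word_map ler_wpM2l ?ratio_ge0// hD.
Qed.

Lemma cvg_geometric0 (C q : R) : 0 < q < 1 -> (fun n => C * q ^+ n) @ \oo --> 0.
Proof.
by move=> /andP[q0 q1]; apply: (cvg_geometric C); rewrite ger0_norm ?(ltW q0).
Qed.

Lemma initial_wordD o n k :
  initial_word o (n + k) = initial_word o n ++ initial_word (left_shift n o) k.
Proof.
rewrite /initial_word /mkseq iotaD map_cat; congr (_ ++ _).
by rewrite add0n -[in LHS](addn0 n) iotaDl -map_comp.
Qed.

Lemma size_initial_word o n : size (initial_word o n) = n.
Proof. exact: size_mkseq. Qed.

(** The limit does not depend on the base point, and a base point in the
    attractor shows that the limit is in it: the nested images of the attractor
    have geometrically small diameters. *)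
Lemma coding_exists o : exists2 y, L y &
  forall x, (fun n => word_map f (initial_word o n) x) @ \oo --> y.
Proof.
have [[x0 Lx0] cL _] := hL.
have [q q01 hq] := ratio_geometric.
have [D D0 hD] := attractor_diam.
pose u n := word_map f (initial_word o n) x0.
have uu n k : (n <= k)%N -> enorm (u k - u n) <= D * q ^+ n.
  move=> nk; apply: le_trans (hD (initial_word o n) _ _ _ _) _.
  - rewrite /u -(subnKC nk) initial_wordD word_map_cat; eexists; last by [].
    exact: attractor_word.
  - by exists x0.
  - by rewrite mulrC ler_wpM2l ?(ltW D0)//; have := hq (initial_word o n); rewrite size_initial_word.
have ucvg : cvgn u.
  apply: cauchy_cvg; apply: cauchy_exP => e e0.
  have /cvgrPdist_lt /(_ e e0)[N _ hN] := cvg_geometric0 D q01.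
  exists (u N); exists N => // n /= Nn; rewrite -ball_normE /= distrC.
  apply: le_lt_trans (norm_le_enorm _) _; apply: le_lt_trans (uu _ _ Nn) _.
  by have := hN N (leqnn N); rewrite sub0r normrN; apply: le_lt_trans; exact: ler_norm.
have [y uy] : exists y : 'rV[R]_d, u @ \oo --> y by exists (limn u).
exists y.
  have clL : closed L by apply: compact_closed cL; exact: norm_hausdorff.
  move: (y) uy; apply: (closed_cvg L clL).
  by apply: nearW => n; exact: attractor_word.
move=> x; pose c := enorm (x - x0).
have -> : (fun n => word_map f (initial_word o n) x) =
    (fun n => u n + (word_map f (initial_word o n) x - u n)).
  by apply/funext => n; rewrite addrC subrK.
rewrite -[X in _ --> X]addr0; apply: cvgD => //.
apply: (@cvg_of_enorm _ _ _ _ (fun n => c * q ^+ n)); last exact: cvg_geometric0.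
move=> n; rewrite subr0 similarity_word_map mulrC ler_wpM2l ?enorm_ge0//.
by have := hq (initial_word o n); rewrite size_initial_word.
Qed.

Lemma cvg_coding o x : (fun n => word_map f (initial_word o n) x) @ \oo --> coding f o.
Proof.
have [y Ly hy] := coding_exists o; rewrite /coding.
suff -> : limn (fun n => word_map f (initial_word o n) 0) = y by [].
by apply: cvg_lim; [exact: norm_hausdorff|exact: hy].
Qed.

Lemma coding_in_attractor o : L (coding f o).
Proof.
have [y Ly hy] := coding_exists o.
suff -> : coding f o = y by [].
by apply: cvg_lim; [exact: norm_hausdorff|exact: hy].
Qed.

Lemma coding_shift o n :
  word_map f (initial_word o n) (coding f (left_shift n o)) = coding f o.
Proof.
have hc := @cvg_coding o 0; have hs := @cvg_coding (left_shift n o) 0.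
have hc' : (fun k => word_map f (initial_word o k) 0) @ \oo -->
    word_map f (initial_word o n) (coding f (left_shift n o)); last first.
  exact: (cvg_unique (@norm_hausdorff _ _) hc' hc).
rewrite -(cvg_shiftn n (fun k => word_map f (initial_word o k) 0)).
have : (fun k => enorm (word_map f (initial_word (left_shift n o) k) 0 -
    coding f (left_shift n o))) @ \oo --> 0.
  apply/cvgrPdist_lt => e e0; apply: filterS (cvg_enorm e0 hs) => k.
  by rewrite sub0r normrN ger0_norm ?enorm_ge0.
move=> h0; have : (fun k => ratio (initial_word o n) * enorm (word_map f (initial_word (left_shift n o) k) 0 -
    coding f (left_shift n o))) @ \oo --> 0.
  by rewrite -[X in _ --> X](mulr0 (ratio (initial_word o n))); apply: cvgM => //; exact: cvg_cst.
apply: cvg_of_enorm => k.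
by rewrite /= addnC initial_wordD word_map_cat similarity_word_map.
Qed.

Lemma coding_in_word o n : (word_map f (initial_word o n) @` L) (coding f o).
Proof.
exists (coding f (left_shift n o)); [exact: coding_in_attractor|exact: coding_shift].
Qed.

Lemma coding_unique o y : (forall n, (word_map f (initial_word o n) @` L) y) -> y = coding f o.
Proof.
move=> hy; have [q q01 hq] := ratio_geometric.
have [D D0 hD] := attractor_diam.
have : (fun n : nat => y) @ \oo --> coding f o.
  apply: (@cvg_of_enorm _ _ _ _ (fun n => D * q ^+ n)); last exact: cvg_geometric0.
  move=> n; apply: le_trans (hD _ _ _ (hy n) (coding_in_word o n)) _.
  by rewrite mulrC ler_wpM2l ?(ltW D0)//; have := hq (initial_word o n); rewrite size_initial_word.
by move=> h; apply: (cvg_unique (@norm_hausdorff _ _)) h; exact: cvg_cst.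
Qed.

(** A code is read off by choosing a preimage in the attractor again and again. *)
Lemma attractor_coding : L = coding f @` [set: symbol_space m].
Proof.
apply/seteqP; split => [x Lx|_ [c _ <-]]; last exact: coding_in_attractor.
have /choice[s hs] (z : 'rV[R]_d) : exists iz : 'I_m.+1 * 'rV[R]_d, L z -> L iz.2 /\ f iz.1 iz.2 = z.
  have [Lz|nLz] := pselect (L z); last by exists (ord0, 0).
  have [_ _ LE] := hL; have := Lz; rewrite {1}LE => -[i _ [z' Lz' <-]].
  by exists (i, z').
pose z n := iter n (fun z => (s z).2) x.
have Lz n : L (z n) by elim: n => //= n /hs[].
pose o n := (s (z n)).1; exists o => //; apply/esym/coding_unique => n.
exists (z n) => //; elim: n => // n IH.
have -> : initial_word o n.+1 = initial_word o n ++ [:: o n].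
  by rewrite /initial_word mkseqS cats1.
rewrite word_map_cat /=.
by rewrite [f _ _](hs _ (Lz n)).2.
Qed.

End IFS.

(** * Hausdorff measure: covers *)

Section Hausdorff.
Variables (R : realType) (d : nat).
Implicit Types (E F : set 'rV[R]_d).

Lemma hausdorff_term_ge0 s E : (0 <= hausdorff_term s E)%E.
Proof. by rewrite /hausdorff_term; case: ifP => // _; exact: poweR_ge0. Qed.

Lemma hausdorff_term0 s : hausdorff_term s (set0 : set 'rV[R]_d) = 0%E.
Proof. by rewrite /hausdorff_term eqxx. Qed.

Lemma diam_le E (c : R) : (forall x y, E x -> E y -> enorm (x - y) <= c) -> (diam E <= c%:E)%E.
Proof. by move=> h; apply: ge_ereal_sup => _ [[x y] [Ex Ey] <-]; rewrite lee_fin h. Qed.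

Lemma le_diam E x y : E x -> E y -> ((enorm (x - y))%:E <= diam E)%E.
Proof. by move=> Ex Ey; apply: ereal_sup_ubound; exists (x, y). Qed.

Lemma diam_ge0 E : E !=set0 -> (0 <= diam E)%E.
Proof. by move=> [x Ex]; apply: le_trans (le_diam Ex Ex); rewrite lee_fin enorm_ge0. Qed.

Lemma hausdorff_term_le s E (c : R) : 0 <= s -> 0 <= c ->
  (forall x y, E x -> E y -> enorm (x - y) <= c) ->
  (hausdorff_term s E <= (c `^ s)%:E)%E.
Proof.
move=> s0 c0 h; rewrite /hausdorff_term; case: ifPn => [_|/set0P nE].
  by rewrite lee_fin powR_ge0.
rewrite -poweR_EFin; apply: gt0_ler_poweR => //.
- by rewrite in_itv /= diam_ge0//= leey.
- by rewrite in_itv /= lee_fin c0 leey.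
- exact: diam_le.
Qed.

Lemma nneseries_le (u : (\bar R)^nat) (c : \bar R) : (forall n, (0 <= u n)%E) ->
  (forall n, (\sum_(0 <= i < n) u i <= c)%E) -> (\big[+%E/0%R]_(0 <= i <oo) u i <= c)%E.
Proof.
move=> u0 uc; apply: lime_le; first by apply: is_cvg_nneseries.
by apply: nearW.
Qed.

(** Countable covers are sequences, but they are produced as a finite list for
    each [J].  The lists are concatenated; the neutral element [z] is put in
    front of each list so that the concatenation never ends. *)
Lemma list_enumeration (T : eqType) (z : T) (W : nat -> seq T) (h : T -> \bar R) (c : \bar R) :
  (forall A, (0 <= h A)%E) -> h z = 0%E ->
  (forall n, (\sum_(J < n) \sum_(A <- W J) h A <= c)%E) ->
  exists U : nat -> T,
    [/\ forall J A, A \in W J -> exists k, U k = A,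
        forall k, U k = z \/ exists2 J, U k \in W J & True &
        (\big[+%E/0%R]_(0 <= k <oo) h (U k) <= c)%E].
Proof.
move=> h0 hz hc.
pose V J := z :: W J.
pose F n := flatten [seq V J | J <- iota 0 n].
have FS n : F n.+1 = F n ++ V n by rewrite /F -addn1 iotaD map_cat flatten_cat /= cats0.
have sF n : (n <= size (F n))%N.
  by elim: n => // n IH; rewrite FS size_cat /= addnS ltnS; apply: leq_trans IH (leq_addr _ _).
have Fle n k : (n <= k)%N -> exists s, F k = F n ++ s.
  move=> /subnKC <-; elim: (k - n)%N => [|j [s IH]]; first by exists [::]; rewrite addn0 cats0.
  by exists (s ++ V (n + j)%N); rewrite addnS FS IH catA.
pose U k := nth z (F k.+1) k.
have UF n k : (k < size (F n))%N -> U k = nth z (F n) k.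
  move=> kn; have [nk|kn'] := leqP n k.+1.
    by have [s es] := Fle _ _ nk; rewrite /U es nth_cat kn.
  have [s es] := Fle _ _ (ltnW kn'); rewrite es nth_cat.
  by have -> : (k < size (F k.+1))%N by exact: sF.
have memF n A : A \in F n -> A = z \/ exists2 J, A \in W J & True.
  move=> /flattenP[B /mapP[J _ ->]]; rewrite inE => /orP[/eqP ->|AJ]; [by left|right].
  by exists J.
exists U; split.
- move=> J A AJ; have AF : A \in F J.+1 by rewrite FS mem_cat inE AJ !orbT.
  exists (index A (F J.+1)); rewrite (@UF J.+1) ?index_mem// nth_index//.
- move=> k; apply: (@memF k.+1); apply: mem_nth; exact: sF.
- apply: nneseries_le => [k|n]; first exact: h0.
  apply: le_trans (hc n).
  have -> : (\sum_(J < n) \sum_(A <- W J) h A = \sum_(A <- F n) h A)%E.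
    elim: n => [|n IH]; first by rewrite big_ord0 big_nil.
    by rewrite big_ord_recr /= IH FS big_cat /= big_cons hz add0e.
  rewrite (big_nth z) (big_cat_nat _ (sF n))//=.
  rewrite (eq_big_nat _ _ (F2 := fun k => h (nth z (F n) k))).
    by rewrite leeDl// sume_ge0.
  by move=> k /andP[_ kn]; rewrite (@UF n) // (leq_trans kn (sF n)).
Qed.

Lemma hausdorff_measure_ge0 s E : (0 <= hausdorff_measure s E)%E.
Proof.
apply: (@le_trans _ _ (hausdorff_premeasure s 1 E)); last first.
  by apply: ereal_sup_ubound; exists 1 => //=.
by apply: le_ereal_inf_tmp => _ [U _ <-]; apply: nneseries_ge0 => n _ _; exact: hausdorff_term_ge0.
Qed.

Lemma hausdorff_measure_eq0 s E :
  (forall delta e : R, 0 < delta -> 0 < e -> exists2 U, delta_cover delta E U &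
     (\big[+%E/0%R]_(0 <= n <oo) hausdorff_term s (U n) <= e%:E)%E) ->
  hausdorff_measure s E = 0%E.
Proof.
move=> h; apply/eqP; rewrite eq_le hausdorff_measure_ge0 andbT.
apply: ge_ereal_sup => _ [delta /= d0 <-]; apply/lee_addgt0Pr => e e0; rewrite add0e.
have [U dU hU] := h _ _ d0 e0; apply: le_trans hU.
by apply: ereal_inf_lbound; exists U.
Qed.

Lemma hausdorff_measure_eq0_cover s E (delta e : R) : hausdorff_measure s E = 0%E ->
  0 < delta -> 0 < e -> exists2 U, delta_cover delta E U &
     (\big[+%E/0%R]_(0 <= n <oo) hausdorff_term s (U n) < e%:E)%E.
Proof.
move=> h d0 e0.
have : (hausdorff_premeasure s delta E < e%:E)%E.
  apply: (@le_lt_trans _ _ 0%E); last by rewrite lte_fin.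
  by rewrite -h; apply: ereal_sup_ubound; exists delta.
by move=> /ereal_inf_lt[_ [U dU <-] hU]; exists U.
Qed.

Lemma hausdorff_measure_mono s E F : E `<=` F ->
  (hausdorff_measure s E <= hausdorff_measure s F)%E.
Proof.
move=> EF; apply: ge_ereal_sup => _ [delta /= d0 <-].
apply: (@le_trans _ _ (hausdorff_premeasure s delta F)); last first.
  by apply: ereal_sup_ubound; exists delta.
apply: le_ereal_inf_tmp => _ [U [FU dU] <-]; apply: ereal_inf_lbound.
by exists U => //; split => //; exact: subset_trans FU.
Qed.

Lemma hausdorff_measure_setU_null s E F : hausdorff_measure s F = 0%E ->
  (hausdorff_measure s (E `|` F) <= hausdorff_measure s E)%E.
Proof.
move=> F0; apply: ge_ereal_sup => _ [delta /= d0 <-].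
apply: (@le_trans _ _ (hausdorff_premeasure s delta E)); last first.
  by apply: ereal_sup_ubound; exists delta.
apply: le_ereal_inf_tmp => _ [U [EU dU] <-]; apply/lee_addgt0Pr => e e0.
have [V [FV dV] hV] := hausdorff_measure_eq0_cover F0 d0 e0.
have [|||Z [ZU ZW hZ]] := @list_enumeration _ set0 (fun J => [:: U J; V J]) (hausdorff_term s)
  ((\big[+%E/0%R]_(0 <= n <oo) hausdorff_term s (U n)) + e%:E)%E.
- exact: hausdorff_term_ge0.
- exact: hausdorff_term0.
- move=> n; apply: (@le_trans _ _ (\sum_(0 <= J < n) hausdorff_term s (U J) + \sum_(0 <= J < n) hausdorff_term s (V J))%E).
    rewrite -big_split /= big_mkord le_eqVlt; apply/orP; left; apply/eqP; apply: eq_bigr => J _.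
    by rewrite big_cons big_seq1.
  apply: leeD.
    by apply: nneseries_lim_ge => k _ _; exact: hausdorff_term_ge0.
  apply: le_trans (ltW hV).
  by apply: nneseries_lim_ge => k _ _; exact: hausdorff_term_ge0.
apply: le_trans hZ; apply: ereal_inf_lbound; exists Z => //; split.
- move=> x [/EU|/FV] [n _ xn].
      by have [|k ek] := ZU n (U n); [rewrite inE eqxx|exists k => //; rewrite ek].
  by have [|k ek] := ZU n (V n); [rewrite !inE eqxx orbT|exists k => //; rewrite ek].
- move=> n; case: (ZW n) => [->|[J]].
    by apply: diam_le.
  by rewrite !inE => /orP[/eqP ->|/eqP ->].
Qed.

Lemma hausdorff_dim_le E (t : R) : 0 <= t ->
  (forall s, t < s -> hausdorff_measure s E = 0%E) -> (hausdorff_dim E <= t%:E)%E.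
Proof.
move=> t0 h; apply/lee_addgt0Pr => e e0; apply: ereal_inf_lbound.
exists (t + e) => //; split; first by rewrite addr_ge0// ltW.
by apply: h; rewrite ltrDl.
Qed.

Lemma hausdorff_dim_ge E (t : R) :
  (forall s, 0 <= s < t -> hausdorff_measure s E <> 0%E) -> (t%:E <= hausdorff_dim E)%E.
Proof.
move=> h; apply: le_ereal_inf_tmp => _ [s [s0 sE] <-]; rewrite lee_fin leNgt; apply/negP => st.
by apply: (h s) => //; rewrite s0.
Qed.

End Hausdorff.

Section WordCovers.
Variables (R : realType) (d m : nat).
Variables (f : 'I_m.+1 -> 'rV[R]_d -> 'rV[R]_d) (lam : 'I_m.+1 -> R).
Hypothesis hlam : forall i, 0 < lam i < 1.
Hypothesis hf : forall i, similarity (f i) (lam i).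
Variable L : set 'rV[R]_d.
Hypothesis hL : attractor f L.

(** The images of the attractor under long words have small diameter,
    proportional to the ratio, so null sets can be recognised by sums over
    words. *)
Lemma word_cover_null (s : R) (E : set 'rV[R]_d) : 0 <= s ->
  (forall (e : R) L0, 0 < e -> exists W : nat -> seq (seq 'I_m.+1),
    [/\ forall x, E x -> exists J w, w \in W J /\ (word_map f w @` L) x,
        forall J w, w \in W J -> (L0 <= size w)%N &
        forall n, \sum_(J < n) \sum_(w <- W J) ratio lam w `^ s <= e]) ->
  hausdorff_measure s E = 0%E.
Proof.
move=> s0 h; apply: hausdorff_measure_eq0 => delta e d0 e0.
have [D D0 hD] := attractor_diam hlam hf hL.
have [q q01 hq] := ratio_geometric hlam.
have [L0 hL0] : exists L0, D * q ^+ L0 < delta.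
  have /cvgrPdist_lt /(_ delta d0)[N _ hN] := cvg_geometric0 D q01.
  exists N; have := hN N (leqnn N); rewrite sub0r normrN; apply: le_lt_trans; exact: ler_norm.
have Ds : 0 < D `^ s by rewrite powR_gt0.
have [|W [EW sW hW]] := h (e / D `^ s) L0; first by rewrite divr_gt0.
have rD w x y : (word_map f w @` L) x -> (word_map f w @` L) y ->
  enorm (x - y) <= ratio lam w * D by apply: hD.
have [|||U [UW1 UW2 hU]] := @list_enumeration R _ set0
  (fun J => [seq word_map f w @` L | w <- W J]) (hausdorff_term s) e%:E.
- exact: hausdorff_term_ge0.
- exact: hausdorff_term0.
- move=> n; apply: (@le_trans _ _ (\sum_(J < n) \sum_(w <- W J) ratio lam w `^ s * D `^ s)%:E).
    rewrite -sumEFin; apply: lee_sum => J _; rewrite big_map -sumEFin; apply: lee_sum => w _.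
    rewrite -powRM ?ratio_ge0 ?(ltW D0)//.
    by apply: hausdorff_term_le => //; [rewrite mulr_ge0 ?ratio_ge0 ?(ltW D0)|exact: rD].
  rewrite lee_fin; under eq_bigr do rewrite -mulr_suml; rewrite -mulr_suml -ler_pdivlMr//.
exists U => //; split.
- move=> x /EW[J [w [wJ wx]]]; have [|k ek] := UW1 J (word_map f w @` L); first exact: map_f.
  by exists k => //; rewrite ek.
- move=> k; case: (UW2 k) => [->|[J]]; first exact: diam_le.
  move=> /mapP[w wJ ->] _; apply: diam_le => x y wx wy.
  apply: le_trans (rD _ _ _ wx wy) _; rewrite mulrC; apply: ltW; apply: le_lt_trans hL0.
  rewrite ler_wpM2l ?(ltW D0)//; apply: le_trans (hq w) _.
  have /andP[q0 q1] := q01; apply: ler_wiXn2l; rewrite ?(ltW q0) ?(ltW q1)//; exact: sW wJ.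
Qed.

End WordCovers.

(** * The mass distribution principle *)

Lemma powR_exprn (R : realType) (a s : R) k : 0 <= a -> (a ^+ k) `^ s = (a `^ s) ^+ k.
Proof.
move=> a0; elim: k => [|k IH]; first by rewrite !expr0 powR1.
by rewrite !exprS powRM ?exprn_ge0// IH.
Qed.

Section OSC.
Variables (R : realType) (d m : nat).
Variables (f : 'I_m.+1 -> 'rV[R]_d -> 'rV[R]_d) (lam : 'I_m.+1 -> R).
Hypothesis hlam : forall i, 0 < lam i < 1.
Hypothesis hf : forall i, similarity (f i) (lam i).
Hypothesis hosc : open_set_condition f.
Variable L : set 'rV[R]_d.
Hypothesis hL : attractor f L.

Lemma attractor_near (a : 'rV[R]_d) : exists2 D : R, 0 < D &
  forall w y, (word_map f w @` L) y -> enorm (word_map f w a - y) <= ratio lam w * D.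
Proof.
have [[y0 Ly0] cL _] := hL; have [D D0 hD] := compact_ebounded cL.
exists (enorm (a - y0) + D) => [|w _ [y Ly <-]]; first by rewrite ltr_wpDl// enorm_ge0.
rewrite (similarity_word_map hf) ler_wpM2l ?ratio_ge0//.
by apply: le_trans (enorm_triangle y0 _ _) _; rewrite lerD2l hD.
Qed.

Lemma ratio_min : exists2 c : R, 0 < c & forall i, c <= lam i.
Proof.
exists (\big[Num.min/lam ord0]_i lam i) => [|i]; last by apply: bigmin_le.
by apply: lt_bigmin => [|i _]; [have /andP[] := hlam ord0|have /andP[] := hlam i].
Qed.

(** A second code of the fixed point [x] of [f i], stripped of its leading
    letters [i], is a code [j] of [x] with [j 0 != i].  Putting [k] letters [i]
    in front of [j] gives a code of [x] for every [k], and these codes are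
    pairwise incomparable.  Cut off at a common scale, they give as many
    separated pieces near [x] as desired, against [packing]. *)
Lemma fixed_code_unique i (o : symbol_space m) :
  coding f o = coding f (fun=> i) -> forall n, o n = i.
Proof.
set x := coding f (fun=> i) => ox.
apply: contrapT => /existsNP ni.
have ex : exists k, o k != i by have [k /eqP] := ni; exists k.
case: (ex_minnP ex) => k ok kmin.
have ii n : initial_word (fun=> i) n = nseq n i.
  by apply: (@eq_from_nth _ i); rewrite ?size_mkseq ?size_nseq// => p pn; rewrite nth_mkseq// nth_nseq pn.
have xi n : word_map f (nseq n i) x = x.
  by have := coding_shift hlam hf hL (fun=> i) n; rewrite ii.
have oi : initial_word o k = nseq k i.
  apply: (@eq_from_nth _ i); rewrite ?size_mkseq ?size_nseq// => p pk; rewrite nth_mkseq// nth_nseq pk.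
  by apply/eqP; rewrite -[_ == _]negbK; apply/negP => /kmin; rewrite leqNgt pk.
pose j := left_shift k o.
have j0 : j 0%N != i by rewrite /j /left_shift addn0.
have xj : coding f j = x.
  apply: (word_map_inj hlam hf (w := nseq k i)).
  by rewrite xi -ox -oi (coding_shift hlam hf hL).
have [a [r0 [r00 sep]]] := osc_separation hlam hf hosc.
have [D D0 hD] := attractor_near a.
have [c c0 hc] := ratio_min.
have [q q01 hq] := ratio_geometric hlam.
have [|N hN] := @packing R d D (r0 * c) _ D0; first by rewrite mulr_gt0.
pose r := lam i ^+ N.+1.
have /andP[li0 li1] := hlam i.
have r1 : 0 < r by rewrite exprn_gt0.
have rn n : ratio lam (nseq n i) = lam i ^+ n.
  by elim: n => [|n IH]; rewrite /= ?ratio_nil// ratio_cons IH exprS.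
pose w k' n := nseq k' i ++ initial_word j n.
have rw k' n : ratio lam (w k' n) = lam i ^+ k' * ratio lam (initial_word j n) by rewrite ratio_cat rn.
(* The least n for which the ratio drops to r; one step loses at most the
   factor c. *)
have /choice[n hn] k' : exists n, (k' <= N)%N -> [/\ (0 < n)%N, ratio lam (w k' n) <= r &
    c * r <= ratio lam (w k' n)].
  have [kN|] := leqP k' N; last by exists 0%N.
  have ex2 : exists n, ratio lam (w k' n) <= r.
    have /cvgrPdist_lt /(_ r r1)[M _ hM] := cvg_geometric0 1 q01.
    exists M; rewrite rw; apply: (@le_trans _ _ (1 * q ^+ M)).
      apply: ler_pM; rewrite ?exprn_ge0 ?ratio_ge0 ?(ltW li0)//.
        by rewrite exprn_ile1 ?(ltW li0) ?(ltW li1).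
      by have := hq (initial_word j M); rewrite size_initial_word.
    have := hM M (leqnn M); rewrite sub0r normrN => h.
    by apply: ltW; apply: le_lt_trans h; exact: ler_norm.
  case: (ex_minnP ex2) => n hn nmin; exists n => _.
  case: n hn nmin => [|n] hn nmin.
    move: hn; rewrite rw /= ratio_nil mulr1 /r leNgt => /negP[].
    by rewrite ltr_iXn2l// ltnS.
  split=> //.
  have : r < ratio lam (w k' n).
    by rewrite ltNge; apply/negP => /nmin; rewrite ltnn.
  rewrite !rw (_ : initial_word j n.+1 = initial_word j n ++ [:: j n]); last first.
    by rewrite /initial_word mkseqS cats1.
  rewrite ratio_cat ratio_cons ratio_nil mulr1 mulrA mulrC => /ltW h.
  by rewrite (mulrC c); apply: ler_pM; rewrite ?(ltW c0) ?(ltW r1).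
have := hN _ (iota 0 N.+1) (fun k' => word_map f (w k' (n k')) a) x r r1 (iota_uniq _ _).
rewrite size_iota ltnn => H; suff : false by []; apply: H => [k1|k1 k2]; rewrite !mem_iota /= !add0n !ltnS.
- move=> /hn[_ h _]; apply: (@le_trans _ _ (ratio lam (w k1 (n k1)) * D)).
    apply: hD; rewrite -(xi k1) -xj.
    have [z Lz hz] := coding_in_word hlam hf hL j (n k1).
    by exists z => //; rewrite /w word_map_cat hz xj.
  by rewrite mulrC ler_wpM2l// ltW.
- move=> k1N k2N k12.
  have npre k1' k2' : (k1' <= N)%N -> (k2' <= N)%N -> (k1' < k2')%N ->
     ~~ prefix (w k1' (n k1')) (w k2' (n k2')) /\ ~~ prefix (w k2' (n k2')) (w k1' (n k1')).
    move=> /hn[n1 _ _] /hn[n2 _ _] lt12.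
    have e1 : nth i (w k1' (n k1')) k1' = j 0%N.
      by rewrite nth_cat size_nseq ltnn subnn nth_mkseq.
    have e2 : nth i (w k2' (n k2')) k1' = i by rewrite nth_cat size_nseq lt12 nth_nseq lt12.
    have s1 : (k1' < size (w k1' (n k1')))%N.
      by rewrite size_cat size_nseq size_initial_word -[X in (X < _)%N]addn0 ltn_add2l.
    have s2 : (k1' < size (w k2' (n k2')))%N.
      by rewrite size_cat size_nseq; apply: leq_trans (leq_addr _ _).
    split; apply/negP => /prefixP[t et].
      by move: e2; rewrite et nth_cat s1 e1 => /eqP; rewrite (negbTE j0).
    by move: e1; rewrite et nth_cat s2 e2 => /esym/eqP; rewrite (negbTE j0).
  apply: (@le_trans _ _ (r0 * ratio lam (w k1 (n k1)))).
    by rewrite -mulrA ler_wpM2l ?(ltW r00)//; have [] := hn _ k1N.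
  case: (ltngtP k1 k2) k12 => // lt12 _.
    by have [] := npre _ _ k1N k2N lt12; exact: sep.
  by have [] := npre _ _ k2N k1N lt12 => h1 h2; exact: sep.
Qed.

(** * Homogeneous subsystems *)

Variables (T : seq (seq 'I_m.+1)) (B : nat) (rho : R).
Hypotheses (uT : uniq T) (sT : forall t, t \in T -> size t = B).
Hypotheses (rT : forall t, t \in T -> ratio lam t = rho) (rho01 : 0 < rho < 1).

Lemma ratio_flatten w n : w \in words T n -> ratio lam (flatten w) = rho ^+ n.
Proof.
rewrite mem_words => /andP[/eqP <-]; elim: w => [|t w IH] /=; first by rewrite ratio_nil.
by move=> /andP[tT wT]; rewrite ratio_cat rT// IH// exprS.
Qed.

Lemma shape_words w n : w \in words T n -> shape w = nseq n B.
Proof.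
rewrite mem_words => /andP[/eqP <-]; elim: w => [|t w IH] //= /andP[tT wT].
by rewrite sT// IH.
Qed.

Lemma flatten_words_inj n : {in words T n &, injective (@flatten 'I_m.+1)}.
Proof.
by move=> u v un vn uv; apply: eq_from_flatten_shape => //; rewrite !(shape_words (n := n)).
Qed.

(** In a homogeneous system all words of length [n] have the ratio [rho ^+ n],
    so the images of the separating point under the words in question are
    [rho ^+ n]-separated, up to a factor, in a ball of comparable size. *)
Lemma words_meeting_bounded : exists N : nat, forall n (V : set 'rV[R]_d), V !=set0 ->
  (forall x y, V x -> V y -> enorm (x - y) <= rho ^+ n) ->
  (size [seq w <- words T n | `[< exists2 y, V y & (word_map f (flatten w) @` L) y >]] <= N)%N.
Proof.
have [a [r0 [r00 sep]]] := osc_separation hlam hf hosc.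
have [D D0 hD] := attractor_near a.
have [|N hN] := @packing R d (D + 1) r0 r00; first by rewrite addr_gt0.
exists N => n V [x Vx] dV.
have /andP[rh0 rh1] := rho01.
apply: (hN _ _ (fun w => word_map f (flatten w) a) x (rho ^+ n)).
- by rewrite exprn_gt0.
- by rewrite filter_uniq// uniq_words.
- move=> w; rewrite mem_filter => /andP[/asboolP[y Vy wy] wn].
  apply: le_trans (enorm_triangle y _ _) _; rewrite mulrDl mul1r.
  apply: lerD; last exact: dV.
  by apply: le_trans (hD _ _ wy) _; rewrite (ratio_flatten wn) mulrC.
- move=> w v; rewrite !mem_filter => /andP[_ wn] /andP[_ vn] wv.
  have sw (u : seq (seq 'I_m.+1)) : u \in words T n -> size (flatten u) = (n * B)%N.
    by move=> un; rewrite size_flatten (shape_words un) sumn_nseq mulnC.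
  rewrite -(ratio_flatten wn); apply: sep; apply/negP => /prefixP[t et].
    have := congr1 size et; rewrite size_cat !sw// -[X in X = _]addn0 => /addnI/esym/size0nil t0.
    by move: wv; rewrite -(inj_in_eq (@flatten_words_inj n))// et t0 cats0 eqxx.
  have := congr1 size et; rewrite size_cat !sw// -[X in X = _]addn0 => /addnI/esym/size0nil t0.
  by move: wv; rewrite -(inj_in_eq (@flatten_words_inj n))// et t0 cats0 eqxx.
Qed.

(** The length [n] is the largest one for which [V] is not larger than the
    pieces of length [n].  If [V] is a singleton there is no largest one, and
    for [0 < s] the error [eta] pays for the choice of a large [n]. *)
Lemma scale_of_set (s eta : R) (V : set 'rV[R]_d) : 0 <= s -> 0 < eta -> V !=set0 ->
  (diam V <= 1%:E)%E ->
  exists n, (forall x y, V x -> V y -> enorm (x - y) <= rho ^+ n) /\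
    (((rho `^ s) ^+ n)%:E <= ((rho `^ s)^-1)%:E * hausdorff_term s V + eta%:E)%E.
Proof.
move=> s0 eta0 nV dV; have /andP[rh0 rh1] := rho01.
have rs0 : 0 < rho `^ s by rewrite powR_gt0.
have d0 := diam_ge0 nV.
have [r dr] : exists r, diam V = r%:E.
  by exists (fine (diam V)); rewrite fineK// ge0_fin_numE// (le_lt_trans dV)// ltry.
have r0 : 0 <= r by rewrite -lee_fin -dr.
have r1 : r <= 1 by rewrite -lee_fin -dr.
have Vr x y : V x -> V y -> enorm (x - y) <= r by move=> Vx Vy; rewrite -lee_fin -dr le_diam.
have -> : hausdorff_term s V = (r `^ s)%:E.
  by rewrite /hausdorff_term ifF ?dr//; apply/eqP => V0; move: nV; rewrite V0 => -[].
have [r00|rn0] := eqVneq r 0.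
  have Vn n x y : V x -> V y -> enorm (x - y) <= rho ^+ n.
    by move=> Vx Vy; apply: le_trans (Vr _ _ Vx Vy) _; rewrite r00 exprn_ge0// ltW.
  have [->|sn0] := eqVneq s 0.
    exists 0%N; split; first exact: Vn.
    by rewrite !powRr0 expr0 invr1 mul1e -EFinD lee_fin lerDl ltW.
  have rs1 : rho `^ s < 1.
    rewrite powRexp// -expR0 ltr_expR nmulr_llt0 ?ln_lt0//.
    by rewrite lt_neqAle eq_sym sn0.
  have rs01 : 0 < rho `^ s < 1 by rewrite rs0.
  have /cvgrPdist_lt /(_ eta eta0)[N _ hN] := cvg_geometric0 1 rs01.
  exists N; split; first exact: Vn.
  have := hN N (leqnn N); rewrite sub0r normrN mul1r => /(le_lt_trans (ler_norm _))/ltW h.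
  rewrite -EFinM -EFinD lee_fin; apply: le_trans h _; rewrite lerDr mulr_ge0 ?powR_ge0// invr_ge0 ltW//.
have rp : 0 < r by rewrite lt_neqAle eq_sym rn0.
have ex : exists n, rho ^+ n < r.
  have /cvgrPdist_lt /(_ r rp)[N _ hN] := cvg_geometric0 1 rho01.
  exists N; have := hN N (leqnn N); rewrite sub0r normrN mul1r; exact/le_lt_trans/ler_norm.
case: (ex_minnP ex) => -[|n] hn nmin; first by move: hn; rewrite expr0 ltNge r1.
exists n; split.
  move=> x y Vx Vy; apply: le_trans (Vr _ _ Vx Vy) _.
  by rewrite leNgt; apply/negP => /nmin; rewrite ltnn.
rewrite -EFinM -EFinD lee_fin; apply: ler_wpDr; first exact: ltW.
rewrite mulrC ler_pdivlMr// -exprSr -powR_exprn ?(ltW rh0)//.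
by apply: ge0_ler_powR; rewrite ?nnegrE ?exprn_ge0 ?(ltW rh0)// ltW.
Qed.

(** Replace the sets of a cheap cover of [E] by the words [W n], of length [k n]
    comparable to their diameter, whose pieces meet them.  The total mass of
    these words is less than 1, by the Frostman bound on [mass] and
    [words_meeting_bounded].  Let [H v] be the mass of those that extend [v].  The
    inequality [H v < mass v] holds at the root, and if it holds at [v] it holds
    at some child of [v], since [mass] is at most, and [H] at least, the sum over
    the children.  The branch found in this way leads to a point of [E]; the point
    lies in some set of the cover, so the branch passes through one of the words
    counted in [H], which contradicts [H v < mass v] there. *)
Lemma mass_distribution (mass : seq (seq 'I_m.+1) -> R) (C s : R) (E : set 'rV[R]_d) :
  0 <= s -> mass [::] = 1 -> (forall w, 0 <= mass w) ->
  (forall w, w \in words T (size w) -> mass w <= \sum_(t <- T) mass (rcons w t)) ->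
  (forall w, w \in words T (size w) -> mass w <= C * (rho `^ s) ^+ size w) ->
  (forall x : nat -> seq 'I_m.+1, (forall n, x n \in T) ->
     (forall n, 0 < mass (mkseq x n)) ->
     exists2 y, E y & forall n, (word_map f (flatten (mkseq x n)) @` L) y) ->
  hausdorff_measure s E <> 0%E.
Proof.
move=> s0 m1 m0 msub mle mE HE0.
have /andP[rh0 rh1] := rho01.
have rs0 : 0 < rho `^ s by rewrite powR_gt0.
have C1 : 1 <= C by have := mle [::] isT; rewrite m1 expr0 mulr1.
have [N hN] := words_meeting_bounded.
pose K : R := N%:R * C; have K0 : 0 <= K by rewrite mulr_ge0// (le_trans ler01).
(* With a cover of cost e, and total error e, the mass of the words W is at
   most K * e * ((rho `^ s)^-1 + 1) < 1. *)
pose e := 1 / ((K + 1) * ((rho `^ s)^-1 + 1)).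
have e0 : 0 < e.
  by rewrite divr_gt0// mulr_gt0// ?ltr_wpDl// invr_ge0 ltW.
have [U [EU dU] hU] := hausdorff_measure_eq0_cover HE0 ltr01 e0.
have /choice[k hk] n : exists k, U n !=set0 ->
    (forall x y, U n x -> U n y -> enorm (x - y) <= rho ^+ k) /\
    (((rho `^ s) ^+ k)%:E <= ((rho `^ s)^-1)%:E * hausdorff_term s (U n) + (e / (2 ^ n.+1)%:R)%:E)%E.
  have [nU|] := pselect (U n !=set0); last by exists 0%N.
  have [|j hj] := @scale_of_set s (e / (2 ^ n.+1)%:R) (U n) s0 _ nU (dU n).
    by rewrite divr_gt0// ltr0n expn_gt0.
  by exists j.
pose W n := if U n == set0 then [::] else
  [seq w <- words T (k n) | `[< exists2 y, U n y & (word_map f (flatten w) @` L) y >]].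
have WT n w : w \in W n -> w \in words T (k n).
  by rewrite /W; case: ifP => // _; rewrite mem_filter => /andP[].
pose h n v := \sum_(w <- W n | prefix v w) mass w.
have h0 n v : 0 <= h n v by apply: sumr_ge0.
pose H v := (\big[+%E/0%R]_(0 <= n <oo) (h n v)%:E)%E.
have hnil : (H [::] < 1%:E)%E.
  apply: (@le_lt_trans _ _ (\big[+%E/0%R]_(0 <= n <oo) (K%:E * (((rho `^ s)^-1)%:E * hausdorff_term s (U n) + (e / (2 ^ n.+1)%:R)%:E)))%E).
    apply: lee_nneseries => [n _ _|n _]; first by rewrite lee_fin.
    rewrite /h /W; case: ifPn => [/eqP U0|/set0P nU].
      rewrite big_nil mule_ge0 ?lee_fin// adde_ge0//.
        by rewrite mule_ge0 ?hausdorff_term_ge0// lee_fin invr_ge0 ltW.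
      by rewrite lee_fin divr_ge0// ltW.
    have [kn1 kn2] := hk n nU.
    apply: (@le_trans _ _ (K * (rho `^ s) ^+ k n)%:E); last first.
      by rewrite EFinM; apply: lee_wpmul2l => //; rewrite lee_fin.
    rewrite lee_fin big_filter_cond.
    apply: (@le_trans _ _ (\sum_(w <- [seq w <- words T (k n) | `[< exists2 y, U n y & (word_map f (flatten w) @` L) y >]]) C * (rho `^ s) ^+ k n)).
      rewrite -big_filter_cond /= (eq_bigl predT); last by move=> w; rewrite prefix0s.
      apply: ler_sum_mem => w; rewrite mem_filter => /andP[_ wn] _.
      have sw := size_mem_words wn; have := mle w; rewrite sw; exact.
    rewrite big_const_seq count_predT iter_addr_0 -[X in X <= _]mulr_natl /K -mulrA ler_wpM2r//.
      by rewrite mulr_ge0 ?exprn_ge0 ?powR_ge0// (le_trans ler01).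
    by rewrite ler_nat; apply: hN.
  rewrite nneseriesZl; last first.
    move=> n _; rewrite adde_ge0//.
      by rewrite mule_ge0 ?hausdorff_term_ge0// lee_fin invr_ge0 ltW.
    by rewrite lee_fin divr_ge0// ltW.
  apply: (@le_lt_trans _ _ (K%:E * (((rho `^ s)^-1 * e + e)%:E))%E).
    apply: lee_wpmul2l; first by rewrite lee_fin.
    apply: le_trans (epsilon_trick _ _ (ltW e0)) _.
      by move=> n; rewrite mule_ge0 ?hausdorff_term_ge0// lee_fin invr_ge0 ltW.
    rewrite EFinD; apply: leeD => //.
    rewrite nneseriesZl; last by move=> n _; exact: hausdorff_term_ge0.
    rewrite EFinM; apply: lee_wpmul2l; first by rewrite lee_fin invr_ge0 ltW.
    exact: ltW.
  rewrite -EFinM lte_fin.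
  have -> : (rho `^ s)^-1 * e + e = (K + 1)^-1.
    rewrite -[X in _ + X]mul1r -mulrDl /e; field.
    by rewrite !gt_eqF ?ltr_wpDl ?invr_ge0 ?(ltW rs0)//= ?addr_gt0.
  by rewrite ltr_pdivrMr ?ltr_wpDl// mul1r ltrDl.
pose good v := v \in words T (size v) /\ (H v < (mass v)%:E)%E.
have step v : exists t, good v -> t \in T /\ good (rcons v t).
  have [[vT gv]|] := pselect (good v); last by exists [::].
  apply: contrapT => no.
  have no2 t : t \in T -> ((mass (rcons v t))%:E <= H (rcons v t))%E.
    move=> tT; rewrite leNgt; apply/negP => lt; apply: no; exists t => _; split=> //; split=> //.
    move: vT; rewrite !mem_words size_rcons !eqxx /= all_rcons => ->; by rewrite andbT.
  move: gv; apply/negP; rewrite -leNgt.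
  apply: (@le_trans _ _ (\sum_(t <- T) (mass (rcons v t))%:E)%E).
    by rewrite sumEFin lee_fin msub.
  apply: (@le_trans _ _ (\sum_(t <- T) H (rcons v t))%E).
    rewrite big_seq [leRHS]big_seq; apply: lee_sum => t; exact: no2.
  rewrite -nneseries_sum; last by move=> *; rewrite lee_fin.
  apply: lee_nneseries => [n _ _|n _]; first by apply: sume_ge0 => t _; rewrite lee_fin.
  rewrite sumEFin lee_fin /h (exchange_big_dep (prefix v)) /=; last first.
    by move=> t w _ /prefixP[z ->]; rewrite -cats1 -catA; apply/prefixP; exists ([:: t] ++ z).
  apply: ler_sum => w vw.
  apply: (@le_trans _ _ (\sum_(t <- T | t == nth [::] w (size v)) mass w)).
    apply: ler_sum_pred => // t _ /prefixP[z ->].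
    by rewrite -cats1 -catA nth_cat ltnn subnn.
  have [cT|ncT] := boolP (nth [::] w (size v) \in T); first by rewrite -big_filter filter_pred1_uniq// big_seq1.
  rewrite big_seq_cond big1// => t /andP[tT /eqP tc].
  by move: ncT; rewrite -tc tT.
have [nx hnx] := choice step.
pose v := fix v n := if n is n'.+1 then rcons (v n') (nx (v n')) else [::].
have gv n : good (v n).
  elim: n => [|n IH]; first by split => //; rewrite m1.
  exact: (hnx _ IH).2.
pose x n := nx (v n).
have xv n : mkseq x n = v n.
  by elim: n => // n IH; rewrite mkseqS IH.
have Hh n w : ((h n w)%:E <= H w)%E.
  apply: (@le_trans _ _ (\sum_(0 <= j < n.+1) (h j w)%:E)%E).
    rewrite big_nat_recr//= leeDr// sume_ge0// => j _; by rewrite lee_fin.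
  by apply: nneseries_lim_ge => j _ _; rewrite lee_fin.
have [||y Ey hy] := mE x.
- by move=> n; have [] := hnx _ (gv n).
- move=> n; rewrite xv -lte_fin; apply: le_lt_trans (gv n).2.
  by apply: nneseries_ge0 => j _ _; rewrite lee_fin.
have [n _ Uy] := EU _ Ey.
have [wT wm] := gv (k n); have sw : size (v (k n)) = k n by rewrite -xv size_mkseq.
have wW : v (k n) \in W n.
  rewrite /W ifF; last by apply/eqP => U0; move: Uy; rewrite U0.
  have wT' : v (k n) \in words T (k n) by move: wT; rewrite sw.
  rewrite mem_filter wT' andbT; apply/asboolP; exists y => //.
  by rewrite -xv.
have := lt_le_trans (le_lt_trans (Hh n _) wm) _; move=> /(_ (h n (v (k n)))%:E).
rewrite lee_fin ltxx => F; suff : false by []; apply: F.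
rewrite /h (big_rem _ wW) /= prefix_refl lerDl sumr_ge0//.
Qed.

End OSC.

(** * A random Cantor set *)

Section CantorMass.
Variables (R : realType) (X : eqType) (T : seq X) (I : Type).
Variables (K : I -> nat) (H : I -> seq (seq X)) (sg sg' C : R).
Hypotheses (uT : uniq T) (sg'0 : 0 < sg') (sg'sg : sg' < sg) (C1 : 1 <= C).
Hypothesis HT : forall i h, h \in H i -> h \in words T (K i).

Let Y i w : R := (count (prefix w) (H i))%:R.

(** The hits of stage [i], of length [K i], reach every word [u] of length [k],
    and those below [u] are shared out among the extensions of [u] with
    geometrically decreasing shares. *)
Definition spread k i := forall u, u \in words T k ->
  (0 < count (prefix u) (H i))%N /\
  forall v, u ++ v \in words T (k + size v) -> (k + size v <= K i)%N ->
    Y i (u ++ v) <= C * sg' ^+ size v * Y i u.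

Hypothesis often_spread : forall k N, exists i, [/\ (N <= K i)%N, (k < K i)%N & spread k i].

Let Y_ge0 i w : 0 <= Y i w. Proof. exact: ler0n. Qed.

Let Y_mono i u v : Y i (u ++ v) <= Y i u.
Proof.
rewrite ler_nat; apply: sub_count => h /= /prefixP[t ->].
by rewrite -catA; apply/prefixP; exists (v ++ t).
Qed.

(** A hit longer than [w] that extends [w] extends exactly one child of [w]. *)
Let Y_children i w : w \in words T (size w) -> (size w < K i)%N ->
  Y i w = \sum_(t <- T) Y i (rcons w t).
Proof.
move=> wT wK; rewrite /Y -natr_sum; congr _%:R.
have HTi h : h \in H i -> h \in words T (K i) by apply: HT.
elim: (H i) HTi => [|h s IH] hT /=; first by rewrite big1.
rewrite big_split /= -IH; last by move=> g gs; apply: hT; rewrite inE gs orbT.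
congr (_ + _)%N.
have := hT h (mem_head _ _); rewrite mem_words => /andP[/eqP sh /allP ah].
have [/prefixP[t et]|np] := boolP (prefix w h).
  case: t et sh ah => [|a t] ->; rewrite size_cat => sh ah; first by move: sh wK; rewrite addn0 => ->; rewrite ltnn.
  have aT : a \in T by apply: ah; rewrite mem_cat mem_head orbT.
  have prE b : prefix (rcons w b) (w ++ a :: t) = (b == a).
    rewrite -cats1 prefix_catr// eqxx /= prefix0s andbT; by [].
  rewrite (eq_bigr (fun b => if b == a then 1 else 0)%N); last first.
    by move=> b _; rewrite prE; case: eqP.
  by rewrite -big_mkcond sum1_count (count_uniq_mem a uT) aT.
rewrite big1// => t _; apply/eqP; rewrite eqb0; apply: contra np => /prefixP[v ->].
by rewrite -cats1 -catA; apply/prefixP; exists ([:: t] ++ v).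
Qed.

(** A stage much longer than [k] lets the loss from [sg'] to [sg] absorb the
    constant [C]. *)
Let next_stage : exists nx : nat -> I, forall k,
  [/\ (k <= K (nx k))%N, (k < K (nx k))%N, spread k (nx k) &
    C * sg' ^+ (K (nx k) - k) <= sg ^+ (K (nx k) - k)].
Proof.
have sg0 : 0 < sg by apply: lt_trans sg'sg.
have q01 : 0 < sg' / sg < 1 by rewrite divr_gt0//= ltr_pdivrMr// mul1r.
have [N hN] : exists N, forall n, (N <= n)%N -> C * sg' ^+ n <= sg ^+ n.
  have /cvgrPdist_lt /(_ 1 ltr01)[N _ hN] : (fun n => C * (sg' / sg) ^+ n) @ \oo --> 0.
    by apply: (cvg_geometric C); rewrite ger0_norm; have /andP[/ltW] := q01.
  exists N => n /hN; rewrite sub0r normrN => /(le_lt_trans (ler_norm _)).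
  by rewrite expr_div_n mulrA ltr_pdivrMr ?exprn_gt0// mul1r => /ltW.
have /choice[nx hnx] k := often_spread k (k + N).
exists nx => k; have [h1 h2 h3] := hnx k; split=> //; first exact: ltnW.
by apply: hN; rewrite leq_subRL ?(ltnW h2).
Qed.

(** Let a stage start at length [b].  Within it, the mass of the word reached at
    length [b] is shared out among its extensions in proportion to the hits of
    the stage [nx b] that extend them.  At the length [K (nx b)] of these hits
    the next stage starts.  The words of positive mass at this length are
    hits, so a branch of positive mass meets the hits of infinitely many
    stages.  The Frostman bound follows since within a stage the shares are at
    most [C * sg' ^+ j], and over a full stage at most [sg ^+ j], without
    constant. *)
Lemma cantor_mass : exists mass : seq X -> R,
  [/\ mass [::] = 1, forall w, 0 <= mass w,
      forall w, w \in words T (size w) -> mass w <= \sum_(t <- T) mass (rcons w t),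
      forall w, w \in words T (size w) -> mass w <= C * sg ^+ size w &
      forall x : nat -> X, (forall n, x n \in T) -> (forall n, 0 < mass (mkseq x n)) ->
        forall N, exists i, (N <= K i)%N /\ mkseq x (K i) \in H i].
Proof.
have [nx hnx] := next_stage.
have sg0 : 0 < sg by apply: lt_trans sg'sg.
(* b n is the length at which the stage in force at length n started. *)
pose b := fix b n := if n is n'.+1 then
  (if n'.+1 == K (nx (b n')) then n'.+1 else b n') else 0%N.
have bS n : b n.+1 = if n.+1 == K (nx (b n)) then n.+1 else b n by [].
have bn n : (b n <= n)%N by elim: n => // n IH; rewrite bS; case: ifP => // _; apply: leqW.
have bK n : (n < K (nx (b n)))%N.
  elim: n => [|n IH]; first by have [] := hnx 0%N.
  rewrite bS; case: ifPn => [_|ne]; first by have [] := hnx n.+1.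
  by rewrite ltn_neqAle ne.
pose mass w := \prod_(n < size w) (Y (nx (b n)) (take n.+1 w) / Y (nx (b n)) (take n w)).
have massr w t : mass (rcons w t) = mass w *
    (Y (nx (b (size w))) (rcons w t) / Y (nx (b (size w))) w).
  rewrite /mass size_rcons big_ord_recr /=; congr (_ * _).
    apply: eq_bigr => n _; rewrite -cats1 !takel_cat//; exact: ltnW.
  have -> : take (size w) (rcons w t) = w by rewrite -cats1 take_size_cat.
  by rewrite take_oversize// size_rcons.
have mass0 w : 0 <= mass w by apply: prodr_ge0 => n _; rewrite divr_ge0.
have spr k u : u \in words T k -> Y (nx k) u != 0.
  by move=> uk; have [_ _ /(_ u uk)[h _] _] := hnx k; rewrite pnatr_eq0 -lt0n.
have take_words w n k : w \in words T n -> (k <= n)%N -> take k w \in words T k.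
  rewrite !mem_words => /andP[/eqP <- aw] kn; rewrite size_takel// eqxx /=.
  by apply/allP => y /mem_take; move/allP: aw; exact.
have wr w n : w \in words T n.+1 -> exists2 w', w' \in words T n & exists2 t, t \in T & w = rcons w' t.
  case/lastP: w => [|w t]; rewrite mem_words// size_rcons all_rcons => /and3P[sw tT aw].
  by exists w; [rewrite mem_words aw andbT|exists t].
have A2 w n : w \in words T n -> mass w = mass (take (b n) w) *
    (Y (nx (b n)) w / Y (nx (b n)) (take (b n) w)) -> forall t,
    mass (rcons w t) = mass (take (b n) w) *
    (Y (nx (b n)) (rcons w t) / Y (nx (b n)) (take (b n) w)).
  move=> wn e t; rewrite massr (size_mem_words wn) e.
  have [Y0|Yn0] := eqVneq (Y (nx (b n)) w) 0; last by field; rewrite Yn0 spr// (take_words _ n).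
  have -> : Y (nx (b n)) (rcons w t) = 0.
    by apply/eqP; rewrite eq_le Y_ge0 andbT -Y0 -cats1 Y_mono.
  by rewrite Y0 !mul0r !mulr0.
(* Within a stage the product of shares telescopes. *)
have A1 n : forall w, w \in words T n -> mass w = mass (take (b n) w) *
    (Y (nx (b n)) w / Y (nx (b n)) (take (b n) w)).
  elim: n => [|n IH] w wn.
    have w0 : w = [::] by move: wn => /size_mem_words/size0nil.
    have Yw := spr 0%N w wn; rewrite w0 in Yw *.
    by rewrite (_ : take (b 0%N) [::] = [::])// divff ?mulr1.
  have [w' w'n [t tT wE]] := wr _ _ wn.
  have := A2 _ _ w'n (IH _ w'n) t; rewrite -wE bS; case: ifPn => [_ _|_ ->].
    by rewrite take_oversize ?(size_mem_words wn)// divff ?mulr1// spr.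
  by rewrite wE -cats1 takel_cat// (size_mem_words w'n).
have A n w (wn : w \in words T n) : mass w = mass (take (b n) w) *
    (Y (nx (b n)) w / Y (nx (b n)) (take (b n) w)) /\ forall t, t \in T ->
    mass (rcons w t) = mass (take (b n) w) *
    (Y (nx (b n)) (rcons w t) / Y (nx (b n)) (take (b n) w)).
  by split=> [|t _]; [exact: A1|apply: A2 => //; exact: A1].
have spr2 k u v : u \in words T k -> u ++ v \in words T (k + size v) -> (k + size v <= K (nx k))%N ->
    Y (nx k) (u ++ v) / Y (nx k) u <= C * sg' ^+ size v.
  move=> uk uv kv; have [_ _ /(_ u uk)[_ /(_ v uv kv) h] _] := hnx k.
  by rewrite ler_pdivrMr// lt_neqAle eq_sym spr//=.
have C0 : 0 <= C by apply: le_trans C1.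
(* At the start of a stage the Frostman bound holds without constant. *)
have Bd n : forall w, w \in words T (b n) -> mass w <= sg ^+ b n.
  elim: n => [|n IH] w; first by move=> /size_mem_words/size0nil ->; rewrite /mass big_ord0 expr0.
  rewrite bS; case: ifPn => [/eqP nK wn|_]; last exact: IH.
  have [w' w'n [t tT wE]] := wr _ _ wn.
  have [_ /(_ t tT)] := A n _ w'n; rewrite -wE => ->.
  have tk : take (b n) w' \in words T (b n) by apply: take_words w'n _.
  have tw : take (b n) w' = take (b n) w.
    by rewrite wE -cats1 takel_cat// (size_mem_words w'n).
  have wtk : w = take (b n) w' ++ drop (b n) w by rewrite tw cat_take_drop.
  have sd : size (drop (b n) w) = (n.+1 - b n)%N by rewrite size_drop (size_mem_words wn).
  have bn1 : (b n <= n.+1)%N by apply: leqW.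
  apply: (@le_trans _ _ (sg ^+ b n * (C * sg' ^+ (n.+1 - b n)))).
    apply: ler_pM => //; [by rewrite divr_ge0|exact: IH|].
    by rewrite -sd [X in Y _ X]wtk; apply: spr2; rewrite ?sd ?subnKC// -?wtk// -nK.
  have [_ _ _ h] := hnx (b n); rewrite -nK in h.
  apply: le_trans (ler_wpM2l _ h) _; first by rewrite exprn_ge0// ltW.
  by rewrite -exprD subnKC.
exists mass; split => //.
- by rewrite /mass big_ord0.
- move=> w wT; set n := size w.
  have [Y0|Yn0] := eqVneq (Y (nx (b n)) w) 0.
    have [-> _] := A n _ wT; rewrite Y0 mul0r mulr0; apply: sumr_ge0 => t _; exact: mass0.
  under eq_bigr do rewrite massr.
  by rewrite -mulr_sumr -mulr_suml -Y_children// divff// mulr1.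
- move=> w wT; set n := size w; have [-> _] := A n _ wT.
  have tk : take (b n) w \in words T (b n) by apply: take_words wT _.
  have sd : size (drop (b n) w) = (n - b n)%N by rewrite size_drop.
  apply: (@le_trans _ _ (sg ^+ b n * (C * sg' ^+ (n - b n)))).
    apply: ler_pM => //; [by rewrite divr_ge0|exact: Bd|].
    rewrite -sd -{1}[w](cat_take_drop (b n)); apply: spr2; rewrite ?sd ?subnKC ?cat_take_drop//.
    exact: ltnW.
  rewrite mulrCA ler_wpM2l// -[in leRHS](subnKC (bn n)) exprD.
  by rewrite ler_wpM2l ?exprn_ge0 ?(ltW sg0)// lerXn2r ?nnegrE ?(ltW sg0) ?(ltW sg'0)// ltW.
- move=> x xT x0 N.
  have bK2 j : (N <= j)%N -> (j < K (nx (b N)))%N -> b j = b N.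
    elim: j => [|j IH]; first by rewrite leqn0 => /eqP ->.
    rewrite leq_eqVlt => /orP[/eqP <- //|]; rewrite ltnS => Nj jK.
    have bj := IH Nj (ltnW jK); rewrite bS bj ifF//.
    by apply/eqP => e; rewrite e ltnn in jK.
  set i := nx (b N) in bK2 *.
  have NK : (N < K i)%N by apply: bK.
  exists i; split; first exact: ltnW.
  have [k kE] : exists k, K i = k.+1 by exists (K i).-1; rewrite prednK// (leq_trans _ NK).
  have kT : mkseq x k \in words T k.
    by rewrite mem_words size_mkseq eqxx; apply/allP => _ /mapP[j _ ->]; exact: xT.
  have bk : b k = b N by apply: bK2; rewrite ?kE// -ltnS -kE.
  have [_ /(_ (x k) (xT k))] := A k _ kT; rewrite -mkseqS bk -/i => e.
  have : Y i (mkseq x k.+1) != 0.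
    by apply/negP => /eqP Y0; have := x0 k.+1; rewrite e Y0 mul0r mulr0 ltxx.
  rewrite pnatr_eq0 -lt0n -has_count => /hasP[h hH /prefixP[t et]].
  have := HT hH => /size_mem_words; rewrite et size_cat size_mkseq kE -[X in _ = X]addn0.
  by move=> /addnI/size0nil t0; move: hH; rewrite et t0 cats0.
Qed.

End CantorMass.

(** * Random words are well spread *)

Section Hits.
Variables (Om : Type) (X : eqType) (Z : Om -> nat -> X) (T : seq X).

(** The trials of index 1 to [M], with only the ones over the alphabet [T] kept. *)
Definition hits K M (o : Om) : seq (seq X) :=
  [seq h <- behead (mkseq (blocks Z K o) M.+1) | h \in words T K].

Lemma count_hits K M o w : count (prefix w) (hits K M o) =
  count (fun h => prefix w h && (h \in words T K)) (behead (mkseq (blocks Z K o) M.+1)).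
Proof. by rewrite /hits count_filter. Qed.

Lemma mem_hits K M o h : h \in hits K M o ->
  h \in words T K /\ exists2 i, (1 <= i <= M)%N & h = blocks Z K o i.
Proof.
rewrite mem_filter /mkseq /= => /andP[hT /mapP[i]].
by rewrite mem_iota add1n ltnS => iM hE; split => //; exists i.
Qed.

End Hits.

Section RandomHits.
Context d (Om : measurableType d) (R : realType) (P : probability Om R).

Lemma measure_exists_mem (I : eqType) (s : seq I) (E : I -> set Om) :
  (forall i, measurable (E i)) ->
  measurable [set o | exists2 i, i \in s & E i o] /\
  (P [set o | exists2 i, i \in s & E i o] <= \sum_(i <- s) P (E i))%E.
Proof.
move=> mE; elim: s => [|i s [mIH IH]].
  rewrite big_nil (_ : [set _ | _] = set0) ?measure0; first by split.
  by apply/seteqP; split => // o [].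
have -> : [set o | exists2 j, j \in i :: s & E j o] = E i `|` [set o | exists2 j, j \in s & E j o].
  apply/seteqP; split => o /=.
    by move=> [j]; rewrite inE => /orP[/eqP -> ?|? ?]; [left|right; exists j].
  by move=> [?|[j js ?]]; [exists i; rewrite ?mem_head|exists j; rewrite // inE js orbT].
split; first exact: measurableU.
rewrite big_cons; apply: (@le_trans _ _ (P (E i) + P [set o | exists2 j, j \in s & E j o])%E).
  exact: measureU2.
by rewrite leeD2l.
Qed.

Variables (X : eqType) (Z : Om -> nat -> X) (A : seq X) (p : X -> R).
Hypotheses (iZ : iid P Z A p) (p0 : forall a, 0 <= p a) (p1 : \sum_(a <- A) p a = 1).
Hypothesis uA : uniq A.
Variables (T : seq X) (pw : R).
Hypotheses (uT : uniq T) (TA : {subset T <= A}) (pT : forall t, t \in T -> p t = pw).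
Hypothesis pw0 : 0 < pw.

Let pB (w : seq X) := \prod_(a <- w) p a.

Let iB K : iid P (blocks Z K) (words A K) pB. Proof. exact: iid_blocks. Qed.

Let pB0 w : 0 <= pB w. Proof. exact: prodr_ge0. Qed.

Let pB1 K : \sum_(w <- words A K) pB w = 1.
Proof. by rewrite sum_words_prod p1 expr1n. Qed.

(** There are [size T ^ (K - size w)] words of length [K] over [T] that extend
    [w], and each of them has the probability [pw ^+ K]. *)
Lemma prob_prefix K w : w \in words T (size w) -> (size w <= K)%N ->
  \sum_(h <- words A K | prefix w h && (h \in words T K)) pB h =
  (size T)%:R ^+ (K - size w) * pw ^+ K.
Proof.
move=> wT wK; rewrite -big_filter.
have pe : perm_eq [seq h <- words A K | prefix w h && (h \in words T K)]
    [seq w ++ v | v <- words T (K - size w)].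
  apply: uniq_perm.
  - by rewrite filter_uniq// uniq_words.
  - by rewrite map_inj_in_uniq ?uniq_words// => u v _ _ /eqP; rewrite eqseq_cat// eqxx /= => /eqP.
  move=> h; rewrite mem_filter; apply/idP/mapP.
    case/andP=> /andP[/prefixP[v ->] wv _]; exists v => //.
    move: wv; rewrite !mem_words size_cat all_cat => /andP[/eqP <- /andP[_ ->]].
    by rewrite addKn eqxx.
  case=> v vT ->; rewrite prefix_prefix /=.
  have wvT : w ++ v \in words T K.
    move: wT vT; rewrite !mem_words size_cat all_cat => /andP[_ ->] /andP[/eqP -> ->].
    by rewrite subnKC// eqxx.
  rewrite wvT; move: wvT; rewrite !mem_words => /andP[-> /allP h1] /=.
  by apply/allP => y /h1 /TA.
rewrite (perm_big _ pe) big_map big_seq.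
rewrite (eq_bigr (fun=> pw ^+ K)); last first.
  move=> v vT; have : w ++ v \in words T K.
    move: wT vT; rewrite !mem_words size_cat all_cat => /andP[_ ->] /andP[/eqP -> ->].
    by rewrite subnKC// eqxx.
  rewrite mem_words => /andP[/eqP <-]; rewrite /pB.
  elim: (w ++ v) => [|a u IH] /=; first by rewrite big_nil expr0.
  by move=> /andP[aT uT']; rewrite big_cons IH// pT// exprS.
by rewrite -big_seq big_const_seq count_predT iter_addr_0 size_words -natrX mulr_natl.
Qed.

Variables (beta sg' : R).
Hypotheses (sg'0 : 0 < sg') (sg'1 : sg' < 1).
Hypothesis growth1 : 1 < (size T)%:R * sg'.
Hypothesis growth2 : 1 < (size T)%:R * sg' * pw * beta.

Let a : R := (size T)%:R.

Let a1 : 1 < a.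
Proof.
rewrite ltNge; apply/negP => h.
have := ler_wpM2r (ltW sg'0) h; rewrite mul1r; move: growth1 sg'1; rewrite -/a; lra.
Qed.

(** The number of hits below [u] has the mean [y], and below [u ++ v] the mean
    [y / a ^+ size v].  The lower tail keeps the first count above [y / 2].  Once
    [(a * sg') ^+ size v >= 6], the mean of the second is so far below
    [sg' ^+ size v * y] that the upper tail applies; the shorter [v] are absorbed
    by the constant [C].  All the numbers [sg' ^+ j * y] are at least [z], which
    grows exponentially in [K] by [growth2], so that the failure
    probabilities [expR (- z / 18)] outweigh the number of words. *)
Lemma random_hits_spread : exists2 C : R, 1 <= C & forall k (e : R), 0 < e ->
  exists K0, forall K M, (K0 <= K)%N -> beta ^+ K <= M%:R ->
    (k < K)%N /\ exists2 Bad, measurable Bad & (P Bad <= e%:E)%E /\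
      forall o, ~ Bad o -> spread T (fun i => i.1) (fun i => hits Z T i.1 i.2 o) sg' C k (K, M).
Proof.
have a0 : 0 < a by apply: lt_trans a1.
have s0 : 0 < a * sg' by rewrite mulr_gt0.
have [j0 hj0] : exists j0, forall j, (j0 <= j)%N -> 6 <= (a * sg') ^+ j.
  have [|j0 hj0] := @expR_dominates R 0 (ln (a * sg')) 6; first by rewrite ln_gt0.
  exists j0 => j /hj0; rewrite expr0 mulr1 expRM_natr lnK ?posrE//.
pose C := Num.max 2 (sg' ^- j0).
exists C => [|k e e0]; first by rewrite le_max; apply/orP; left; lra.
pose kap := a * sg' * pw * beta.
have kap0 : 0 < kap by apply: lt_trans growth2.
have la0 : 0 < ln a by rewrite ln_gt0.
pose c := (a * sg') ^- k / 18.
have c0 : 0 < c by rewrite divr_gt0// invr_gt0 exprn_gt0.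
have [|K1 hK1] := @expR_dominates R 2 (ln kap) ((2 + ln a) / c); first by rewrite ln_gt0.
exists (maxn K1 (maxn k.+1 (Num.truncn e^-1).+1)) => K M; rewrite !geq_max => /and3P[KK1 kK Ke] hM.
split=> //.
pose y : R := M%:R * (a ^+ (K - k) * pw ^+ K).
pose z : R := sg' ^+ (K - k) * y.
have y0 : 0 <= y by rewrite mulr_ge0// mulr_ge0 ?exprn_ge0// ltW.
have zy j : (j <= K - k)%N -> z <= sg' ^+ j * y.
  by move=> jK; rewrite ler_wpM2r// ler_wiXn2l// ltW.
have zc : c * 18 * kap ^+ K <= z.
  have -> : z = (a * sg') ^- k * ((a * sg' * pw) ^+ K * M%:R).
    rewrite /z /y !exprMn.
    have -> : a ^+ K = a ^+ k * a ^+ (K - k) by rewrite -exprD subnKC// ltnW.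
    have -> : sg' ^+ K = sg' ^+ k * sg' ^+ (K - k) by rewrite -exprD subnKC// ltnW.
    by field; rewrite !gt_eqF// exprn_gt0.
  rewrite /c divfK// ler_wpM2l ?invr_ge0 ?exprn_ge0 ?(ltW s0)//.
  by rewrite /kap exprMn ler_wpM2l// exprn_ge0// !mulr_ge0 ?(ltW a0) ?(ltW sg'0) ?(ltW pw0).
have kexp : (2 + ln a) * K.+1%:R ^+ 2 <= z / 18.
  have := hK1 K KK1; rewrite expRM_natr lnK ?posrE// => h.
  have : c * ((2 + ln a) / c * K.+1%:R ^+ 2) <= c * kap ^+ K by rewrite ler_wpM2l// ltW.
  rewrite [X in X <= _ -> _](_ : _ = (2 + ln a) * K.+1%:R ^+ 2); last by field; rewrite gt_eqF.
  move: zc; lra.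
pose S w h := prefix w h && (h \in words T K).
pose N w o := count (S w) (behead (mkseq (blocks Z K o) M.+1)).
pose E (w : seq X) := if size w == k then [set o | ((N w o)%:R <= y / 2)%R]
   else [set o | (sg' ^+ (size w - k) * y <= (N w o)%:R)%R].
have mE w : measurable (E w).
  rewrite /E; case: ifP => _.
    exact: (@iid_measurable _ _ _ _ _ _ _ _ M.+1 (fun W => (count (S w) (behead W))%:R <= y / 2)%R (iB K)).
  exact: (@iid_measurable _ _ _ _ _ _ _ _ M.+1 (fun W => sg' ^+ (size w - k) * y <= (count (S w) (behead W))%:R)%R (iB K)).
(* The words u of length k, and their extensions by j letters for the j that
   are long enough for the upper tail. *)
pose s := words T k ++ flatten [seq words T (k + j) | j <- [seq j <- iota 0 (K - k).+1 | (0 < j)%N && (j0 <= j)%N]].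
have PE w : w \in s -> (P (E w) <= (expR (- (z / 18)))%:E)%E.
  rewrite mem_cat => /orP[wk|/flattenP[t /mapP[j]]].
    have sw := size_mem_words wk; rewrite /E sw eqxx.
    apply: le_trans (iid_lower_tail (S := S w) (iB K) pB0 (pB1 K) _) _.
      by rewrite prob_prefix ?sw// ltnW.
    rewrite lee_fin ler_expR lerN2 ler_wpM2r//.
    by have := zy 0%N (leq0n _); rewrite expr0 mul1r.
  rewrite mem_filter mem_iota add0n ltnS => /andP[/andP[j1 jj0] jK] -> wT.
  have sw := size_mem_words wT; rewrite /E sw.
  have -> : (k + j == k)%N = false by rewrite -[X in (_ == X)%N]addn0 eqn_add2l eqn0Ngt j1.
  rewrite addKn.
  have kjK : (k + j <= K)%N by rewrite -leq_subRL ?(ltnW kK).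
  apply: le_trans (iid_upper_tail (S := S w) (iB K) pB0 (pB1 K) _) _.
    rewrite prob_prefix ?sw//.
    have -> : a ^+ (K - (k + j)) = a ^+ (K - k) / a ^+ j.
      by rewrite subnDA -exprB// ?unitfE ?gt_eqF.
    have -> : M%:R * (a ^+ (K - k) / a ^+ j * pw ^+ K) = y / a ^+ j by rewrite /y; field; rewrite gt_eqF ?exprn_gt0.
    rewrite ler_pdivrMr ?exprn_gt0//.
    have -> : sg' ^+ j * y / 6 * a ^+ j = y * ((a * sg') ^+ j / 6) by rewrite exprMn; field.
    by rewrite ler_peMr// ler_pdivlMr// mul1r hj0.
  rewrite lee_fin ler_expR lerN2; have := zy j jK.
  have z0 : 0 <= z by rewrite mulr_ge0// exprn_ge0// ltW.
  lra.
have ss : (size s)%:R <= K.+1%:R * a ^+ K.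
  have t0 : (0 < size T)%N by rewrite -(ltr_nat R).
  rewrite /a -natrX -natrM ler_nat /s size_cat size_words size_flatten /shape -map_comp.
  set J := [seq _ <- iota _ _ | _].
  have sJ : (size J <= K - k)%N.
    by rewrite /J /=; rewrite size_filter; apply: leq_trans (count_size _ _) _; rewrite size_iota.
  apply: (@leq_trans (size T ^ K + size J * size T ^ K)); last first.
    rewrite -mulSn leq_mul2r; apply/orP; right; rewrite ltnS.
    by apply: leq_trans sJ (leq_subr _ _).
  apply: leq_add; first by rewrite leq_pexp2l// ltnW.
  have : all (fun j => (j <= K - k)%N) J.
    by apply/allP => j; rewrite mem_filter mem_iota add0n ltnS => /andP[_].
  elim: J {sJ} => //= j J IH /andP[jK aJ]; rewrite mulSn leq_add ?IH//=.
  by rewrite size_words leq_pexp2l// -leq_subRL ?(ltnW kK).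
exists [set o | exists2 w, w \in s & E w o]; first exact: (measure_exists_mem s mE).1.
split.
  apply: le_trans (measure_exists_mem s mE).2 _.
  apply: (@le_trans _ _ (\sum_(w <- s) (expR (- (z / 18)))%:E)%E).
    by rewrite big_seq [leRHS]big_seq; apply: lee_sum => w; exact: PE.
  rewrite sumEFin lee_fin big_const_seq count_predT iter_addr_0 -[X in X <= _]mulr_natl.
  apply: (@le_trans _ _ (K.+1%:R * a ^+ K * expR (- (z / 18)))).
    by rewrite ler_wpM2r// expR_ge0.
  have aK : a ^+ K <= expR (K.+1%:R * ln a).
    rewrite -[a in leLHS]lnK ?posrE// -expRM_natl ler_expR ler_wpM2r ?(ltW la0)// ler_nat //.
  have KK : K.+1%:R <= expR (K.+1%:R) :> R.
    by apply: le_trans (expR_ge1Dx _); rewrite lerDr.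
  apply: (@le_trans _ _ (expR (K.+1%:R) * expR (K.+1%:R * ln a) * expR (- (z / 18)))).
    rewrite ler_wpM2r ?expR_ge0//; apply: ler_pM => //; by rewrite exprn_ge0// ltW.
  rewrite -!expRD; apply: (@le_trans _ _ (expR (- K.+1%:R))).
    rewrite ler_expR.
    have Kge1 : 1 <= K.+1%:R :> R by rewrite ler1n.
    have : K.+1%:R * (2 + ln a) <= z / 18.
      apply: le_trans kexp; rewrite mulrC ler_wpM2l ?addr_ge0 ?(ltW la0)//.
      by rewrite expr2 ler_peMr.
    rewrite mulrDr; lra.
  rewrite expRN -[e]invrK lef_pV2 ?posrE ?invr_gt0 ?expR_gt0//.
  apply: le_trans KK; apply: ltW; apply: lt_le_trans (truncnS_gt _) _.
  by rewrite ler_nat leqW.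
move=> o /= nB u uk.
have yY : y / 2 < (count (prefix u) (hits Z T K M o))%:R.
  rewrite ltNge; apply/negP => h; apply: nB; exists u; first by rewrite mem_cat uk.
  by rewrite /E /= (size_mem_words uk) eqxx /= /N -count_hits.
split.
  by rewrite -(ltr_nat R); apply: le_lt_trans yY; rewrite divr_ge0.
move=> v uv /= kv; set Yu := (count (prefix u) _)%:R in yY *.
have Yu0 : 0 <= Yu by [].
have Ym : (count (prefix (u ++ v)) (hits Z T K M o))%:R <= Yu.
  rewrite ler_nat; apply: sub_count => h /= /prefixP[t ->].
  by rewrite -catA; apply/prefixP; exists (v ++ t).
have [jv|jv] := leqP j0 (size v); last first.
  apply: le_trans Ym _; rewrite ler_peMl//.
  apply: (@le_trans _ _ (sg' ^- j0 * sg' ^+ size v)).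
    rewrite mulrC ler_pdivlMr ?exprn_gt0// mul1r ler_wiXn2l// ?(ltW sg'0) ?(ltW sg'1)//; exact: ltnW.
  by rewrite ler_wpM2r ?exprn_ge0 ?(ltW sg'0)// /C le_max lexx orbT.
have [v0|vn0] := posnP (size v).
  by rewrite (size0nil v0) cats0 expr0 mulr1 ler_peMl// /C le_max; apply/orP; left; lra.
have : (count (prefix (u ++ v)) (hits Z T K M o))%:R < sg' ^+ size v * y.
  rewrite ltNge; apply/negP => h; apply: nB; exists (u ++ v).
    rewrite mem_cat; apply/orP; right; apply/flattenP; exists (words T (k + size v)) => //.
    apply/mapP; exists (size v) => //; rewrite mem_filter vn0 jv mem_iota add0n ltnS /=.
    by rewrite leq_subRL ?(ltnW kK).
  rewrite /E /= size_cat (size_mem_words uk) addKn ifF /= ?/N -?count_hits//.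
  by rewrite -[X in (_ == X)%N]addn0 eqn_add2l eqn0Ngt vn0.
move=> /ltW h; apply: le_trans h _.
apply: (@le_trans _ _ (sg' ^+ size v * (2 * Yu))).
  by rewrite ler_wpM2l ?exprn_ge0 ?(ltW sg'0)//; lra.
rewrite mulrCA -mulrA; apply: ler_wpM2r; first by rewrite mulr_ge0 ?exprn_ge0 ?(ltW sg'0).
by rewrite /C le_max lexx.
Qed.

End RandomHits.

(** * Symbolic description of the covering set *)

Lemma initial_word_take m (o : symbol_space m) j k : (j <= k)%N ->
  take j (initial_word o k) = initial_word o j.
Proof. by move=> /subnKC <-; rewrite initial_wordD take_size_cat// size_initial_word. Qed.

Lemma covering_setP (R : realType) d m (f : 'I_m.+1 -> 'rV[R]_d -> 'rV[R]_d)
    (o : symbol_space m) (l : nat -> nat) (y : 'rV[R]_d) :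
  covering_set f o l y <-> exists2 c : symbol_space m, coding f c = y &
    forall N, exists2 n, (N <= n)%N & initial_word c (l n) = initial_word (left_shift n o) (l n).
Proof.
split=> [[c hc <-]|[c <- hc]]; exists c => //.
  move=> N; have [|n /= Nn] := hc N.+1; first by [].
  by rewrite /cylinder /= size_initial_word; exists n => //; exact: ltnW.
move=> N /= _; have [n Nn cn] := hc N; exists n => //=.
by rewrite /cylinder /= size_initial_word.
Qed.

Lemma letters_iid (R : realType) m (p : 'I_m.+1 -> R)
    (P : probability (g_sigma_algebraType (@cylinders m)) R) : bernoulli_measure p P ->
  iid P (fun o : symbol_space m => o) (enum 'I_m.+1) p.
Proof.
move=> hP; apply: iid_of_cylinders => w; split; last exact: hP.
by apply: sub_sigma_algebra; exists w.
Qed.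

Lemma prodr_powR (R : realType) (T : Type) (F : T -> R) (s : R) (w : seq T) :
  (forall i, 0 < F i) -> (\prod_(i <- w) F i) `^ s = \prod_(i <- w) F i `^ s.
Proof.
move=> F0; elim: w => [|i w IH]; first by rewrite !big_nil powR1.
by rewrite !big_cons powRM ?IH ?(ltW (F0 i))// prodr_ge0// => j _; exact: ltW.
Qed.

Section Blocks.
Variables (m : nat) (B : nat).
Implicit Types (o c : symbol_space m).

(** A sequence of blocks of the same length is a sequence of letters. *)
Lemma flatten_mkseq_words (x : nat -> seq 'I_m.+1) : (0 < B)%N -> (forall n, size (x n) = B) ->
  exists c : symbol_space m, forall n, initial_word c (n * B) = flatten (mkseq x n).
Proof.
move=> B0 sx; pose c (n : nat) := nth ord0 (x (n %/ B)%N) (n %% B)%N; exists c.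
elim=> [|n IH]; first by rewrite mul0n.
rewrite mkseqS -cats1 flatten_cat /= cats0 -IH mulSn addnC initial_wordD; congr (_ ++ _).
apply: (@eq_from_nth _ ord0); rewrite ?size_initial_word// => r rB.
rewrite nth_mkseq// /left_shift /c divnMDl// modnMDl.
by rewrite divn_small// addn0 modn_small.
Qed.

Definition letter_blocks o := blocks (fun o : symbol_space m => o) B o.

Lemma flatten_letter_blocks o K i :
  flatten (blocks letter_blocks K o i) = initial_word (left_shift (i * (K * B)) o) (K * B).
Proof.
transitivity (flatten (mkseq (letter_blocks (left_shift (i * (K * B)) o)) K)); last exact: flatten_blocks.
congr flatten; apply: eq_mkseq => r; apply: eq_mkseq => r'.
by rewrite /left_shift; congr (o _); rewrite mulnDl addnA mulnA.
Qed.

End Blocks.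

(** * The lower bound *)

Section LowerBound.
Variables (R : realType) (d m : nat).
Variables (f : 'I_m.+1 -> 'rV[R]_d -> 'rV[R]_d) (lam : 'I_m.+1 -> R).
Hypothesis hlam : forall i, 0 < lam i < 1.
Hypothesis hf : forall i, similarity (f i) (lam i).
Hypothesis hosc : open_set_condition f.
Variable L : set 'rV[R]_d.
Hypothesis hL : attractor f L.

(** Ratios are products, so rearranging letters does not change them. *)
Lemma perm_class_ratio (w0 : seq 'I_m.+1) : (0 < size w0)%N ->
  let T := [seq w <- words (enum 'I_m.+1) (size w0) | perm_eq w0 w] in
  [/\ uniq T, forall t, t \in T -> size t = size w0,
      forall t, t \in T -> ratio lam t = ratio lam w0 & 0 < ratio lam w0 < 1].
Proof.
move=> sw0 T; split.
- by rewrite filter_uniq// uniq_words// enum_uniq.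
- by move=> t; rewrite mem_filter => /andP[_ /size_mem_words].
- by move=> t; rewrite mem_filter => /andP[pt _]; apply/esym/prod_const_perm.
- rewrite ratio_gt0//=; have [q /andP[q0 q1] hq] := ratio_geometric hlam.
  by apply: le_lt_trans (hq _) _; rewrite exprn_ilt1 ?(ltW q0)// -lt0n.
Qed.

(** In a homogeneous subsystem of [N] words with [1 < N * rho `^ t], uniform mass
    satisfies the Frostman bound. *)
Lemma attractor_measure_neq0 (t s : R) : 1 < \sum_i lam i `^ t -> 0 <= s <= t ->
  hausdorff_measure s L <> 0%E.
Proof.
move=> ht /andP[s0 st]; have lam0 i : 0 < lam i by have /andP[] := hlam i.
have [|||w0 [sw0 hw0]] := @balanced_type R m (fun i => lam i `^ t) (fun=> 1).
- by move=> i; rewrite powR_gt0.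
- by move=> _; exact: ltr01.
- by move=> q _; under eq_bigr do rewrite powR1 mulr1.
have [uT sT rT r01] := perm_class_ratio sw0.
set T := [seq _ <- _ | _] in hw0 uT sT rT; set N := size T in hw0.
have /andP[r0 r1] := r01.
have {}hw0 : 1 < N%:R * ratio lam w0 `^ t.
  apply: lt_le_trans hw0 _; rewrite -prodr_powR// ler_wpM2l// ler_piMr ?powR_ge0//.
  by rewrite ge_min lexx.
have N0 : (0 : R) < N%:R.
  by rewrite ltNge; apply/negP => h; move: hw0; apply/negP; rewrite -leNgt (le_trans _ ler01)// mulr_le0_ge0// powR_ge0.
apply: (mass_distribution hlam hf hosc hL uT sT rT r01 (mass := fun w => N%:R ^- size w) (C := 1)) => //.
- by rewrite expr0 invr1.
- move=> w _; under eq_bigr do rewrite size_rcons.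
  rewrite big_const_seq count_predT iter_addr_0 -/N -[leRHS]mulr_natl exprS.
  by rewrite le_eqVlt; apply/orP; left; apply/eqP; field; rewrite !gt_eqF ?exprn_gt0.
- move=> w _; rewrite mul1r -exprVn; apply: lerXn2r; rewrite ?nnegrE ?invr_ge0 ?powR_ge0// ?(ltW N0)//.
  apply: (@le_trans _ _ (ratio lam w0 `^ t)).
    by rewrite -[leLHS]mul1r ler_pdivrMr// mulrC ltW.
  by apply: ger_powR => //; rewrite r0 ltW.
- move=> x xT _; have [c hc] := flatten_mkseq_words sw0 (fun n => sT _ (xT n)).
  exists (coding f c); first exact: (coding_in_attractor hlam hf hL).
  by move=> n; rewrite -hc; exact: (coding_in_word hlam hf hL).
Qed.

Variables (alpha : R) (l : nat -> nat) (p : 'I_m.+1 -> R).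
Hypothesis halpha : 0 < alpha.
Hypothesis hl : {homo l : n n' / (n <= n')%N}.
Hypothesis hliminf : limn_einf (fun n : nat => ((l n)%:R / ln (n%:R : R))%:E) = (1 / alpha)%:E.
Hypotheses (hp : forall i, 0 < p i) (hp1 : \sum_(i < m.+1) p i = 1).
Variable P : probability (g_sigma_algebraType (@cylinders m)) R.
Hypothesis hP : bernoulli_measure p P.

(** Nowhere among the trials are more letters asked for than the length
    [KM.1 * B] of a trial. *)
Definition admissible B (KM : nat * nat) := (0 < KM.1)%N /\
  forall n, (n <= KM.2 * (KM.1 * B))%N -> (l n <= KM.1 * B)%N.

(** A trial that agrees with [c] in [K * B] letters agrees with it in the at most
    [K * B] letters asked for at its place; as the index of the trial is
    positive, this place is not before [K]. *)
Lemma covered_of_hits B (c o : symbol_space m) : (0 < B)%N ->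
  (forall N, exists K M i, [/\ admissible B (K, M), (N <= K)%N, (1 <= i <= M)%N &
     initial_word c (K * B) = initial_word (left_shift (i * (K * B)) o) (K * B)]) ->
  covering_set f o l (coding f c).
Proof.
move=> B0 h; apply/covering_setP; exists c => // N.
have [K [M [i [[/= K0 adm] NK /andP[i1 iM] e]]]] := h N.
exists (i * (K * B))%N.
  apply: leq_trans NK _; apply: leq_trans (leq_pmulr K B0) _.
  exact: leq_pmull.
have lK : (l (i * (K * B)) <= K * B)%N by apply: adm; rewrite leq_mul2r iM orbT.
by rewrite -(initial_word_take c lK) e initial_word_take.
Qed.

(** The homogeneous subsystem [T] comes from [balanced_type], for an exponent
    [t'] above [t]; the gap between [t'] and [t] is the one that [cantor_mass]
    needs.  One null set is excluded for each length [k] at which a stage may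
    start, and all [s <= t] are treated at once because the Frostman bound for
    [t] implies the one for [s]. *)
Lemma covering_set_measure_neq0 (t : R) : 0 <= t < dim_formula lam p alpha ->
  {ae P, forall o : symbol_space m, forall s, 0 <= s <= t ->
    hausdorff_measure s (covering_set f o l) <> 0%E}.
Proof.
move=> /andP[t0 tD]; have lam0 i : 0 < lam i by have /andP[] := hlam i.
pose t' := (t + dim_formula lam p alpha) / 2.
have tt' : t < t' by rewrite /t'; lra.
have t'D : t' < dim_formula lam p alpha by rewrite /t'; lra.
have [|||w0 [sw0 hw0]] := @balanced_type R m (fun i => lam i `^ t') (fun i => p i * expR alpha).
- by move=> i; rewrite powR_gt0.
- by move=> i; rewrite mulr_gt0 ?expR_gt0.
- by move=> q hq; exact: lt_dim_formula.
have [uT sT rT r01] := perm_class_ratio sw0.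
set T := [seq _ <- _ | _] in hw0 uT sT rT; set N := size T in hw0.
have /andP[r0 r1] := r01.
set B := size w0 in sw0 sT *; set rho := ratio lam w0 in rT r01 r0 r1.
pose pw := \prod_(i <- w0) p i.
have pw0 : 0 < pw by apply: prodr_gt0.
have xE : \prod_(i <- w0) (p i * expR alpha) = pw * expR (alpha * B%:R).
  by rewrite big_split /=; congr (_ * _); rewrite big_const_seq count_predT iter_mulr_1 expRM_natr.
rewrite xE -prodr_powR// -/(ratio lam w0) -/rho in hw0.
set sg' := rho `^ t' in hw0; pose sg := rho `^ t.
have sg'0 : 0 < sg' by rewrite powR_gt0.
have sg'sg : sg' < sg by apply: powR_decr.
have sg1 : sg <= 1.
  by rewrite -(powRr0 rho); apply: ger_powR => //; rewrite r0 ltW.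
have sg'1 : sg' < 1 by apply: lt_le_trans sg1.
have growth1 : 1 < N%:R * sg'.
  apply: lt_le_trans hw0 _; rewrite ler_wpM2l// ler_piMr ?(ltW sg'0)//.
  by rewrite ge_min lexx.
pose G := N%:R * sg' * pw * expR (alpha * B%:R).
have G1 : 1 < G.
  apply: lt_le_trans hw0 _; rewrite /G -!mulrA ler_wpM2l// ler_wpM2l ?(ltW sg'0)//.
  by rewrite ge_min lexx orbT.
have B0 : (0 : R) < B%:R by rewrite ltr0n.
have lG : 0 < ln G by rewrite ln_gt0.
(* Close enough to alpha to lose at most half of ln G, and still positive. *)
pose a := Num.max (alpha / 2) (alpha - ln G / (2 * B%:R)).
have a0 : 0 < a by rewrite lt_max divr_gt0.
have aalpha : a < alpha.
  rewrite /a gt_max; apply/andP; split; first by move: halpha; lra.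
  by rewrite gtrBl divr_gt0// mulr_gt0.
pose beta := expR (a * B%:R).
have growth2 : 1 < N%:R * sg' * pw * beta.
  have -> : N%:R * sg' * pw * beta = G * expR ((a - alpha) * B%:R).
    by rewrite /G /beta -[RHS]mulrA -expRD; congr (_ * expR _); ring.
  rewrite -[G]lnK ?posrE ?(lt_trans ltr01)// -expRD -[X in X < _]expR0 ltr_expR.
  have : alpha - ln G / (2 * B%:R) <= a by rewrite le_max lexx orbT.
  rewrite lerBlDr -lerBlDl => h; have := ler_wpM2r (ltW B0) h.
  have -> : ln G / (2 * B%:R) * B%:R = ln G / 2 by field; rewrite gt_eqF.
  have -> : (a - alpha) * B%:R = - ((alpha - a) * B%:R) by ring.
  lra.
have iL := letters_iid hP.
have p1 : \sum_(i <- enum 'I_m.+1) p i = 1 by rewrite big_enum.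
have pB0 (w : seq 'I_m.+1) : 0 <= \prod_(i <- w) p i by apply: prodr_ge0 => i _; exact: ltW.
have pB1 : \sum_(w <- words (enum 'I_m.+1) B) \prod_(i <- w) p i = 1.
  by rewrite sum_words_prod p1 expr1n.
have TA : {subset T <= words (enum 'I_m.+1) B} by move=> w; rewrite mem_filter => /andP[].
have pT w : w \in T -> \prod_(i <- w) p i = pw.
  by rewrite mem_filter => /andP[pt _]; apply/esym/prod_const_perm.
have uA : uniq (words (enum 'I_m.+1) B) by rewrite uniq_words// enum_uniq.
have [C C1 hC] := random_hits_spread (iid_blocks B iL) pB0 pB1 uA uT TA pT pw0 sg'0 sg'1 growth1 growth2.
pose Z := @letter_blocks m B.
have good k : {ae P, forall o : symbol_space m, forall K0, exists KM : nat * nat, [/\ (K0 <= KM.1)%N,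
    admissible B KM, (k < KM.1)%N &
    spread T fst (fun i => hits Z T i.1 i.2 o) sg' C k KM]}.
  pose I := {x : (nat * nat) * set (g_sigma_algebraType (@cylinders m)) | [/\ measurable x.2, admissible B x.1, (k < x.1.1)%N &
     forall o, ~ x.2 o -> spread T fst (fun i => hits Z T i.1 i.2 o) sg' C k x.1]}.
  have := @ae_frequently _ _ _ P I (fun i => (sval i).1.1) (fun i => (sval i).2).
  move=> H; apply: filterS (H _ _) => [ o ho K0|i|K0 e e0].
  - by have [[[[K M] Bad] /= [_ adm kK sp]] /= [K0K nB]] := ho K0; exists (K, M); split => //; apply: sp.
  - by case: (svalP i).
  - have [K1 hK1] := hC k e e0.
    have [||K [M [KK K0' hM adm]]] := @many_trials R alpha l halpha hl hliminf a B (maxn K0 K1).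
    + by rewrite a0.
    + by rewrite -(ltr_nat R).
    move: KK; rewrite geq_max => /andP[K0K K1K].
    have [|kK [Bad mB [PB sp]]] := hK1 K M K1K.
      by apply: le_trans hM; rewrite natrM /beta -expRM_natl mulrCA.
    have Q : [/\ measurable (K, M, Bad).2, admissible B (K, M, Bad).1, (k < (K, M, Bad).1.1)%N &
     forall o, ~ (K, M, Bad).2 o -> spread T fst (fun i => hits Z T i.1 i.2 o) sg' C k (K, M, Bad).1].
      by split.
    by exists (exist _ (K, M, Bad) Q).
apply: filterS (ae_foralln good) => o ho s /andP[s0 st].
pose I := {KM : nat * nat | admissible B KM}.
have [||mass [m1 m0 msub mle msup]] := @cantor_mass R _ T I (fun i => (sval i).1)
   (fun i => hits Z T (sval i).1 (sval i).2 o) sg sg' C uT sg'0 sg'sg C1.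
- by move=> i h hh; have [] := mem_hits hh.
- move=> k K0; have [KM [h1 h2 h3 h4]] := ho k K0.
  by exists (exist _ KM h2); split.
apply: (mass_distribution hlam hf hosc hL uT sT rT r01 s0 m1 m0 msub (C := C)).
  move=> w wT; apply: le_trans (mle w wT) _; rewrite ler_wpM2l ?(le_trans ler01)//.
  rewrite lerXn2r ?nnegrE ?powR_ge0//; apply: ger_powR => //; by rewrite r0 ltW.
move=> x xT x0; have [c hc] := flatten_mkseq_words sw0 (fun n => sT _ (xT n)).
exists (coding f c); last by move=> n; rewrite -hc; exact: (coding_in_word hlam hf hL).
apply: (covered_of_hits sw0) => K0.
have [[[K M] adm] /= [K0K xH]] := msup x xT x0 K0.
have [_ [i iM hE]] := mem_hits xH.
exists K, M, i; split => //.
by rewrite hc hE flatten_letter_blocks.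
Qed.

End LowerBound.

(** * The dimension of the attractor *)

Section Moran.
Variables (R : realType) (d m : nat).
Variables (f : 'I_m.+1 -> 'rV[R]_d -> 'rV[R]_d) (lam : 'I_m.+1 -> R).
Hypothesis hlam : forall i, 0 < lam i < 1.
Hypothesis hf : forall i, similarity (f i) (lam i).
Variable L : set 'rV[R]_d.
Hypothesis hL : attractor f L.

Lemma ratio_powR s w : ratio lam w `^ s = \prod_(i <- w) lam i `^ s.
Proof. by apply: prodr_powR => i; have /andP[] := hlam i. Qed.

Lemma exists_geometric_lt (C q e : R) : 0 <= q < 1 -> 0 < e ->
  exists N, forall n, (N <= n)%N -> C * q ^+ n < e.
Proof.
move=> /andP[q0 q1] e0.
have /cvgrPdist_lt /(_ e e0)[N _ hN] : (fun n => C * q ^+ n) @ \oo --> 0.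
  by apply: (cvg_geometric C); rewrite ger0_norm.
exists N => n /hN; rewrite sub0r normrN; apply: le_lt_trans; exact: ler_norm.
Qed.

(** The pieces of all words of length [K] have the sum
    [(\sum_i lam i `^ s) ^+ K]. *)
Lemma attractor_measure_eq0 (s : R) : 0 <= s -> \sum_i lam i `^ s < 1 ->
  hausdorff_measure s L = 0%E.
Proof.
move=> s0 hs; apply: (word_cover_null hlam hf hL s0) => e L0 e0.
have S0 : 0 <= \sum_i lam i `^ s by apply: sumr_ge0 => i _; rewrite powR_ge0.
have [|N hN] := @exists_geometric_lt 1 (\sum_i lam i `^ s) e _ e0; first by rewrite S0.
pose K := maxn N L0.
exists (fun J => if J == 0%N then words (enum 'I_m.+1) K else [::]); split.
- move=> x Lx; have [c <-] : exists c, coding f c = x.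
    by move: Lx; rewrite (attractor_coding hlam hf hL) => -[c _ <-]; exists c.
  exists 0%N, (initial_word c K); split; last exact: (coding_in_word hlam hf hL).
  by rewrite mem_words_enum size_initial_word.
- by move=> [|J] w //=; rewrite mem_words_enum => /eqP ->; exact: leq_maxr.
- move=> n; apply: (@le_trans _ _ ((\sum_i lam i `^ s) ^+ K)).
    case: n => [|n]; first by rewrite big_ord0 exprn_ge0.
    rewrite big_ord_recl /= [X in _ + X]big1 ?addr0; last first.
      by move=> i _; rewrite big_nil.
    under eq_bigr do rewrite ratio_powR.
    by rewrite sum_words_prod big_enum.
  by have := hN K (leq_maxl _ _); rewrite mul1r => /ltW.
Qed.

Hypothesis hosc : open_set_condition f.

Lemma moran s0 : hausdorff_dim L = s0%:E -> 0 <= s0 /\ \sum_i lam i `^ s0 = 1.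
Proof.
move=> hs0; have [t ht] := @powsum_root R m lam hlam (fun=> 1) (fun=> ltr01).
have htE s : \sum_i lam i `^ s * 1 = \sum_i lam i `^ s by apply: eq_bigr => i _; rewrite mulr1.
have decr s s' : s < s' -> \sum_i lam i `^ s' < \sum_i lam i `^ s.
  by move=> ss'; have := @powsum_decr R m lam hlam (fun=> 1) s s' (fun=> ltr01) ss'; rewrite !htE.
rewrite htE in ht.
have t0 : 0 <= t.
  rewrite leNgt; apply/negP => /decr; rewrite ht; apply/negP; rewrite -leNgt.
  under eq_bigr do rewrite powRr0.
  by rewrite sumr_const card_ord ler1n.
suff : hausdorff_dim L = t%:E by rewrite hs0 => -[->].
apply/eqP; rewrite eq_le; apply/andP; split.
  apply: hausdorff_dim_le => // s ts; apply: attractor_measure_eq0.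
    by rewrite (le_trans t0)// ltW.
  by rewrite -ht decr.
apply: hausdorff_dim_ge => s /andP[s0' st].
apply: (attractor_measure_neq0 hlam hf hosc hL (t := s)); last by rewrite s0' lexx.
by rewrite -ht decr.
Qed.

End Moran.

(** * The upper bound *)

Section WordProb.
Variables (R : realType) (X : eqType) (A : seq X) (p : X -> R).
Hypotheses (p0 : forall a, 0 <= p a) (p1 : \sum_(a <- A) p a = 1).

Definition word_prob n (Q : pred (seq X)) := \sum_(v <- words A n | Q v) \prod_(a <- v) p a.

Let pr0 (v : seq X) : 0 <= \prod_(a <- v) p a. Proof. exact: prodr_ge0. Qed.

Lemma word_prob_le1 n Q : word_prob n Q <= 1.
Proof.
rewrite -(expr1n R n) -p1 -sum_words_prod /word_prob.
by apply: ler_sum_pred => // v _ _; exact: pr0.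
Qed.

(** The word stands between two free parts, which have total weight 1. *)
Lemma word_prob_position n L N w : w \in words A L -> uniq A -> (n + L <= N)%N ->
  word_prob N (fun v => take L (drop n v) == w) = \prod_(a <- w) p a.
Proof.
move=> wA uA nLN; rewrite /word_prob -(subnKC nLN) -addnA big_mkcond sum_words_cat /=.
have -> : \sum_(u <- words A n) \sum_(v <- words A (L + (N - (n + L))))
    (if take L (drop n (u ++ v)) == w then \prod_(a <- u ++ v) p a else 0) =
    \sum_(u <- words A n) \prod_(a <- u) p a * \prod_(a <- w) p a.
  apply: eq_big_seq => u /size_mem_words un.
  rewrite sum_words_cat.
  transitivity (\sum_(v <- words A L | v == w) \prod_(a <- u) p a * \prod_(a <- w) p a).
    rewrite [RHS]big_mkcond; apply: eq_big_seq => v /size_mem_words vL.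
    rewrite (eq_bigr (fun r => if v == w then \prod_(a <- u) p a * \prod_(a <- w) p a * \prod_(a <- r) p a else 0)).
      case: ifP => _; last by rewrite big1.
      by rewrite -mulr_sumr sum_words_prod p1 expr1n mulr1.
    move=> r _; rewrite drop_size_cat// take_size_cat//.
    by case: eqP => // ->; rewrite !big_cat /= mulrA.
  rewrite -[LHS]big_filter (_ : [seq v <- words A L | v == w] = [:: w]) ?big_seq1//.
  by apply: filter_pred1_uniq => //; exact: uniq_words.
by rewrite -mulr_suml sum_words_prod p1 expr1n mul1r.
Qed.

(** The union bound over the places in [s]. *)
Lemma word_prob_position_has L N (s : seq nat) (g : pred nat) w : w \in words A L -> uniq A ->
  (forall n, n \in s -> (n + L <= N)%N) ->
  word_prob N (fun v => has (fun n => g n && (take L (drop n v) == w)) s) <=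
  (size s)%:R * \prod_(a <- w) p a.
Proof.
move=> wA uA; elim: s => [|n s IH] sN /=; first by rewrite /word_prob big_pred0_eq mul0r.
apply: (@le_trans _ _ (word_prob N (fun v => take L (drop n v) == w) +
   word_prob N (fun v => has (fun n => g n && (take L (drop n v) == w)) s))).
  rewrite /word_prob big_mkcond [X in _ <= X + _]big_mkcond [X in _ <= _ + X]big_mkcond -big_split /=.
  apply: ler_sum => v _; case: (g n) => /=; case: (_ == _) => /=; case: has => //=; rewrite ?addr0 ?add0r ?lexx ?addr_ge0//; by rewrite lerDl.
rewrite -natr1 mulrDl mul1r addrC lerD//.
  by apply: IH => j js; apply: sN; rewrite inE js orbT.
by rewrite word_prob_position// sN// mem_head.
Qed.

End WordProb.

Section Markov.
Context dd (Om : measurableType dd) (R : realType) (P : probability Om R).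
Variables (X : eqType) (Z : Om -> nat -> X) (A : seq X) (p : X -> R).
Hypotheses (iZ : iid P Z A p) (p0 : forall a, 0 <= p a).

(** The Markov inequality for a weighted number of events. *)
Lemma iid_markov (I : Type) (s : seq I) (c : I -> R) (Q : I -> pred (seq X)) n (z : R) :
  (forall i, 0 <= c i) -> 0 < z ->
  (P [set o | (z <= \sum_(i <- s | Q i (mkseq (Z o) n)) c i)%R] <=
    ((\sum_(i <- s) c i * word_prob A p n (Q i)) / z)%:E)%E.
Proof.
move=> c0 z0.
rewrite (iidP n (fun v => z <= \sum_(i <- s | Q i v) c i) iZ) lee_fin.
have -> : \sum_(i <- s) c i * word_prob A p n (Q i) =
    \sum_(v <- words A n) \prod_(a <- v) p a * \sum_(i <- s | Q i v) c i.
  transitivity (\sum_(i <- s) \sum_(v <- words A n) (if Q i v then \prod_(a <- v) p a * c i else 0)).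
    apply: eq_bigr => i _; rewrite /word_prob big_mkcond mulr_sumr; apply: eq_bigr => v _.
    by case: ifP; rewrite ?mulr0// mulrC.
  rewrite exchange_big; apply: eq_bigr => v _; rewrite mulr_sumr [RHS]big_mkcond.
  by apply: eq_bigr => i _.
have pr0 (v : seq X) : 0 <= \prod_(a <- v) p a by apply: prodr_ge0.
rewrite mulr_suml big_mkcond; apply: ler_sum => v _; case: ifPn => [h|_].
  by rewrite -mulrA ler_peMr// ler_pdivlMr// mul1r.
by rewrite divr_ge0 ?(ltW z0)// mulr_ge0// sumr_ge0.
Qed.

End Markov.

Section Upper.
Variables (R : realType) (d m : nat).
Variables (f : 'I_m.+1 -> 'rV[R]_d -> 'rV[R]_d) (lam : 'I_m.+1 -> R).
Hypothesis hlam : forall i, 0 < lam i < 1.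
Hypothesis hf : forall i, similarity (f i) (lam i).
Variable L : set 'rV[R]_d.
Hypothesis hL : attractor f L.
Variables (alpha : R) (l : nat -> nat) (p : 'I_m.+1 -> R).
Hypothesis halpha : 0 < alpha.
Hypothesis hliminf : limn_einf (fun n : nat => ((l n)%:R / ln (n%:R : R))%:E) = (1 / alpha)%:E.
Hypotheses (hp : forall i, 0 < p i) (hp1 : \sum_(i < m.+1) p i = 1).
Variable P : probability (g_sigma_algebraType (@cylinders m)) R.
Hypothesis hP : bernoulli_measure p P.

Let A := enum 'I_m.+1.
Let p1 : \sum_(i <- A) p i = 1. Proof. by rewrite big_enum. Qed.
Let p0 i : 0 <= p i. Proof. exact: ltW. Qed.

(** The word [w] of length [K] stands in [v] at a place before [N] where exactly
    [K] letters are asked for. *)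
Definition occurs (N K : nat) (w v : seq 'I_m.+1) :=
  has (fun n => (l n == K) && (take K (drop n v) == w)) (iota 0 N).

Lemma occurs_of_covered N K (c o : symbol_space m) n : l n = K -> (n < N)%N ->
  initial_word c K = initial_word (left_shift n o) K ->
  occurs N K (initial_word c K) (initial_word o (N + K)).
Proof.
move=> lK nN e; apply/hasP; exists n; first by rewrite mem_iota.
rewrite lK eqxx /= e; apply/eqP.
have -> : (N + K = n + (K + (N - n)))%N by rewrite addnCA subnKC ?(ltnW nN)// addnC.
by rewrite initial_wordD drop_size_cat ?size_initial_word// initial_word_take// leq_addr.
Qed.

(** There are at most [N K], hence about [expR (a * K)], places at which [K]
    letters are asked for; the union bound runs over them. *)
Lemma few_occurrences (a : R) : alpha < a -> exists2 C : R, 1 <= C &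
  exists N : nat -> nat, [/\ forall n, (n < N (l n))%N,
    forall K, (N K)%:R <= C * expR (a * K%:R) &
    forall K w, w \in words A K ->
      word_prob A p (N K + K) (occurs (N K) K w) <=
      Num.min 1 (C * expR (a * K%:R) * \prod_(i <- w) p i)].
Proof.
move=> aa; have [C [C0 hC]] := lengths_ge halpha hliminf aa.
have a0 : 0 < a by apply: lt_trans aa.
exists (C + 1); first by rewrite lerDr.
pose N K := (Num.truncn (C * expR (a * K%:R))).+1; exists N.
have N2 K : (N K)%:R <= (C + 1) * expR (a * K%:R).
  rewrite /N -natr1 mulrDl mul1r lerD//.
    by rewrite truncn_le mulr_ge0// expR_ge0.
  by rewrite -[X in X <= _]expR0 ler_expR mulr_ge0// ltW.
split => //.
  move=> n; rewrite -(ltr_nat R); apply: le_lt_trans (hC n) _; exact: truncnS_gt.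
move=> K w wK; rewrite le_min; apply/andP; split; first exact: word_prob_le1.
apply: (@le_trans _ _ ((size (iota 0 (N K)))%:R * \prod_(i <- w) p i)).
  apply: (word_prob_position_has p0 p1 (fun n => l n == K) wK (enum_uniq _)).
  by move=> n; rewrite mem_iota add0n /= => nN; rewrite leq_add2r ltnW.
by rewrite size_iota ler_wpM2r// prodr_ge0.
Qed.

(** Some [q] makes [phi < 1]; enlarging [alpha] to [a] multiplies [phi] by at
    most [expR dl], and [dl] is half the distance of [ln phi] from 0, so the
    ratio [th] of the geometric bound stays below 1.  Between [th] and 1 there
    is room for a rate [eta] such that the sums at length [K] exceed [eta ^+ K]
    with geometrically small probability. *)
Lemma covering_set_measure_eq0 (s : R) : dim_formula lam p alpha < s ->
  {ae P, forall o : symbol_space m, hausdorff_measure s (covering_set f o l) = 0%E}.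
Proof.
move=> Ds; have s0 : 0 <= s.
  by apply: le_trans (ltW Ds); exact: dim_formula_ge0.
have [q /andP[q0 q1] hq] := dim_formula_lt hlam hp Ds.
set phi := \sum_i _ in hq.
have lam0 i : 0 < lam i by have /andP[] := hlam i.
have phi0 : 0 < phi.
  rewrite /phi (bigD1 ord0)//= ltr_pwDl//.
    by rewrite mulr_gt0 ?powR_gt0 ?mulr_gt0 ?expR_gt0.
  by apply: sumr_ge0 => i _; rewrite mulr_ge0 ?powR_ge0.
have lnphi : ln phi < 0 by rewrite ln_lt0// phi0.
pose dl := - ln phi / 2; have dl0 : 0 < dl by rewrite divr_gt0// oppr_gt0.
pose a := alpha + dl.
pose th := \sum_i lam i `^ s * (p i * expR a) `^ q.
have th0 : 0 <= th by apply: sumr_ge0 => i _; rewrite mulr_ge0 ?powR_ge0.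
have th1 : th < 1.
  have -> : th = phi * expR (dl * q).
    rewrite /th /phi mulr_suml; apply: eq_bigr => i _.
    have -> : p i * expR a = p i * expR alpha * expR dl by rewrite /a expRD mulrA.
    rewrite powRM ?expR_ge0//; last by rewrite mulr_ge0 ?expR_ge0.
    by rewrite -expRM mulrA.
  rewrite -[phi]lnK ?posrE// -expRD -[X in _ < X]expR0 ltr_expR.
  have : dl * q <= dl by rewrite ler_piMr// ltW.
  have : dl = - ln phi / 2 by [].
  lra.
have [|C C1 [N [N1 N2 N3]]] := @few_occurrences a; first by rewrite ltrDl.
pose eta := (th + 1) / 2.
have eta0 : 0 < eta by rewrite /eta; lra.
have eta1 : eta < 1 by rewrite /eta; lra.
have the : th < eta by rewrite /eta; lra.
have iL := letters_iid hP.
pose Bad K := [set o : g_sigma_algebraType (@cylinders m) | (eta ^+ K <= \sum_(w <- words A K | occurs (N K) K w (mkseq o (N K + K)))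
    ratio lam w `^ s)%R].
have := @ae_eventually _ _ _ P Bad C (th / eta).
move=> H; apply: filterS (H _ _ _) => [ o [K0 hK0]|K||K].
- apply: (word_cover_null hlam hf hL s0) => e L0 e0.
  have [|N' hN'] := @exists_geometric_lt R (1 / (1 - eta)) eta e _ e0.
    by rewrite (ltW eta0).
  pose K1 := maxn N' (maxn K0 L0).
  exists (fun J => [seq w <- words A (K1 + J) | occurs (N (K1 + J)%N) (K1 + J) w (mkseq o (N (K1 + J)%N + (K1 + J)))]); split.
  + move=> x /covering_setP[c <- hc].
    have [n0 hn0] := lengths_unbounded halpha hliminf K1.
    have [n nn0 e1] := hc n0; have lK := hn0 n nn0.
    exists (l n - K1)%N, (initial_word c (l n)); split; last exact: (coding_in_word hlam hf hL).
    rewrite subnKC// mem_filter mem_words_enum size_initial_word eqxx andbT.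
    exact: occurs_of_covered.
  + move=> J w; rewrite mem_filter mem_words_enum => /andP[_ /eqP ->].
    by apply: leq_trans (leq_addr _ _); rewrite !leq_max leqnn !orbT.
  + move=> n; apply: (@le_trans _ _ (\sum_(J < n) eta ^+ (K1 + J))).
      apply: ler_sum => J _; rewrite big_filter.
      rewrite leNgt; apply/negP => /ltW h.
      apply: (hK0 (K1 + J)%N) h; apply: leq_trans (leq_addr _ _).
      by rewrite !leq_max leqnn !orbT.
    have -> : \sum_(J < n) eta ^+ (K1 + J) = eta ^+ K1 * ((1 - eta ^+ n) / (1 - eta)).
      under eq_bigr do rewrite exprD.
      rewrite -mulr_sumr; congr (_ * _).
      have := subrX1 eta n; have e1 : eta - 1 != 0 by rewrite subr_eq0 lt_eqF.
      have e2 : 1 - eta != 0 by rewrite subr_eq0 gt_eqF.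
      move=> h; apply: (mulfI e2); rewrite mulrCA divff// mulr1.
      by rewrite -[1 - eta]opprB mulNr -h opprB.
    apply: le_trans (ltW (hN' K1 (leq_maxl _ _))).
    rewrite mulrC ler_wpM2r ?exprn_ge0 ?(ltW eta0)// ler_wpM2r ?invr_ge0 ?subr_ge0 ?(ltW eta1)//.
    by rewrite gerBl exprn_ge0// ltW.
- exact: (iid_measurable (N K + K) (fun v => eta ^+ K <= \sum_(w <- words A K | occurs (N K) K w v) ratio lam w `^ s) iL).
- by rewrite divr_ge0 ?(ltW eta0)//= ltr_pdivrMr// mul1r.
- apply: le_trans (iid_markov iL p0 (words A K) (fun w => occurs (N K) K w) (N K + K) _ _) _.
  + by move=> w; exact: powR_ge0.
  + by rewrite exprn_gt0.
  have -> : C * (th / eta) ^+ K = C * th ^+ K / eta ^+ K by rewrite expr_div_n mulrA.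
  rewrite lee_fin ler_wpM2r ?invr_ge0 ?exprn_ge0 ?(ltW eta0)//.
  have -> : C * th ^+ K = \sum_(w <- words A K) ratio lam w `^ s * (C * (expR (a * K%:R) * \prod_(i <- w) p i) `^ q).
    rewrite /th -[\sum_i _](big_enum _ _ xpredT) -sum_words_prod mulr_sumr.
    apply: eq_big_seq => w /size_mem_words wK.
    rewrite big_split /= -ratio_powR// mulrCA; congr (_ * (_ * _)).
    rewrite -prodr_powR; last by move=> i; rewrite mulr_gt0 ?expR_gt0.
    rewrite big_split /= mulrC; congr ((_ * _) `^ _).
    by rewrite big_const_seq count_predT iter_mulr_1 wK expRM_natr.
  apply: ler_sum_mem => w wK _; rewrite ler_wpM2l ?powR_ge0//.
  apply: le_trans (N3 K w wK) _; rewrite -mulrA.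
  set y := expR (a * K%:R) * \prod_(i <- w) p i.
  have y0 : 0 < y by rewrite mulr_gt0 ?expR_gt0 ?prodr_gt0.
  have C0 : 0 < C by apply: lt_le_trans C1.
  apply: (@le_trans _ _ ((C * y) `^ q)).
    have [h|h] := leP 1 (C * y).
      apply: (@le_trans _ _ (1 `^ q)); first by rewrite powR1.
      by apply: ge0_ler_powR; rewrite ?nnegrE ?ler01 ?(le_trans ler01 h).
    by apply: ger1_powR => //; rewrite (ltW h) mulr_gt0.
  rewrite powRM ?(ltW C0) ?(ltW y0)// ler_wpM2r ?powR_ge0//.
  by rewrite -[X in _ <= X]powRr1 ?(ltW C0)//; apply: ler_powR.
Qed.

End Upper.

(** * Full measure and the whole attractor *)

Lemma pmin_attained (R : realType) m (p : 'I_m.+1 -> R) :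
  exists2 i, p i = pmin p & forall j, pmin p <= p j.
Proof.
have le j : pmin p <= p j by apply: bigmin_le.
case: (@Order.TotalTheory.arg_minP _ _ _ (ord0 : 'I_m.+1) xpredT p isT) => i _ hi.
exists i => //; apply/eqP; rewrite eq_le le andbT.
by apply: le_bigmin => [|j _]; exact: hi.
Qed.

Section Large.
Variables (R : realType) (d m : nat).
Variables (f : 'I_m.+1 -> 'rV[R]_d -> 'rV[R]_d) (lam : 'I_m.+1 -> R).
Hypothesis hlam : forall i, 0 < lam i < 1.
Hypothesis hf : forall i, similarity (f i) (lam i).
Hypothesis hosc : open_set_condition f.
Variable L : set 'rV[R]_d.
Hypothesis hL : attractor f L.
Variables (alpha : R) (l : nat -> nat) (p : 'I_m.+1 -> R).
Hypothesis halpha : 0 < alpha.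
Hypothesis hl : {homo l : n n' / (n <= n')%N}.
Hypothesis hliminf : limn_einf (fun n : nat => ((l n)%:R / ln (n%:R : R))%:E) = (1 / alpha)%:E.
Hypotheses (hp : forall i, 0 < p i) (hp1 : \sum_(i < m.+1) p i = 1).
Variable P : probability (g_sigma_algebraType (@cylinders m)) R.
Hypothesis hP : bernoulli_measure p P.

Let A := enum 'I_m.+1.
Let p1 : \sum_(i <- A) p i = 1. Proof. by rewrite big_enum. Qed.
Let p0 i : 0 <= p i. Proof. exact: ltW. Qed.
Let pB (w : seq 'I_m.+1) := \prod_(i <- w) p i.
Let pB0 w : 0 <= pB w. Proof. exact: prodr_ge0. Qed.
Let pB1 K : \sum_(w <- words A K) pB w = 1.
Proof. by rewrite sum_words_prod p1 expr1n. Qed.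
Let iB K := iid_blocks K (letters_iid hP).

Let ple1 i : p i <= 1.
Proof. by rewrite -hp1 (bigD1 i)//= lerDl sumr_ge0. Qed.

(** The first block of [W] is ignored, as the trial at place 0 is not counted. *)
Definition missing (w : seq 'I_m.+1) (W : seq (seq 'I_m.+1)) := ~~ has (pred1 w) (behead W).

Lemma missingPn K M (o : symbol_space m) w :
  ~~ missing w (mkseq (letter_blocks K o) M.+1) ->
  exists2 i, (1 <= i <= M)%N & w = initial_word (left_shift (i * K) o) K.
Proof.
rewrite negbK /mkseq /= => /hasP[_ /mapP[i iM ->] /eqP <-].
by exists i => //; move: iM; rewrite mem_iota add1n ltnS.
Qed.

Lemma covered_of_not_missing (c o : symbol_space m) :
  (forall N, exists K M, [/\ admissible l 1 (K, M), (N <= K)%N &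
     ~~ missing (initial_word c K) (mkseq (letter_blocks K o) M.+1)]) ->
  covering_set f o l (coding f c).
Proof.
move=> h; apply: (@covered_of_hits _ _ _ _ _ 1) => // N.
have [K [M [adm NK /missingPn[i iM e]]]] := h N.
by exists K, M, i; split => //; rewrite !muln1.
Qed.

Lemma prob_missing K M w : w \in words A K ->
  word_prob (words A K) pB M.+1 (missing w) <= expR (- (M%:R * pB w)).
Proof.
move=> wK; rewrite -lee_fin -(iidP _ _ (iB K)).
have := iid_prob_miss (pred1 w) M (iB K) pB0 (pB1 K).
rewrite (_ : \sum_(a <- words A K | pred1 w a) _ = pB w)//.
rewrite -[LHS]big_filter (_ : [seq v <- words A K | pred1 w v] = [:: w]) ?big_seq1//.
by apply: filter_pred1_uniq => //; rewrite uniq_words// enum_uniq.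
Qed.

(** A doubly exponentially small probability outweighs the number of words. *)
Let rare (a kap : R) : 0 < kap -> 1 <= a -> forall e : R, 0 < e -> exists K0, forall K, (K0 <= K)%N ->
  a ^+ K * expR (- expR (kap * K%:R)) <= e.
Proof.
move=> kap0 a1 e e0; have a0 : 0 < a by apply: lt_le_trans a1.
have la0 : 0 <= ln a by rewrite ln_ge0.
have [N hN] := @expR_dominates R 1 kap (2 + ln a) kap0.
exists (maxn N (Num.truncn e^-1).+1) => K; rewrite geq_max => /andP[/hN h Ke].
rewrite expr1 in h.
have -> : a ^+ K = expR (ln a * K%:R) by rewrite expRM_natr lnK ?posrE.
rewrite -expRD; apply: (@le_trans _ _ (expR (- K.+1%:R))).
  rewrite ler_expR.
  have h1 : ln a * K%:R <= ln a * K.+1%:R by rewrite ler_wpM2l// ler_nat.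
  have h2 : 0 <= K.+1%:R :> R by [].
  rewrite mulrDl in h; lra.
rewrite expRN -[e]invrK lef_pV2 ?posrE ?invr_gt0 ?expR_gt0//.
apply: (@le_trans _ _ (1 + K.+1%:R)); last exact: expR_ge1Dx.
apply: ler_wpDl => //; apply: ltW; apply: lt_le_trans (truncnS_gt _) _.
by rewrite ler_nat leqW.
Qed.

(** A union bound over all words of length [K]: each of them is missing with
    probability at most [expR (- expR (kap * K))], where
    [kap = a + ln (pmin p) > 0] for some [a < alpha]. *)
Lemma covering_set_full : - ln (pmin p) < alpha ->
  {ae P, forall o : symbol_space m, covering_set f o l = L}.
Proof.
move=> ha; have [i0 pi0 pj] := pmin_attained p.
have pm0 : 0 < pmin p by rewrite -pi0.
have pm1 : pmin p <= 1 by rewrite -pi0.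
have lp0 : ln (pmin p) <= 0 by rewrite -ln1 ler_ln ?posrE.
pose a := (alpha - ln (pmin p)) / 2.
have aa : 0 < a < alpha by rewrite /a; apply/andP; split; lra.
pose I := {KM : nat * nat | admissible l 1 KM}.
pose Miss (i : I) := [set o : g_sigma_algebraType (@cylinders m) | exists2 w, w \in words A (sval i).1 &
   missing w (mkseq (letter_blocks (sval i).1 o) (sval i).2.+1)].
have mM (i : I) w : measurable [set o : g_sigma_algebraType (@cylinders m) |
   missing w (mkseq (letter_blocks (sval i).1 o) (sval i).2.+1)].
  exact: (iid_measurable _ _ (iB (sval i).1)).
have := @ae_frequently _ _ _ P I (fun i => (sval i).1) Miss.
move=> H; apply: filterS (H _ _) => [ o ho|i|K0 e e0].
- rewrite (attractor_coding hlam hf hL); apply/seteqP; split.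
    by move=> x /covering_setP[c <- _]; exists c.
  move=> _ [c _ <-]; apply: covered_of_not_missing => N.
  have [[[K M] adm] /= [NK nM]] := ho N; exists K, M; split => //.
  apply/negP => h; apply: nM; exists (initial_word c K) => //.
  by rewrite mem_words_enum size_initial_word.
- exact: (measure_exists_mem P (words A (sval i).1) (mM i)).1.
- have [||K1 hK1] := @rare m.+1%:R (a + ln (pmin p)) _ _ e e0.
  + by rewrite /a; lra.
  + by rewrite ler1n.
  have [||K [M [KK K0' hM adm]]] := @many_trials R alpha l halpha hl hliminf a 1 (maxn K0 K1) => //.
  have adm' : admissible l 1 (K, M) by split.
  exists (exist _ (K, M) adm') => /=; split; first by apply: leq_trans KK; exact: leq_maxl.
  apply: le_trans (measure_exists_mem P (words A K) (mM (exist _ (K, M) adm'))).2 _ => /=.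
  apply: (@le_trans _ _ (\sum_(w <- words A K) (expR (- expR ((a + ln (pmin p)) * K%:R)))%:E)%E).
    rewrite big_seq [leRHS]big_seq; apply: lee_sum => w wK.
    rewrite (iidP _ _ (iB K)) lee_fin; apply: le_trans (prob_missing M wK) _.
    rewrite ler_expR lerN2 mulrDl expRD.
    have pw : pmin p ^+ K <= pB w.
      rewrite -(size_mem_words wK) /pB; elim: (w) => [|j v IH]; first by rewrite big_nil expr0.
      by rewrite big_cons /= exprS; apply: ler_pM; rewrite ?exprn_ge0 ?(ltW pm0).
    apply: ler_pM; rewrite ?expR_ge0//; first by move: hM; rewrite muln1.
    by rewrite expRM_natr lnK ?posrE.
  rewrite sumEFin lee_fin big_const_seq count_predT iter_addr_0 -[X in X <= _]mulr_natl.
  rewrite size_words size_enum_ord natrX; apply: hK1.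
  by apply: leq_trans KK; exact: leq_maxr.
Qed.

(** The run of [K] letters [i] occurs in time with probability of order
    [(expR a * pmin p) ^+ K], which is summable for [a] between [alpha] and
    [- ln (pmin p)]. *)
Lemma covering_set_not_full : alpha < - ln (pmin p) ->
  {ae P, forall o : symbol_space m, covering_set f o l <> L}.
Proof.
move=> ha; have [i pi0 _] := pmin_attained p.
have pm0 : 0 < pmin p by rewrite -pi0.
pose a := (alpha - ln (pmin p)) / 2.
have [|C C1 [N [N1 N2 N3]]] := few_occurrences halpha hliminf hp hp1 (a := a); first by rewrite /a; lra.
pose q := expR a * pmin p.
have q0 : 0 <= q by rewrite mulr_ge0 ?expR_ge0// ltW.
have q1 : q < 1.
  rewrite /q -[pmin p]lnK ?posrE// -expRD -[X in _ < X]expR0 ltr_expR /a; lra.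
pose Bad K := [set o : g_sigma_algebraType (@cylinders m) |
  occurs l (N K) K (nseq K i) (mkseq o (N K + K))].
have := @ae_eventually _ _ _ P Bad C q.
move=> H; apply: filterS (H _ _ _) => [ o [K0 hK0]|K||K].
- move=> RL; have : covering_set f o l (coding f (fun=> i)).
    by rewrite RL; exact: (coding_in_attractor hlam hf hL).
  move=> /covering_setP[c ci hc].
  have cE := fixed_code_unique hlam hf hosc hL ci.
  have [n0 hn0] := lengths_unbounded halpha hliminf K0.
  have [n nn0 e] := hc n0; apply: (hK0 (l n) (hn0 _ nn0)).
  rewrite /Bad /= (_ : nseq (l n) i = initial_word c (l n)).
    exact: occurs_of_covered.
  by apply: (@eq_from_nth _ i); rewrite ?size_nseq ?size_initial_word// => r rl; rewrite nth_nseq rl nth_mkseq.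
- exact: (iid_measurable _ _ (letters_iid hP)).
- by rewrite q0.
- rewrite (iidP _ _ (letters_iid hP)) lee_fin.
  apply: le_trans (N3 K (nseq K i) _) _.
    by rewrite mem_words_enum size_nseq.
  rewrite ge_min; apply/orP; right; rewrite /q exprMn expRM_natr mulrA.
  rewrite (_ : \prod_(j <- nseq K i) p j = pmin p ^+ K)//.
  by rewrite big_nseq iter_mulr_1 pi0.
Qed.

Variable s0 : R.
Hypotheses (s0_ge0 : 0 <= s0) (hs0 : \sum_i lam i `^ s0 = 1).

(** The expected weight of the missing words is estimated separately for the
    words that are atypical for the weights [lam i `^ s0], by
    [words_chebyshev], and for the typical ones, each of which is missing with
    exponentially small probability. *)
Lemma missing_weight (e : R) : 0 < e -> - \sum_(i < m.+1) lam i `^ s0 * ln (p i) < alpha ->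
  {ae P, forall o : symbol_space m, forall K0, exists KM : nat * nat, [/\ (K0 <= KM.1)%N, admissible l 1 KM &
    \sum_(w <- words A KM.1 | missing w (mkseq (letter_blocks KM.1 o) KM.2.+1)) ratio lam w `^ s0 <= e]}.
Proof.
move=> e0; set c := - _ => ca.
pose th i := lam i `^ s0.
have th0 i : 0 <= th i by exact: powR_ge0.
have th1 : \sum_(i <- A) th i = 1 by rewrite big_enum.
have c0 : 0 <= c.
  rewrite /c oppr_ge0; apply: sumr_le0 => i _; rewrite mulr_ge0_le0 ?powR_ge0//.
  by rewrite -ln1 ler_ln ?posrE.
pose a := (alpha + c) / 2; have aa : 0 < a < alpha by rewrite /a; apply/andP; split; lra.
pose eta := (a - c) / 2; have eta0 : 0 < eta by rewrite /eta /a; lra.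
have mu : - c = \sum_(i <- A) th i * ln (p i) by rewrite opprK big_enum.
have [V hV] := words_chebyshev th0 th1 mu eta0.
pose I := {KM : nat * nat | admissible l 1 KM}.
pose Bad (i : I) := [set o : g_sigma_algebraType (@cylinders m) |
  (e <= \sum_(w <- words A (sval i).1 | missing w (mkseq (letter_blocks (sval i).1 o) (sval i).2.+1)) ratio lam w `^ s0)%R].
have := @ae_frequently _ _ _ P I (fun i => (sval i).1) Bad.
move=> H; apply: filterS (H _ _) => [ o ho K0|i|K0 e1 e10].
- have [[[K M] adm] /= [KK nB]] := ho K0; exists (K, M); split => //=.
  by rewrite leNgt; apply/negP => /ltW.
- exact: (iid_measurable (sval i).2.+1 (fun W => e <= \sum_(w <- words A (sval i).1 | missing w W) ratio lam w `^ s0) (iB (sval i).1)).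
- pose K1 := (Num.truncn ((V + 1 / eta) / (e1 * e))).+1.
  have [||K [M [KK K0' hM adm]]] := @many_trials R alpha l halpha hl hliminf a 1 (maxn K0 K1) => //.
  have adm' : admissible l 1 (K, M) by split.
  exists (exist _ (K, M) adm') => /=; split; first by apply: leq_trans KK; exact: leq_maxl.
  apply: le_trans (iid_markov (iB K) pB0 (words A K) missing M.+1 _ e0) _.
    by move=> w; exact: powR_ge0.
  rewrite lee_fin ler_pdivrMr//.
  have K0r : (0 : R) < K%:R by rewrite ltr0n.
  have K1K : (V + 1 / eta) / K%:R <= e1 * e.
    rewrite ler_pdivrMr// -ler_pdivrMl ?mulr_gt0// [X in X <= _]mulrC.
    apply: ltW; apply: lt_le_trans (truncnS_gt _) _; rewrite ler_nat.
    by apply: leq_trans KK; exact: leq_maxr.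
  apply: le_trans K1K; rewrite mulrDl.
  pose atyp (w : seq 'I_m.+1) := eta * K%:R <= `|\sum_(i <- w) ln (p i) - K%:R * - c|.
  rewrite (bigID atyp)/=; apply: lerD.
    apply: le_trans (hV K K0'); apply: ler_sum => w _.
    rewrite (ratio_powR hlam) -/th ler_piMr//; last exact: word_prob_le1.
    by apply: prodr_ge0 => i _; exact: th0.
  have typ w : w \in words A K -> ~~ atyp w -> word_prob (words A K) pB M.+1 (missing w) <= expR (- (eta * K%:R)).
    move=> wK; rewrite -ltNge ltr_norml => /andP[lo _].
    apply: le_trans (prob_missing M wK) _; rewrite ler_expR lerN2.
    have -> : pB w = expR (\sum_(i <- w) ln (p i)).
      rewrite /pB; elim: (w) => [|j v IH]; first by rewrite !big_nil expR0.
      by rewrite !big_cons expRD IH lnK ?posrE.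
    apply: (@le_trans _ _ (expR (a * K%:R) * expR (\sum_(i <- w) ln (p i)))); last first.
      by rewrite ler_wpM2r ?expR_ge0//; move: hM; rewrite muln1.
    rewrite -expRD; apply: le_trans (expR_ge1Dx _).
    have -> : a = c + 2 * eta by rewrite /eta; lra.
    rewrite mulrDl; lra.
  apply: (@le_trans _ _ (\sum_(w <- words A K | ~~ atyp w) (\prod_(i <- w) th i) * expR (- (eta * K%:R)))).
    apply: ler_sum_mem => w wK tw; rewrite (ratio_powR hlam) -/th ler_wpM2l ?typ//.
    by apply: prodr_ge0 => i _; exact: th0.
  rewrite -mulr_suml; apply: (@le_trans _ _ (1 * expR (- (eta * K%:R)))).
    rewrite ler_wpM2r ?expR_ge0//.
    have := word_prob_le1 th0 th1 K (fun w => ~~ atyp w); exact.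
  have eK : 0 < eta * K%:R by exact: mulr_gt0.
  rewrite mul1r expRN -[_ / K%:R]invrK invfM invrK div1r invrK lef_pV2 ?posrE ?expR_gt0//.
  by apply: le_trans (expR_ge1Dx _); rewrite lerDr.
Qed.

(** Choose lengths [KM J] at which the missing words have weight at most
    [e / 2 ^ J.+1].  A code none of whose long initial words is ever hit at an
    admissible length is, at each length [KM J], a missing word; so the missing
    words of all these lengths cover the rest of the attractor. *)
Lemma covering_set_full_measure : - \sum_(i < m.+1) lam i `^ s0 * ln (p i) < alpha ->
  {ae P, forall o : symbol_space m,
    hausdorff_measure s0 (covering_set f o l) = hausdorff_measure s0 L}.
Proof.
move=> ca.
have inv0 n : 0 < n.+1%:R^-1 :> R by rewrite invr_gt0.
apply: filterS (ae_foralln (fun n => missing_weight (inv0 n) ca)) => o ho.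
have RL : covering_set f o l `<=` L.
  by move=> x /covering_setP[c <- _]; exact: (coding_in_attractor hlam hf hL).
apply/eqP; rewrite eq_le hausdorff_measure_mono//=.
rewrite -[X in (hausdorff_measure _ X <= _)%E](setDUK RL).
apply: hausdorff_measure_setU_null.
apply: (word_cover_null hlam hf hL s0_ge0) => e L0 e0.
have /choice[KM hKM] J : exists KM : nat * nat, [/\ (maxn J L0 <= KM.1)%N, admissible l 1 KM &
    \sum_(w <- words A KM.1 | missing w (mkseq (letter_blocks KM.1 o) KM.2.+1)) ratio lam w `^ s0 <= e / (2 ^ J.+1)%:R].
  have e1 : 0 < e / (2 ^ J.+1)%:R by rewrite divr_gt0// ltr0n expn_gt0.
  have [n hn] : exists n : nat, n.+1%:R^-1 <= e / (2 ^ J.+1)%:R.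
    have [n _ h] := near_infty_natSinv_lt (PosNum e1); exists n; exact/ltW/(h n (leqnn n)).
  have [KM [h1 h2 h3]] := ho n (maxn J L0); exists KM; split => //; exact: le_trans hn.
exists (fun J => [seq w <- words A (KM J).1 | missing w (mkseq (letter_blocks (KM J).1 o) (KM J).2.+1)]); split.
- move=> x [Lx nRx]; have [c cx] : exists c, coding f c = x.
    by move: Lx; rewrite (attractor_coding hlam hf hL) => -[c _ <-]; exists c.
  have [J hJ] : exists J, forall K M, (J <= K)%N -> admissible l 1 (K, M) ->
      missing (initial_word c K) (mkseq (letter_blocks K o) M.+1).
    apply: contrapT => no; apply: nRx; rewrite -cx; apply: covered_of_not_missing => N.
    apply: contrapT => no2; apply: no; exists N => K M NK adm.
    by apply: contrapT => /negP h; apply: no2; exists K, M.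
  have [h1 h2 _] := hKM J; exists J, (initial_word c (KM J).1); split; last first.
    by rewrite -cx; exact: (coding_in_word hlam hf hL).
  rewrite mem_filter mem_words_enum size_initial_word eqxx andbT; apply: hJ.
    by apply: leq_trans h1; exact: leq_maxl.
  by rewrite -surjective_pairing.
- move=> J w; rewrite mem_filter mem_words_enum => /andP[_ /eqP ->].
  by have [h1 _ _] := hKM J; apply: leq_trans h1; exact: leq_maxr.
- move=> n; apply: (@le_trans _ _ (\sum_(J < n) e / (2 ^ J.+1)%:R)).
    by apply: ler_sum => J _; rewrite big_filter; have [] := hKM J.
  rewrite -lee_fin -sumEFin; apply: le_trans (epsilon_trick0 xpredT (ltW e0)).
  rewrite -(big_mkord xpredT (fun J => (e / (2 ^ J.+1)%:R)%:E)).
  apply: nneseries_lim_ge => k _ _; rewrite lee_fin divr_ge0// ltW//.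
Qed.

(** The two bounds hold off a null set for each exponent, and a sequence of
    exponents tending to the value suffices. *)
Lemma hausdorff_dim_covering_set :
  {ae P, forall o : symbol_space m,
    hausdorff_dim (covering_set f o l) = (dim_formula lam p alpha)%:E}.
Proof.
set D := dim_formula lam p alpha.
have D0 : 0 <= D by apply: dim_formula_ge0.
have up n : {ae P, forall o : symbol_space m, hausdorff_measure (D + n.+1%:R^-1) (covering_set f o l) = 0%E}.
  by apply: (covering_set_measure_eq0 hlam hf hL halpha hliminf hp hp1 hP); rewrite ltrDl invr_gt0.
have lo n : {ae P, forall o : symbol_space m, forall s, 0 <= s <= D - n.+1%:R^-1 ->
    hausdorff_measure s (covering_set f o l) <> 0%E}.
  have [h|h] := leP 0 (D - n.+1%:R^-1).
    by apply: (covering_set_measure_neq0 hlam hf hosc hL halpha hl hliminf hp hp1 hP); rewrite h gtrBl invr_gt0/=.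
  by apply: aeW => o s /andP[s0' sD]; have := le_lt_trans (le_trans s0' sD) h; rewrite ltxx.
apply: filterS2 (ae_foralln up) (ae_foralln lo) => o ho1 ho2.
have small (e : R) : 0 < e -> exists n : nat, n.+1%:R^-1 < e.
  by move=> e0; have [n _ h] := near_infty_natSinv_lt (PosNum e0); exists n; exact: (h n (leqnn n)).
apply/eqP; rewrite eq_le; apply/andP; split.
  apply/lee_addgt0Pr => e e0; have [n hn] := small e e0.
  apply: (@le_trans _ _ (D + n.+1%:R^-1)%:E).
    apply: ereal_inf_lbound; exists (D + n.+1%:R^-1) => //; split => //.
    by rewrite addr_ge0.
  by rewrite -EFinD lee_fin lerD2l ltW.
apply: hausdorff_dim_ge => s /andP[s0' sD].
have [|n hn] := small (D - s); first by rewrite subr_gt0.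
by apply: (ho2 n); rewrite s0' /= lerBrDl -lerBrDr ltW.
Qed.

End Large.

Theorem theorem1p2 (R : realType) (d m : nat)
    (f : 'I_m.+1 -> 'rV[R]_d -> 'rV[R]_d) (lam : 'I_m.+1 -> R)
    (hlam : forall i, 0 < lam i < 1)
    (hf : forall i, similarity (f i) (lam i))
    (hosc : open_set_condition f)
    (Lam : set 'rV[R]_d) (hLam : attractor f Lam)
    (s0 : R) (hs0 : hausdorff_dim Lam = s0%:E)
    (alpha : R) (halpha : 0 < alpha)
    (l : nat -> nat) (hl : {homo l : n n' / (n <= n')%N})
    (hliminf : limn_einf (fun n : nat => ((l n)%:R / ln (n%:R : R))%:E)
               = (1 / alpha)%:E)
    (p : 'I_m.+1 -> R) (hp : forall i, 0 < p i)
    (hp1 : \sum_(i < m.+1) p i = 1)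
    (P : probability (g_sigma_algebraType (@cylinders m)) R)
    (hP : bernoulli_measure p P) :
  {ae P, forall o : symbol_space m,
     hausdorff_dim (covering_set f o l) = (dim_formula lam p alpha)%:E}
  /\
  {ae P, forall o : symbol_space m,
     (- \sum_(i < m.+1) lam i `^ s0 * ln (p i) < alpha < - ln (pmin p) ->
        hausdorff_measure s0 (covering_set f o l) = hausdorff_measure s0 Lam /\
        covering_set f o l <> Lam)
     /\
     (- ln (pmin p) < alpha -> covering_set f o l = Lam)}.
Proof.
split; first exact: (hausdorff_dim_covering_set hlam hf hosc hLam halpha hl hliminf hp hp1 hP).
have [s00 s0E] := moran hlam hf hLam hosc hs0.
have aeF := ae_filter_ringOfSetsType P.
have full := covering_set_full hlam hf hLam halpha hl hliminf hp hp1 hP.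
have [h1|h1] := ltP (- \sum_(i < m.+1) lam i `^ s0 * ln (p i)) alpha; last first.
  have [h2|h2] := ltP (- ln (pmin p)) alpha; last by apply: aeW => o; split.
  by have F := full h2; apply: filterS F => o ->; split.
have [h2|h2] := ltP alpha (- ln (pmin p)).
  have F := covering_set_full_measure hlam hf hLam halpha hl hliminf hp hp1 hP s00 s0E h1.
  have G := covering_set_not_full hlam hf hosc hLam halpha hliminf hp hp1 hP h2.
  apply: filterS2 F G => o e1 e2; split=> // h3.
  by have := lt_trans h2 h3; rewrite ltxx.
have [h3|h3] := ltP (- ln (pmin p)) alpha; last by apply: aeW => o; split.
by have F := full h3; apply: filterS F => o ->; split.
Qed.
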